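(* For each $n\ge1$ let $V_n$ be a finite set, $K_n$ a sub-stochastic matrix on $V_n$, $\nu_n$ the uniform law on $V_n$ and $\lambda_n\in(0,\infty)$, and suppose that $(V_n,K_n)_{n\ge1}$ is one of the following: (a) $\mathbb G$ is a fixed infinite connected non-amenable graph with bounded degrees, $V_n$ is an arbitrary $n$-element set of vertices of $\mathbb G$, $K_n=P_{\mathbb G}[V_n]$; set $w_n=n\sqrt{\log n}$. (b) $G_n$ is a connected vertex-transitive graph on $n+1$ vertices, $V_n$ is obtained from its vertex set by removing one vertex, $K_n=P_{G_n}[V_n]$; set $w_n=\sqrt n$. (c) $d\in\mathbb N$ is fixed, $G_n$ is a graph on $n+1$ vertices with one vertex of degree $n$ (the sink) and all others of degree at most $d$, $V_n$ is obtained from its vertex set by removing the sink, $K_n=P_{G_n}[V_n]$; set $w_n=n\sqrt{\log n}$. (d) $d\ge1$ is fixed, $V_n=\{x\in\mathbb Z^d\colon x_1^2+\cdots+x_d^2\le n^2\}$, $K_n=P_{\mathbb Z^d}[V_n]$; set $w_n=\sqrt{n^dg_d(n)}$, where $g_1(n)=1$, $g_2(n)=n\log n$, and $g_d(n)=n^{d-1}$ for $d\ge3$. If $\lambda_n/|V_n|\to\infty$ as $n\to\infty$, then the sequence of $\mathrm{ARW}(K_n,\lambda_n,\nu_n)$ chains exhibits a total-variation cutoff, with the same location as the separation cutoff, i.e. $t_{\mathrm{mix}}^{(n)}=(1+o(1))\,t_{\mathrm{sep}}^{(n)}$ (so that $t_{\mathrm{mix}}^{(n)}=\Theta(n\log n)$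 in cases (a) and (c), and $t_{\mathrm{mix}}^{(n)}=|V_n|+o(|V_n|)$ in cases (b) and (d)), and with window $O(w_n)$.
   Context: Graph notions: for a graph $G$, $P_{G}(x,y)=1/\deg(x)$ if $\{x,y\}$ is an edge and $0$ otherwise, and $P_G[V]$ denotes the restriction of $P_G$ to $V^2$ ($\mathbb Z^d$ is the nearest-neighbor lattice). An infinite graph is non-amenable if $\inf\{|\partial V|/|V|\}>0$ over finite non-empty vertex sets $V$, where $\partial V$ is the set of vertices outside $V$ having a neighbor in $V$. A graph is vertex-transitive if any vertex can be mapped to any other by a graph automorphism. Given a finite set $V$ and a sub-stochastic matrix $K\colon V^2\to[0,1]$ (i.e. $\sum_{y}K(x,y)\le1$) having no stochastic principal sub-matrix, a $K$-walk is the killed random walk which, when alive at $x$, jumps to $y\in V$ at rate $K(x,y)$ and is killed at rate $1-\sum_yK(x,y)$. ARW dynamics with sleeping rate $\lambda\in(0,\infty)$: a configuration is $\eta\in\{0,\mathrm s,1,2,\ldots\}^V$; the site $x$ is empty if $\eta(x)=0$, holds one sleeping particle if $\eta(x)=\mathrm s$, and holds $k\ge1$ active particles if $\eta(x)=k$. In continuous time, active particles perform independent $K$-walks (a killed particle is removed), but fall asleep at rate $\lambda$ when alone on a site; sleeping particles do not move, but become active upon contact with another particle. Configurations in $\{0,\mathrm s\}^V$ are stable, and from any configuration with finitely many particles the process is almost surely absorbed in a stable configuration. The $\mathrm{ARW}(K,\lambda,\nu)$ chain is the discrete-time Markov chain on $\mathcal X=\{0,\mathrm s\}^V$ which at each step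 adds one active particle to the current state at an independent $\nu$-distributed random site and then runs the ARW dynamics until a stable configuration is obtained; the latter is the new state. Its transition matrix $P$ is irreducible and aperiodic, with unique invariant distribution $\pi$. $d_{\mathrm{sep}}(t):=\max_{\eta,\eta'\in\mathcal X}\big(1-\frac{P^t(\eta,\eta')}{\pi(\eta')}\big)$ and $t_{\mathrm{sep}}:=\inf\{t\in\mathbb N\colon d_{\mathrm{sep}}(t)\le1/2\}$; $d_{\mathrm{tv}}(t):=\max_{\eta\in\mathcal X,A\subseteq\mathcal X}|P^t(\eta,A)-\pi(A)|$, $t_{\mathrm{mix}}(\varepsilon):=\min\{t\in\mathbb N\colon d_{\mathrm{tv}}(t)\le\varepsilon\}$, $t_{\mathrm{mix}}:=t_{\mathrm{mix}}(1/2)$; here $\mathbb N=\{0,1,2,\dots\}$. Quantities of the $n$-th chain carry the superscript $(n)$. A sequence of chains exhibits total-variation cutoff if for any fixed $\alpha\ge0$, $d_{\mathrm{tv}}^{(n)}(\lfloor\alpha t_{\mathrm{mix}}^{(n)}\rfloor)$ tends to $1$ if $\alpha<1$ and to $0$ if $\alpha>1$; it has window $O(w_n)$ if moreover, for every fixed $\varepsilon\in(0,1/2)$, $t_{\mathrm{mix}}^{(n)}(\varepsilon)-t_{\mathrm{mix}}^{(n)}(1-\varepsilon)=O(w_n)$. *)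

(* Defs.v *)
From HB Require Import structures.
From mathcomp Require Import all_boot all_order all_algebra.
From mathcomp Require Import finmap.
From mathcomp Require Import all_classical all_reals all_analysis.

Set Implicit Arguments.
Unset Strict Implicit.
Unset Printing Implicit Defensive.

Import Order.TTheory GRing.Theory Num.Theory.
Import numFieldNormedType.Exports.

Local Open Scope classical_set_scope.
Local Open Scope ring_scope.

Section ActivatedRandomWalk.
Context {R : realType} {V : finType}.
Variables (K : V -> V -> R) (lam : R) (nu : V -> R).

(* [None] is one sleeping particle; [Some k] is k active particles, so that
   [Some 0] is the empty site. *)
Definition config : Type := {ffun V -> option nat}.

Definition active_at (eta : config) (x : V) : nat := odflt 0%N (eta x).

Definition put (eta : config) (x : V) (s : option nat) : config :=
  [ffun z => if z == x then s else eta z].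

(* A sleeping particle is awakened by the incoming one, whence [Some 2]. *)
Definition add_active (eta : config) (x : V) : config :=
  put eta x (if eta x is Some k then Some k.+1 else Some 2%N).

Definition remove_active (eta : config) (x : V) : config :=
  put eta x (omap predn (eta x)).

(* Infinitesimal generator of the continuous-time dynamics. *)
Definition arw_generator (f : config -> R) (eta : config) : R :=
  \sum_(x : V)
    ((active_at eta x)%:R *
       (\sum_(y : V) K x y *
            (f (add_active (remove_active eta x) y) - f eta)
        + (1 - \sum_(y : V) K x y) * (f (remove_active eta x) - f eta))
     + (if eta x == Some 1%N then lam * (f (put eta x None) - f eta) else 0)).

(* The Markov semigroup exp (t L) of the generator L. The number of particles
   never increases, so only finitely many configurations are reachable from
   [eta] and the exponential series converges for every [f]. *)
Definition arw_semigroup (t : R) (f : config -> R) (eta : config) : R :=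
  limn (series (fun k : nat => t ^+ k / k`!%:R * iter k arw_generator f eta)).

(* Stable configurations, [true] meaning one sleeping particle. *)
Definition stable : finType := {ffun V -> bool}.

Definition config_of_stable (s : stable) : config :=
  [ffun x => if s x then None else Some 0%N].

(* Probability that the dynamics started from [eta] is absorbed in [s]. *)
Definition absorption (eta : config) (s : stable) : R :=
  lim (arw_semigroup t (fun zeta => (zeta == config_of_stable s)%:R) eta
         @[t --> +oo]).

Definition arw (s s' : stable) : R :=
  \sum_(x : V) nu x * absorption (add_active (config_of_stable s) x) s'.

End ActivatedRandomWalk.

Definition uniform_law (R : realType) (V : finType) : V -> R :=
  fun=> #|V|%:R^-1.

Section MixingTimes.
Context {R : realType} {S : finType}.
Variables (P : S -> S -> R) (pi : S -> R).

Definition stationary : Prop :=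
  [/\ forall x, 0 <= pi x, \sum_x pi x = 1
    & forall y, \sum_x pi x * P x y = pi y].

Fixpoint kernel_pow (t : nat) (x y : S) : R :=
  if t is t'.+1 then \sum_z P x z * kernel_pow t' z y else (x == y)%:R.

(* The default value 0 does not affect the maximum: the [pi]-average over y of
   the quantity maximised is 0. *)
Definition dsep (t : nat) : R :=
  \big[Num.max/0]_(x : S) \big[Num.max/0]_(y : S)
    (1 - kernel_pow t x y / pi y).

Definition dtv (t : nat) : R :=
  \big[Num.max/0]_(x : S) \big[Num.max/0]_(A : {set S})
    `|\sum_(y in A) kernel_pow t x y - \sum_(y in A) pi y|.

(* Least natural number satisfying [p], and 0 if there is none. *)
Definition least (p : pred nat) : nat :=
  if pselect (exists t, p t) is left h then ex_minn h else 0%N.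

Definition tsep : nat := least (fun t => dsep t <= 2^-1).

Definition tmix (eps : R) : nat := least (fun t => dtv t <= eps).

End MixingTimes.

Section Cutoff.
Context {R : realType} {S : nat -> finType}.
Variables (P : forall n, S n -> S n -> R) (pi : forall n, S n -> R).

Definition tv_cutoff : Prop :=
  forall alpha : R, 0 <= alpha ->
    let d n := dtv (@P n) (@pi n)
                 (Num.truncn (alpha * (tmix (@P n) (@pi n) 2^-1)%:R)) in
    (alpha < 1 -> d n @[n --> \oo] --> (1 : R)) /\
    (1 < alpha -> d n @[n --> \oo] --> (0 : R)).

Definition cutoff_window (w : nat -> R) : Prop :=
  forall eps : R, 0 < eps -> eps < 2^-1 ->
    (fun n => (tmix (@P n) (@pi n) eps)%:R - (tmix (@P n) (@pi n) (1 - eps))%:R : R)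
      =O_\oo w.

End Cutoff.

Section Graphs.
Context {R : realType} {G : choiceType}.
Variable e : rel G.

Definition simple_graph : Prop := symmetric e /\ irreflexive e.

Definition connected_graph : Prop :=
  forall x y, exists2 p, path e x p & last x p = y.

Definition neighbors (x : G) : set G := [set y | e x y].

(* Meaningful for locally finite graphs only: [fset_set] sends infinite sets
   to the empty one. *)
Definition degree (x : G) : nat := #|` fset_set (neighbors x)|.

Definition bounded_degree : Prop :=
  exists D : nat, forall x, finite_set (neighbors x) /\ (degree x <= D)%N.

Definition vertex_transitive : Prop :=
  forall x y, exists f : G -> G,
    [/\ bijective f, forall u v, e (f u) (f v) = e u v & f x = y].

Definition outer_boundary (A : {fset G}) : set G :=
  [set y | y \notin A /\ exists2 x, x \in A & e x y].

Definition non_amenable : Prop :=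
  0 < inf [set r : R | exists2 A : {fset G}, A != fset0
             & r = #|` fset_set (outer_boundary A)|%:R / #|` A|%:R].

Definition srw (x y : G) : R := if e x y then (degree x)%:R^-1 else 0.

Definition srw_on (A : {fset G}) (x y : A) : R := srw (val x) (val y).

End Graphs.

Definition lattice_edge (d : nat) (x y : 'rV[int]_d) : bool :=
  \sum_(i < d) `|x 0 i - y 0 i| == 1.

Definition ball_g (R : realType) (d n : nat) : R :=
  match d with
  | 1 => 1
  | 2 => n%:R * ln n%:R
  | _ => n%:R ^+ d.-1
  end.

(* In each setting the data are constrained for n >= 1 only. *)

Inductive setting_a (R : realType) :
    forall V : nat -> finType, (forall n, V n -> V n -> R) ->
      (nat -> R) -> Prop :=
  SettingA (G : choiceType) (e : rel G) (V : nat -> {fset G}) of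
    simple_graph e & infinite_set [set: G] & connected_graph e
    & bounded_degree e & non_amenable (R := R) e
    & (forall n, (0 < n)%N -> #|` V n| = n) :
  @setting_a R (fun n => V n) (fun n => @srw_on R G e (V n))
    (fun n => n%:R * Num.sqrt (ln n%:R)).

Inductive setting_b (R : realType) :
    forall V : nat -> finType, (forall n, V n -> V n -> R) ->
      (nat -> R) -> Prop :=
  SettingB (G : nat -> finType) (e : forall n, rel (G n))
    (o : forall n, G n) (V : forall n, {fset G n}) of
    (forall n, (0 < n)%N ->
       [/\ simple_graph (e n), connected_graph (e n),
           vertex_transitive (e n), #|G n| = n.+1
         & forall x, (x \in V n) = (x != o n)]) :
  @setting_b R (fun n => V n) (fun n => @srw_on R (G n) (e n) (V n))
    (fun n => Num.sqrt n%:R).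

Inductive setting_c (R : realType) :
    forall V : nat -> finType, (forall n, V n -> V n -> R) ->
      (nat -> R) -> Prop :=
  SettingC (d : nat) (G : nat -> finType) (e : forall n, rel (G n))
    (o : forall n, G n) (V : forall n, {fset G n}) of
    (forall n, (0 < n)%N ->
       [/\ simple_graph (e n), #|G n| = n.+1, degree (e n) (o n) = n,
           (forall x, x != o n -> (degree (e n) x <= d)%N)
         & forall x, (x \in V n) = (x != o n)]) :
  @setting_c R (fun n => V n) (fun n => @srw_on R (G n) (e n) (V n))
    (fun n => n%:R * Num.sqrt (ln n%:R)).

Inductive setting_d (R : realType) :
    forall V : nat -> finType, (forall n, V n -> V n -> R) ->
      (nat -> R) -> Prop :=
  SettingD (d : nat) (V : nat -> {fset 'rV[int]_d}) of
    (0 < d)%N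
    & (forall n, (0 < n)%N -> forall x : 'rV[int]_d,
         (x \in V n) = (\sum_(i < d) x 0 i ^+ 2 <= n%:R ^+ 2)) :
  @setting_d R (fun n => V n)
    (fun n => @srw_on R 'rV[int]_d (@lattice_edge d) (V n))
    (fun n => Num.sqrt (n%:R ^+ d * ball_g R d n)).

(* Main.v *)
(* By the abelian property the final state does not depend on the order of
   topplings. Add [t] uniform particles to the empty state and let them first
   perform internal aggregation (each walks until it finds a vacant site), and
   stabilize only then. If all sites have been occupied, the final state has
   the stationary law [target], whatever the initial state was; hence [dsep t]
   is exactly the probability [surv t] that a site is still vacant. Comparing
   at the fully sleeping state, which is reached only through full occupation
   and has stationary mass at least [1 - |V| / (1 + lam)], shows that [dtv t]
   is asymptotically [surv t] too when [lam / |V|] tends to infinity.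

   It remains to see that the filling time [T] is concentrated. The mean
   filling time [m] from a given set decreases by a quantity in [0, r] when a
   particle is added, where [1 / r] bounds from below the probability, for each
   site [y], that the next particle settles at [y] when [y] is the only vacant
   site; hence the variance of [T] is at most [r m]. The quantity [r] is
   governed by the sums [\sum_x hit y x] of the probabilities of ever visiting
   [y]. In settings (a) and (c) these sums are bounded for many [y], which
   makes [T] comparable with a coupon collector time, so that [r = n] and [m]
   is of order [n ln n]. In settings (b) and (d) they are large, and an
   exponential moment bound on the number of particles that could have visited
   [y] yields [m] equivalent to [|V|]. *)

Require Import Defs.
From HB Require Import structures.
From mathcomp Require Import all_boot all_order all_algebra.
From mathcomp Require Import finmap.
From mathcomp Require Import all_classical all_reals all_analysis.
From mathcomp Require Import ring lra zify.

Set Implicit Arguments.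
Unset Strict Implicit.
Unset Printing Implicit Defensive.

Import Order.TTheory GRing.Theory Num.Theory.
Import numFieldNormedType.Exports.

Local Open Scope ring_scope.

(** * The killed walk and internal aggregation *)

Section Dirichlet.
Context {R : realType} {V : finType}.
Implicit Types (K : V -> V -> R) (C A : {set V}) (u b : V -> R).

(** No probability space appears: each process is an operator on functions of its state ([settle],
    [grow], [topple], [arw_generator]), and probabilities are iterates of it on indicators. The
    abelian property is used through [toppling_inv]: a bounded function that every legal toppling
    preserves in mean is determined by its values at stable configurations ([inv_stab]), and adding
    a particle preserves this invariance. Two obstacles have to be removed. [absorption] is a limit
    of power series of the continuous-time generator; uniformization on configurations with
    boundedly many particles identifies it with the toppling limit [stab]. And particles may sleep:
    but a sleep instruction has no effect at a site with two or more active particles, so a particle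
    added on top of active ones performs a pure [K]-walk, which is what makes internal aggregation
    appear. In settings (a), (c) and (d) the hitting sums come from one duality identity,
    [hit_duality], tested against different functions. *)

Definition transient K : Prop :=
  [/\ forall x y, 0 <= K x y, forall x, \sum_y K x y <= 1
    & forall Z : {set V}, Z != finset.set0 ->
        exists2 x, x \in Z & \sum_(y in Z) K x y < 1].

(** At a positive maximum the inequality is an equality, so no mass of [K] is killed or leaves the
    set of maximum points: this set would carry a stochastic principal sub-matrix. *)
Lemma max_principle K C u : transient K ->
  (forall x, x \in C -> u x <= \sum_y K x y * u y) ->
  (forall x, x \notin C -> u x <= 0) -> forall x, u x <= 0.
Proof.
move=> [K0 K1 KZ] uC u0 x0; rewrite leNgt; apply/negP => ux0.
pose m := [arg max_(i > x0) u i]%O.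
have um y : u y <= u m by rewrite /m; case: arg_maxP => // i _; apply.
have m0 : 0 < u m by apply: lt_le_trans (um x0).
pose Z := [set x | u x == u m]%SET.
have [] := KZ Z; first by apply/set0Pn; exists m; rewrite inE.
move=> x; rewrite inE => /eqP xm; rewrite ltNge => /negP; apply.
have xC : x \in C by apply: contraTT m0 => /u0; rewrite xm -leNgt.
have key : \sum_y K x y * (u m - u y) + (1 - \sum_y K x y) * u m <= 0.
  have := uC _ xC; rewrite xm => h.
  under eq_bigr do rewrite mulrBr.
  rewrite sumrB -mulr_suml; lra.
have t1 y : 0 <= K x y * (u m - u y) by rewrite mulr_ge0 ?subr_ge0.
have t2 : 0 <= (1 - \sum_y K x y) * u m by rewrite mulr_ge0 ?subr_ge0 // ltW.
have s1 : 0 <= \sum_y K x y * (u m - u y) by apply: sumr_ge0.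
have /eqP : \sum_y K x y * (u m - u y) = 0 by apply/eqP; rewrite eq_le s1 andbT; lra.
rewrite psumr_eq0 // => /allP z1.
have : (1 - \sum_y K x y) * u m = 0 by apply/eqP; rewrite eq_le t2 andbT; lra.
move/eqP; rewrite mulf_eq0 (gt_eqF m0) orbF subr_eq0 => /eqP ->.
rewrite (bigID (mem Z)) /= [X in _ + X]big1 ?addr0 // => y yZ.
have /(_ (mem_index_enum y)) := z1 y; rewrite mulf_eq0 subr_eq0 => /orP[/eqP//|].
by rewrite eq_sym => yM; rewrite inE yM in yZ.
Qed.

Lemma dirichlet_unique K C b u v : transient K ->
  (forall x, x \in C -> u x = \sum_y K x y * u y + b x) ->
  (forall x, x \in C -> v x = \sum_y K x y * v y + b x) ->
  (forall x, x \notin C -> u x = v x) -> u =1 v.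
Proof.
move=> Kt hu hv huv x; apply/eqP; rewrite eq_le -subr_le0 -[X in _ && X]subr_le0.
have aux (f g : V -> R) :
    (forall x, x \in C -> f x = \sum_y K x y * f y + b x) ->
    (forall x, x \in C -> g x = \sum_y K x y * g y + b x) ->
    (forall x, x \notin C -> f x = g x) -> f x - g x <= 0.
  move=> hf hg hfg; apply: (max_principle (C := C) (u := fun x => f x - g x) Kt).
    move=> y yC; rewrite hf // hg //; under [leRHS]eq_bigr do rewrite mulrBr.
    by rewrite sumrB opprD addrACA subrr addr0.
  by move=> y yC; rewrite hfg ?subrr.
by rewrite !aux // => y yC; rewrite huv.
Qed.

(** Uniqueness makes a square matrix injective, hence invertible. [B] is the transpose of the system
    because row vectors multiply it from the left. *)
Lemma dirichlet_ex K C b : transient K ->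
  exists u, forall x, u x = (if x \in C then \sum_y K x y * u y else 0) + b x.
Proof.
move=> Kt.
pose B : 'M[R]_#|V| := \matrix_(j, i) ((i == j)%:R -
   if enum_val i \in C then K (enum_val i) (enum_val j) else 0).
have prodE (v : 'rV[R]_#|V|) i : (v *m B) 0 i = v 0 i -
    if enum_val i \in C then \sum_y K (enum_val i) y * v 0 (enum_rank y) else 0.
  rewrite !mxE; under eq_bigr do rewrite mxE mulrBr.
  rewrite sumrB; congr (_ - _).
    rewrite (bigD1 i) //= eqxx mulr1 big1 ?addr0 // => j ji.
    by rewrite eq_sym (negPf ji) mulr0.
  case: ifP => _; last by rewrite big1 // => j _; rewrite mulr0.
  rewrite [RHS](reindex (@enum_val V predT)) /=; last first.
    by apply: onW_bij; apply: enum_val_bij.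
  by apply: eq_bigr => j _; rewrite mulrC enum_valK.
have Bu : B \in unitmx.
  rewrite -row_free_unit; apply: inj_row_free => v vB0; apply/rowP => i.
  rewrite mxE -(enum_valK i).
  have h y : v 0 (enum_rank y) =
     if y \in C then \sum_z K y z * v 0 (enum_rank z) else 0.
    apply/eqP; rewrite -subr_eq0 -{2 3}(enum_rankK y) -prodE vB0 mxE //.
  apply: (@dirichlet_unique K C (fun=> 0) (fun y => v 0 (enum_rank y)) (fun=> 0) Kt).
  - by move=> x xC; rewrite {1}h xC addr0.
  - by move=> x xC; rewrite big1 ?addr0 // => y _; rewrite mulr0.
  - by move=> x xC; rewrite h (negPf xC).
pose v := (\row_i b (enum_val i)) *m invmx B.
exists (fun x => v 0 (enum_rank x)) => x.
have := prodE v (enum_rank x); rewrite /v mulmxKV // mxE !enum_rankK => ->.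
by rewrite addrCA subrr addr0.
Qed.

End Dirichlet.

(** * Settling of one particle and the growth of the occupied set *)

Section Settling.
Context {R : realType} {V : finType} {K : V -> V -> R} (Kt : transient K).
Implicit Types (A B : {set V}) (h g : {set V} -> R).

Let K_le1 : forall x, \sum_y K x y <= 1. Proof. by case: Kt. Qed.

(* Probability that the walk started at the last argument leaves [A] by
   jumping to [z]; it is [0] if [z \in A]. *)
Definition exit A (z : V) : V -> R :=
  projT1 (cid (dirichlet_ex A (fun x => ((x \notin A) && (x == z))%:R) Kt)).

Lemma exit_in A z x : x \in A -> exit A z x = \sum_y K x y * exit A z y.
Proof. by rewrite /exit; case: cid => u /= uE xA; rewrite uE xA addr0. Qed.

Lemma exit_out A z x : x \notin A -> exit A z x = (x == z)%:R.
Proof. by rewrite /exit; case: cid => u /= uE xA; rewrite uE xA (negPf xA) add0r. Qed.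

Lemma exit_ge0 A z x : 0 <= exit A z x.
Proof.
rewrite -oppr_le0; apply: (max_principle (C := A) (u := fun x => - exit A z x) Kt).
  by move=> y yA; rewrite {1}exit_in // -sumrN; apply: ler_sum => w _; rewrite mulrN.
by move=> y yA; rewrite exit_out // oppr_le0.
Qed.

Lemma exit_sum_le1 A x : \sum_z exit A z x <= 1.
Proof.
rewrite -subr_le0.
apply: (max_principle (C := A) (u := fun x => \sum_z exit A z x - 1) Kt).
  move=> y yA; under eq_bigr do rewrite exit_in //.
  under [leRHS]eq_bigr do rewrite mulrBr mulr1 mulr_sumr.
  by rewrite exchange_big /= sumrB lerD2l lerN2.
move=> y yA; under eq_bigr do rewrite exit_out //.
by rewrite (bigD1 y) //= eqxx big1 ?addr0 ?subrr // => i; rewrite eq_sym => /negPf ->.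
Qed.

Lemma exit_target_in A z x : z \in A -> exit A z x = 0.
Proof.
move=> zA; apply: (@dirichlet_unique _ _ K A (fun=> 0) (exit A z) (fun=> 0) Kt).
- by move=> y yA; rewrite {1}exit_in // addr0.
- by move=> y yA; rewrite big1 ?addr0 // => w _; rewrite mulr0.
- by move=> y yA; rewrite exit_out //; case: eqP => // yz; rewrite yz zA in yA.
Qed.

(* A particle added at [x] walks until it leaves [A], and is then added to [A];
   [settle h A x] is the mean of [h] at the resulting set. *)
Definition settle h A (x : V) : R := h A + \sum_z exit A z x * (h (z |: A)%SET - h A).

Lemma settle_out h A x : x \notin A -> settle h A x = h (x |: A)%SET.
Proof.
move=> xA; rewrite /settle (bigD1 x) //= exit_out // eqxx mul1r big1 => [|z zx].
  by rewrite addr0 addrCA subrr addr0.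
by rewrite exit_out // eq_sym (negPf zx) mul0r.
Qed.

Lemma settle_in h A x : x \in A ->
  settle h A x = \sum_y K x y * settle h A y + (1 - \sum_y K x y) * h A.
Proof.
move=> xA; rewrite /settle; under [in RHS]eq_bigr do rewrite mulrDr.
rewrite big_split /= -mulr_suml.
have -> : \sum_z exit A z x * (h (z |: A)%SET - h A) =
    \sum_y K x y * \sum_z exit A z y * (h (z |: A)%SET - h A).
  under [RHS]eq_bigr do rewrite mulr_sumr.
  rewrite exchange_big /=; apply: eq_bigr => z _.
  by rewrite exit_in // mulr_suml; apply: eq_bigr => y _; rewrite mulrA.
lra.
Qed.

Lemma settle_unique h A (u : V -> R) :
  (forall x, x \in A -> u x = \sum_y K x y * u y + (1 - \sum_y K x y) * h A) ->
  (forall x, x \notin A -> u x = h (x |: A)%SET) -> forall x, u x = settle h A x.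
Proof.
move=> uA uC; apply: (dirichlet_unique Kt uA); first by move=> x; apply: settle_in.
by move=> x xA; rewrite uC // settle_out.
Qed.

(** Abelian property of internal aggregation: the two particles may settle in either order. *)
Lemma settle_comm h A x y :
  settle (fun B => settle h B x) A y = settle (fun B => settle h B y) A x.
Proof.
pose U x y := settle (fun B => settle h B y) A x; rewrite -/(U y x) -/(U x y).
(* A particle starting at a vacant site stays there, and both sides solve the same Dirichlet problem
   in the start of the other one. *)
have half a b : a \notin A -> U a b = U b a.
  move=> aA; apply: (settle_unique (u := U a)) => {}b bA.
    rewrite /U (settle_out _ aA) settle_in ?in_setU1 ?bA ?orbT //; congr (_ + _).
      by apply: eq_bigr => c _; rewrite (settle_out _ aA).
    by rewrite (settle_out _ aA).
  rewrite /U (settle_out _ aA); have [->//|ba] := eqVneq b a.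
  rewrite !settle_out ?in_setU1 ?negb_or ?bA ?aA ?ba 1?eq_sym ?ba //.
  by rewrite finset.setUCA.
have [yA|yA] := boolP (y \in A); last by rewrite half.
(* For [y] in [A] both sides are again solutions of one Dirichlet problem in the start of the other
   particle, whose killing leaves [settle h A y]. *)
symmetry; apply: (@dirichlet_unique _ _ K A
  (fun x => (1 - \sum_y K x y) * settle h A y) (U ^~ y) (U y) Kt).
- by move=> a aA; rewrite /U settle_in.
- move=> a aA; rewrite /U.
  have sE (g : {set V} -> R) B b : settle g B b = g B + \sum_z exit B z b * (g (z |: B)%SET - g B) by [].
  rewrite sE (sE _ _ y) (eq_bigr _ (fun b _ => congr1 _ (sE (fun B => settle h B b) A y))).
  have e z : settle h (z |: A) a - settle h A a =
      \sum_b K a b * (settle h (z |: A) b - settle h A b) +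
      (1 - \sum_b K a b) * (h (z |: A)%SET - h A).
    rewrite !settle_in ?in_setU1 ?aA ?orbT // opprD addrACA -sumrB -mulrBr.
    by congr (_ + _); apply: eq_bigr => b _; rewrite mulrBr.
  under [X in _ + X = _]eq_bigr do rewrite e mulrDr mulr_sumr.
  rewrite big_split /= exchange_big /= (settle_in _ aA).
  rewrite addrACA -big_split /=; congr (_ + _).
    apply: eq_bigr => b _; rewrite [RHS]mulrDr [in RHS]mulr_sumr; congr (_ + _).
    by apply: eq_bigr => z _; rewrite mulrCA.
  rewrite [RHS]mulrDr [in RHS]mulr_sumr; congr (_ + _).
  by apply: eq_bigr => z _; rewrite mulrCA.
- by move=> a aA; apply: half.
Qed.

Lemma settle_sum (I : finType) (c : I -> R) (F : I -> {set V} -> R) A x :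
  settle (fun B => \sum_i c i * F i B) A x = \sum_i c i * settle (F i) A x.
Proof.
rewrite /settle; under [X in _ + X = _]eq_bigr => z _.
  rewrite -sumrB mulr_sumr; under eq_bigr do rewrite -mulrBr mulrCA; over.
rewrite exchange_big -big_split /=; apply: eq_bigr => y _.
by rewrite -mulr_sumr -mulrDr.
Qed.

Lemma settle_ext h g A x : h A = g A -> (forall z, h (z |: A)%SET = g (z |: A)%SET) ->
  settle h A x = settle g A x.
Proof. by move=> e1 e2; rewrite /settle e1; under eq_bigr do rewrite e2. Qed.

Context (nu : V -> R) (nu_gt0 : forall x, 0 < nu x) (nu_sum : \sum_x nu x = 1).

(** Transition probability of the occupied set when a [nu]-distributed particle is added; the mass
    missing from 1 is that of killed particles, which leave the set unchanged. [grow] is the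
    operator of this chain. *)
Definition grow_at A z : R := \sum_x nu x * exit A z x.

Definition grow h A : R := \sum_x nu x * settle h A x.

Lemma growE h A : grow h A = h A + \sum_z grow_at A z * (h (z |: A)%SET - h A).
Proof.
rewrite /grow /settle; under eq_bigr do rewrite mulrDr mulr_sumr.
rewrite big_split /= -mulr_suml nu_sum mul1r exchange_big /=; congr (_ + _).
by apply: eq_bigr => z _; rewrite /grow_at mulr_suml; apply: eq_bigr => x _; rewrite mulrA.
Qed.

Lemma grow_at_ge0 A z : 0 <= grow_at A z.
Proof. by apply: sumr_ge0 => x _; rewrite mulr_ge0 ?exit_ge0 // ltW. Qed.

Lemma grow_at_in A z : z \in A -> grow_at A z = 0.
Proof. by move=> zA; rewrite /grow_at big1 // => x _; rewrite exit_target_in ?mulr0. Qed.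

Lemma grow_at_ge A z : z \notin A -> nu z <= grow_at A z.
Proof.
move=> zA; rewrite /grow_at (bigD1 z) //= exit_out // eqxx mulr1 lerDl.
by apply: sumr_ge0 => x _; rewrite mulr_ge0 ?exit_ge0 // ltW.
Qed.

Lemma grow_at_sum_le1 A : \sum_z grow_at A z <= 1.
Proof.
rewrite /grow_at exchange_big /= -nu_sum; apply: ler_sum => x _.
by rewrite -mulr_sumr ler_piMr ?exit_sum_le1 // ltW.
Qed.

Lemma growE_mean h A : grow h A =
  (1 - \sum_z grow_at A z) * h A + \sum_z grow_at A z * h (z |: A)%SET.
Proof.
rewrite growE; under eq_bigr do rewrite mulrBr.
rewrite sumrB -mulr_suml; lra.
Qed.

Lemma ler_grow h g A : h A <= g A -> (forall z, h (z |: A)%SET <= g (z |: A)%SET) ->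
  grow h A <= grow g A.
Proof.
move=> h1 h2; rewrite !growE_mean lerD ?ler_wpM2l ?subr_ge0 ?grow_at_sum_le1 //.
by apply: ler_sum => z _; rewrite ler_wpM2l ?grow_at_ge0.
Qed.

Lemma growD h g A : grow (fun B => h B + g B) A = grow h A + grow g A.
Proof.
rewrite !growE addrACA -big_split /=; congr (_ + _).
by apply: eq_bigr => z _; rewrite -mulrDr opprD addrACA.
Qed.

Lemma growZ c h A : grow (fun B => c * h B) A = c * grow h A.
Proof.
rewrite !growE mulrDr mulr_sumr; congr (_ + _).
by apply: eq_bigr => z _; rewrite -mulrBr mulrCA.
Qed.

Lemma growC c A : grow (fun=> c) A = c.
Proof. by rewrite growE big1 ?addr0 // => z _; rewrite subrr mulr0. Qed.

Lemma grow_ext h g : h =1 g -> grow h =1 grow g.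
Proof. by move=> hg A; rewrite !growE hg; congr (_ + _); apply: eq_bigr => z _; rewrite hg. Qed.

Lemma grow_settle h A x : grow (fun B => settle h B x) A = settle (grow h) A x.
Proof.
rewrite /grow settle_sum; apply: eq_bigr => y _; by rewrite settle_comm.
Qed.

Lemma grow_full h : grow h [set: V]%SET = h [set: V]%SET.
Proof. by rewrite growE big1 ?addr0 // => z _; rewrite finset.setUT subrr mulr0. Qed.

Lemma cardsC_grow A z : z \notin A -> #|~: A| = #|~: (z |: A)|.+1.
Proof.
move=> zA; rewrite (cardsD1 z (~: A)) finset.in_setC zA add1n; congr _.+1.
by apply: eq_card => y; rewrite !inE negb_or.
Qed.

(** Replaces optional stopping: until it is full, the set grows with positive probability at each
    step, which allows induction on the number of vacant sites. *)
Lemma growth_principle h : 0 <= h [set: V]%SET ->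
  (forall A, A != [set: V]%SET -> grow h A <= h A) -> forall A, 0 <= h A.
Proof.
move=> hT hQ A; have [n] := ubnP #|~: A|; elim: n A => // n IH A An.
have [->//|AT] := eqVneq A [set: V]%SET.
have [z0 z0A] : exists z, z \notin A.
  by apply/existsP; rewrite -negb_forall; apply: contra AT => /forallP a; apply/eqP/setP => z; rewrite a inE.
have := hQ _ AT; rewrite growE_mean.
have p0 : 0 < \sum_z grow_at A z.
  rewrite (bigD1 z0) //= ltr_pwDl ?sumr_ge0 // => [|z _]; last exact: grow_at_ge0.
  exact: lt_le_trans (grow_at_ge z0A).
have s0 : 0 <= \sum_z grow_at A z * h (z |: A)%SET.
  apply: sumr_ge0 => z _; have [zA|zA] := boolP (z \in A); first by rewrite grow_at_in ?mul0r.
  rewrite mulr_ge0 ?grow_at_ge0 // IH //.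
  by move: An; rewrite (cardsC_grow zA) ltnS.
move=> le; rewrite -(pmulr_rge0 _ p0); lra.
Qed.

End Settling.

(** * The filling time *)

Definition harmonic_num {R : realType} (n : nat) : R := \sum_(i < n) i.+1%:R^-1.

Lemma harmonic_numS (R : realType) n :
  harmonic_num n.+1 = harmonic_num n + n.+1%:R^-1 :> R.
Proof. by rewrite /harmonic_num big_ord_recr. Qed.

Section FillTime.
Context {R : realType} {V : finType} {K : V -> V -> R} (Kt : transient K).
Context (nu : V -> R) (nu_gt0 : forall x, 0 < nu x) (nu_sum : \sum_x nu x = 1).
Implicit Types (A B : {set V}) (h g : {set V} -> R).

Notation full := [set: V]%SET.
Notation Q := (grow Kt nu).
Notation q := (grow_at Kt nu).

Let q_ge0 A z : 0 <= q A z. Proof. exact: grow_at_ge0. Qed.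
Let q_le1 A : \sum_z q A z <= 1. Proof. exact: grow_at_sum_le1. Qed.
Let QE := growE Kt nu_sum.

Lemma notfullP A : reflect (exists z, z \notin A) (A != full).
Proof.
apply: (iffP idP) => [AT|[z zA]]; last by apply: contraNneq zA => ->; rewrite inE.
apply/existsP; rewrite -negb_forall; apply: contra AT => /forallP a.
by apply/eqP/setP => z; rewrite a inE.
Qed.

Lemma grow_rate_gt0 A : A != full -> 0 < \sum_z q A z.
Proof.
move=> /notfullP[z zA]; rewrite (bigD1 z) //= ltr_pwDl ?sumr_ge0 //.
exact: lt_le_trans (grow_at_ge Kt nu_gt0 zA).
Qed.

Lemma fill_time_ex : exists f : {set V} -> R,
  f full = 0 /\ forall A, A != full -> f A = 1 + Q f A.
Proof.
(* The fuel is the number of vacant sites; dividing by the growth probability accounts for the steps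
   in which nothing settles. *)
pose F := fix F n A := if n is n'.+1 then
  if A == full then 0 else (1 + \sum_z q A z * F n' (z |: A)%SET) / \sum_z q A z else 0.
exists (fun A => F #|~: A| A); split => [|A AT].
  by rewrite finset.setCT cards0.
have p0 := grow_rate_gt0 AT.
have [z0 z0A] := notfullP _ AT.
have Fz z : q A z * F #|~: (z |: A)| (z |: A)%SET = q A z * F #|~: (z0 |: A)| (z |: A)%SET.
  have [zA|zA] := boolP (z \in A); first by rewrite grow_at_in ?mul0r.
  congr (_ * F _ _); apply: succn_inj; rewrite -!cardsC_grow //.
rewrite QE; under eq_bigr do rewrite mulrBr Fz.
have FA : F #|~: A| A = (1 + \sum_z q A z * F #|~: (z0 |: A)| (z |: A)%SET) / \sum_z q A z.
  by rewrite (cardsC_grow z0A) /= (negPf AT).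
rewrite sumrB -mulr_suml FA.
set p := \sum_z q A z in p0 *; set s := \sum_i _.
by field; rewrite gt_eqF.
Qed.

(* Mean number of aggregation steps from a set until all sites are occupied. *)
Definition fill_time : {set V} -> R := projT1 (cid fill_time_ex).
Local Notation f := fill_time.

Lemma fill_time_full : f full = 0.
Proof. by rewrite /fill_time; case: cid => g []. Qed.

Lemma fill_timeE A : A != full -> f A = 1 + Q f A.
Proof. by rewrite /fill_time; case: cid => g /= [_ gE] /gE. Qed.

Lemma fill_time_drift A : A != full -> \sum_z q A z * (f A - f (z |: A)%SET) = 1.
Proof.
move=> AT; have := fill_timeE AT; rewrite QE => e.
under eq_bigr do rewrite -opprB mulrN.
rewrite sumrN; lra.
Qed.

Lemma growB h g A : Q (fun B => h B - g B) A = Q h A - Q g A.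
Proof.
rewrite (@grow_ext _ _ _ Kt nu nu_sum _ (fun B => h B + (-1) * g B)).
  by rewrite growD // growZ // mulN1r.
by move=> B; rewrite mulN1r.
Qed.

Lemma fill_time_ge h : h full <= 0 -> (forall A, A != full -> h A <= 1 + Q h A) ->
  forall A, h A <= f A.
Proof.
move=> h0 hQ A; rewrite -subr_ge0; move: A.
apply: (growth_principle (Kt := Kt) nu_gt0 nu_sum (h := fun A => f A - h A)) => [|A AT].
  by rewrite fill_time_full sub0r oppr_ge0.
rewrite growB; have := hQ A AT; have := fill_timeE AT; lra.
Qed.

Lemma fill_time_le h : 0 <= h full -> (forall A, A != full -> 1 + Q h A <= h A) ->
  forall A, f A <= h A.
Proof.
move=> h0 hQ A; rewrite -subr_ge0; move: A.
apply: (growth_principle (Kt := Kt) nu_gt0 nu_sum (h := fun A => h A - f A)) => [|A AT].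
  by rewrite fill_time_full subr0.
rewrite growB; have := hQ A AT; have := fill_timeE AT; lra.
Qed.

Lemma fill_time_ge0 A : 0 <= f A.
Proof. by move: A; apply: fill_time_ge => // A _; rewrite growC // addr0. Qed.

Lemma fill_time_ge_card A : #|~: A|%:R <= f A.
Proof.
move: A; apply: fill_time_ge => [|A _]; first by rewrite finset.setCT cards0.
rewrite QE addrCA lerDl.
have : - \sum_z q A z <= \sum_z q A z * (#|~: (z |: A)|%:R - #|~: A|%:R).
  rewrite -sumrN; apply: ler_sum => z _.
  have [zA|zA] := boolP (z \in A); first by rewrite grow_at_in // mul0r oppr0.
  by rewrite (cardsC_grow zA) -[_.+1%:R]natr1 opprD addrA subrr add0r mulrN1.
have := q_le1 A; lra.
Qed.

(** Coupon collector: with [k] vacant sites the next particle fills one with probability at least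
    [k / c], and then [harmonic_num] drops by [1 / k]. *)
Lemma fill_time_le_harmonic c :
  (forall A z, z \notin A -> 1 <= c * q A z) ->
  forall A, f A <= c * harmonic_num #|~: A|.
Proof.
move=> cq; apply: fill_time_le => [|A AT].
  by rewrite finset.setCT cards0 /harmonic_num big_ord0 mulr0.
rewrite QE addrCA gerDl.
have [z0 z0A] := notfullP _ AT.
suff : \sum_z q A z * (c * harmonic_num #|~: (z |: A)| - c * harmonic_num #|~: A|) <= -1 by lra.
have -> : -1 = \sum_(z in ~: A) - (#|~: A|%:R^-1) :> R.
  rewrite sumr_const -[RHS]mulr_natl mulrN divff // pnatr_eq0.
  by rewrite (cardsC_grow z0A).
rewrite [leRHS]big_mkcond /=; apply: ler_sum => z _.
rewrite finset.in_setC; have [zA|zA] := boolP (z \in A); first by rewrite grow_at_in // mul0r.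
rewrite (cardsC_grow zA) harmonic_numS [c * (_ + _)]mulrDr opprD addrA subrr add0r.
by rewrite mulrN lerN2 mulrA (mulrC _ c) ler_peMl // cq.
Qed.

Lemma fill_time_ge_harmonic c (D : {set V}) : 
  (forall A z, z \in D -> c * q A z <= 1) ->
  forall A, c * harmonic_num #|D :\: A| <= f A.
Proof.
move=> cq; apply: fill_time_ge => [|A AT].
  by rewrite finset.setDT cards0 /harmonic_num big_ord0 mulr0.
rewrite QE addrCA lerDl.
suff : -1 <= \sum_z q A z * (c * harmonic_num #|D :\: (z |: A)| - c * harmonic_num #|D :\: A|) by lra.
have DE z : #|D :\: A| = ((z \in D :\: A) + #|D :\: (z |: A)|)%N.
  rewrite (cardsD1 z); congr (_ + _)%N; apply: eq_card => y.
  by rewrite !inE negb_or andbA.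
have : \sum_(z in D :\: A) - (#|D :\: A|%:R^-1) >= -1 :> R.
  rewrite sumr_const -[leRHS]mulr_natl mulrN lerN2.
  have [->|/eqP n0] := eqVneq #|D :\: A| 0%N; first by rewrite mul0r.
  by rewrite divff // pnatr_eq0; apply/eqP.
move/le_trans; apply; rewrite [leLHS]big_mkcond /=; apply: ler_sum => z _.
rewrite {2}(DE z); case: ifP => zA; last by rewrite add0n subrr mulr0.
rewrite add1n harmonic_numS [c * (_ + _)]mulrDr opprD addrA subrr add0r.
rewrite mulrN lerN2 mulrA (mulrC _ c) (DE z) zA add1n ler_piMl // cq //.
by move: zA; rewrite inE => /andP[].
Qed.

Context (r : R) (qr : forall y, 1 <= r * q (~: [set y])%SET y).

Let r_ge0 : (0 < #|V|)%N -> 0 <= r.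
Proof.
move=> /card_gt0P[y _]; rewrite leNgt; apply/negP => r0.
have := qr y; rewrite leNgt => /negP; apply.
by apply: le_lt_trans (ltr01); rewrite nmulr_rle0.
Qed.

Let ind A : R := (A != full)%:R.

Lemma settle_full h x : settle Kt h full x = h full.
Proof. by rewrite /settle big1 ?addr0 // => z _; rewrite finset.setUT subrr mulr0. Qed.

Lemma setU1_full A z : z \notin A -> z |: A = full -> A = (~: [set z])%SET.
Proof.
move=> zA /setP e; apply/setP => y; have := e y; rewrite !inE.
by have [->|] := eqVneq y z; first rewrite (negPf zA).
Qed.

(* As [grow] and [settle] commute, the drift of [f - settle f] is minus the
   probability that the particle at [x] occupies the last vacant site. *)
Lemma fill_time_settle A x : 0 <= f A - settle Kt f A x <= r.
Proof.
have ind01 B : 0 <= settle Kt ind B x <= 1.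
  rewrite /settle; have e1 := exit_sum_le1 Kt B x; have e0 z := exit_ge0 Kt B z x.
  have -> : ind B + \sum_z exit Kt B z x * (ind (z |: B)%SET - ind B) =
     (1 - \sum_z exit Kt B z x) * ind B + \sum_z exit Kt B z x * ind (z |: B)%SET.
    by under eq_bigr do rewrite mulrBr; rewrite sumrB -mulr_suml; lra.
  have i01 C : 0 <= ind C <= 1 by rewrite /ind ler0n lern1 leq_b1.
  apply/andP; split.
    rewrite addr_ge0 ?mulr_ge0 ?subr_ge0 //.
    by apply: sumr_ge0 => z _; rewrite mulr_ge0.
  apply: (@le_trans _ _ ((1 - \sum_z exit Kt B z x) * 1 + \sum_z exit Kt B z x * 1)).
    2: by rewrite -mulr_suml; lra.
  rewrite lerD ?ler_wpM2l ?subr_ge0 //; first by case/andP: (i01 B).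
  by apply: ler_sum => z _; rewrite ler_wpM2l //; case/andP: (i01 (z |: B)%SET).
pose e B := f B - settle Kt f B x.
have fE B : Q f B = f B - ind B.
  rewrite /ind; have [->|BT] := eqVneq B full.
    by rewrite grow_full // fill_time_full subr0.
  by rewrite (fill_timeE BT) addrAC subrr add0r.
have Qe B : B != full -> Q e B = e B - (1 - settle Kt ind B x).
  move=> BT; rewrite growB grow_settle fE.
  have -> : ind B = 1 by rewrite /ind BT.
  have -> : settle Kt (Q f) B x = settle Kt f B x - settle Kt ind B x.
    rewrite /settle fE [in RHS]opprD [RHS]addrACA -[in RHS]sumrB; congr (_ + _); apply: eq_bigr => z _.
    by rewrite fE -mulrBr; congr (_ * _); lra.
  rewrite /e; lra.
have e0 : e full = 0 by rewrite /e settle_full subrr.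
apply/andP; split.
  apply: (growth_principle (Kt := Kt) nu_gt0 nu_sum (h := e)) => [|B BT]; first by rewrite e0.
  by rewrite Qe //; case/andP: (ind01 B) => _; lra.
have [->|AT] := eqVneq A full.
  by rewrite -/(e full) e0; apply: r_ge0; apply/card_gt0P; exists x.
suff : 0 <= r * ind A - e A by rewrite /ind AT mulr1 subr_ge0.
apply: (growth_principle (Kt := Kt) nu_gt0 nu_sum (h := fun B => r * ind B - e B)) => [|B BT].
  by rewrite e0 /ind eqxx mulr0 subrr.
rewrite growB growZ // Qe //.
suff : 1 - settle Kt ind B x <= r * (ind B - Q ind B) by lra.
have -> : ind B - Q ind B = \sum_z q B z * (ind B - ind (z |: B)%SET).
  rewrite QE opprD addrA subrr add0r -sumrN; apply: eq_bigr => z _.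
  by rewrite -mulrN opprB.
(* If one site is missing, [qr] bounds the drift from below; if more are missing, one particle
   cannot complete the set and both sides vanish. *)
have [/existsP[z /andP[zB /eqP zT]]|/existsPn nz] :=
  boolP [exists z, (z \notin B) && (z |: B == full)].
  rewrite (bigD1 z) //= /ind zT eqxx BT subr0 mulr1.
  have BE := setU1_full zB zT.
  have := qr z; rewrite -BE.
  have : 0 <= r * \sum_(i | i != z) q B i * (1 - (i |: B != full)%:R).
    rewrite mulr_ge0 ?r_ge0 //; first by apply/card_gt0P; exists x.
    by apply: sumr_ge0 => i _; rewrite mulr_ge0 // subr_ge0 lern1 leq_b1.
  case/andP: (ind01 B) => ? ?; rewrite mulrDr; rewrite /ind in ind01 *; lra.
have same z : z \notin B -> ind (z |: B)%SET = ind B.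
  by move=> zB; have := nz z; rewrite zB /= /ind BT => ->.
rewrite big1 => [|z _]; last first.
  have [zB|zB] := boolP (z \in B); first by rewrite grow_at_in ?mul0r.
  by rewrite same // subrr mulr0.
rewrite mulr0 /settle big1 => [|z _]; last first.
  have [zB|zB] := boolP (z \in B); first by rewrite exit_target_in ?mul0r.
  by rewrite same // subrr mulr0.
by rewrite /ind BT addr0 subrr.
Qed.

Lemma fill_time_lip A z : 0 <= f A - f (z |: A)%SET <= r.
Proof.
have [zA|zA] := boolP (z \in A); last by rewrite -(settle_out Kt _ zA) fill_time_settle.
have -> : z |: A = A by apply/finset.setUidPr; rewrite finset.sub1set.
by rewrite subrr lexx r_ge0 //; apply/card_gt0P; exists z.
Qed.

Lemma fill_time_le_card A : f A <= r * #|~: A|%:R.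
Proof.
have [n] := ubnP #|~: A|; elim: n A => // n IH A An.
have [->|AT] := eqVneq A full.
  by rewrite fill_time_full finset.setCT cards0 mulr0.
have [z zA] := notfullP _ AT.
rewrite (cardsC_grow zA) -natr1 mulrDr mulr1.
have := IH (z |: A)%SET; rewrite -ltnS -(cardsC_grow zA) => /(_ An).
by case/andP: (fill_time_lip A z) => _; lra.
Qed.

(* Probability that a site is still vacant after [t] aggregation steps. *)
Definition surv (t : nat) : {set V} -> R := iter t Q ind.

Lemma iter_grow_le t h g : (forall A, h A <= g A) -> forall A, iter t Q h A <= iter t Q g A.
Proof. by move=> hg; elim: t => //= t IH A; apply: ler_grow. Qed.

Lemma iter_grow_full t h : iter t Q h full = h full.
Proof. by elim: t => //= t <-; rewrite grow_full. Qed.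

Lemma iter_grow_cst t c A : iter t Q (fun=> c) A = c.
Proof. by elim: t A => //= t IH A; rewrite (grow_ext Kt nu_sum IH) growC. Qed.

Lemma surv_ge0 t A : 0 <= surv t A.
Proof.
by rewrite -[0](iter_grow_cst t 0 A); apply: iter_grow_le => B; rewrite /ind.
Qed.

Lemma surv_le1 t A : surv t A <= 1.
Proof.
by rewrite -[leRHS](iter_grow_cst t 1 A); apply: iter_grow_le => B; rewrite /ind lern1 leq_b1.
Qed.

(* A supersolution, whence bounds of Chebyshev type for the filling time. *)
Let W A (a : R) := r * f A + (f A - a) ^+ 2.

(** The value [f] drops by 1 in mean, just as [a] does, so the linear terms cancel; by the Lipschitz
    bound the drop has second moment at most [r], which the term [r * f A] pays for. *)
Lemma fill_time_quadratic A a : A != full -> Q (W ^~ (a - 1)) A <= W A a.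
Proof.
move=> AT; rewrite QE.
have := fill_time_drift AT.
have : \sum_z q A z * (f A - f (z |: A)%SET) ^+ 2 <=
   r * \sum_z q A z * (f A - f (z |: A)%SET).
  rewrite mulr_sumr; apply: ler_sum => z _; rewrite [leRHS]mulrCA ler_wpM2l //.
  by case/andP: (fill_time_lip A z) => ? ?; rewrite expr2 ler_wpM2r.
move=> le1 d1; rewrite d1 mulr1 in le1.
have -> : \sum_z q A z * (W (z |: A)%SET (a - 1) - W A (a - 1)) =
  \sum_z q A z * (f A - f (z |: A)%SET) ^+ 2 -
  (r + 2 * (f A - a + 1)) * \sum_z q A z * (f A - f (z |: A)%SET).
  rewrite mulr_sumr -sumrB; apply: eq_bigr => z _; rewrite /W; ring.
rewrite d1 mulr1 /W; nra.
Qed.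

Lemma W_ge0 A a : 0 <= W A a.
Proof.
have [->|AT] := eqVneq A full.
  by rewrite /W fill_time_full mulr0 add0r sqr_ge0.
rewrite addr_ge0 ?sqr_ge0 // mulr_ge0 ?fill_time_ge0 // r_ge0 //.
by have [z _] := notfullP _ AT; apply/card_gt0P; exists z.
Qed.

(** On a set still unfilled at time [t] one has [f >= 0 >= a - t], so [W] there is at least
    [(t - a) ^ 2]. With [a = f A] this is Chebyshev's inequality with variance [r * f A]. *)
Lemma surv_upper t A a : a <= t%:R -> surv t A * (t%:R - a) ^+ 2 <= W A a.
Proof.
elim: t A a => [|t IH] A a at_.
  rewrite /surv /= /ind; have [_|AT] := eqVneq A full; first by rewrite mul0r W_ge0.
  rewrite mul1r sub0r sqrrN /W.
  have f0 := fill_time_ge0 A.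
  have : 0 <= r * f A.
    by rewrite mulr_ge0 // r_ge0 //; have [z _] := notfullP _ AT; apply/card_gt0P; exists z.
  nra.
have [->|AT] := eqVneq A full.
  by rewrite /surv iter_grow_full /ind eqxx mul0r W_ge0.
apply: le_trans (fill_time_quadratic _ AT).
have -> : t.+1%:R - a = t%:R - (a - 1) by rewrite -natr1; lra.
rewrite /surv iterS -/(surv t) mulrC -growZ //.
by apply: ler_grow => // [|z]; rewrite mulrC; apply: IH; move: at_; rewrite -natr1; lra.
Qed.

(** Now the filled set contributes: [f] vanishes there and [W] is the square of [a] minus the
    elapsed time. *)
Lemma surv_lower t A a : t%:R <= a -> (1 - surv t A) * (a - t%:R) ^+ 2 <= W A a.
Proof.
elim: t A a => [|t IH] A a at_.
  rewrite /surv /= /ind subr0; have [->|AT] := eqVneq A full.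
    by rewrite /W fill_time_full mulr0 add0r sub0r sqrrN subr0 mul1r.
  by rewrite subrr mul0r W_ge0.
have [->|AT] := eqVneq A full.
  rewrite /surv iter_grow_full /ind eqxx subr0 mul1r /W fill_time_full mulr0 add0r.
  rewrite sub0r sqrrN; have : 0 <= t.+1%:R :> R by []. nra.
apply: le_trans (fill_time_quadratic _ AT).
rewrite /surv iterS -/(surv t) mulrC.
have -> : 1 - Q (surv t) A = Q (fun B => 1 - surv t B) A by rewrite growB growC.
have -> : a - t.+1%:R = (a - 1) - t%:R by rewrite -natr1; lra.
rewrite -growZ //.
by apply: ler_grow => // [|z]; rewrite mulrC; apply: IH; move: at_; rewrite -natr1; lra.
Qed.

Lemma fill_time_split t A : f A <= t%:R + iter t Q f A.
Proof.
elim: t A => [|t IH] A; first by rewrite add0r.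
have [->|AT] := eqVneq A full.
  by rewrite fill_time_full iter_grow_full fill_time_full addr0.
rewrite (fill_timeE AT) -natr1 addrAC [leRHS]addrC lerD2l iterS.
by rewrite -(growC Kt nu_sum t%:R A) -growD //; apply: ler_grow => // z.
Qed.

Context (nu_unif : forall x, nu x = #|V|%:R^-1).

Let hit y x := exit Kt (~: [set y])%SET y x.

(** The walk must leave [A] in order to visit [y]: this is the strong Markov property at the exit
    time. *)
Lemma hit_exit A x y : y \notin A -> \sum_z exit Kt A z x * hit y z = hit y x.
Proof.
move=> yA.
apply: (@dirichlet_unique _ _ K A (fun=> 0) (fun x => \sum_z exit Kt A z x * hit y z) _ Kt).
- move=> a aA; rewrite addr0; under eq_bigr do rewrite (exit_in _ _ aA) mulr_suml.
  rewrite exchange_big /=; apply: eq_bigr => b _; rewrite mulr_sumr.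
  by apply: eq_bigr => z _; rewrite mulrA.
- move=> a aA; rewrite addr0 /hit exit_in // !inE.
  by apply: contraNneq yA => <-.
- move=> a aA; rewrite (bigD1 a) //= exit_out // eqxx mul1r big1 ?addr0 // => z za.
  by rewrite exit_out // eq_sym (negPf za) mul0r.
Qed.

Lemma hit01 y x : 0 <= hit y x <= 1.
Proof.
rewrite exit_ge0 /=; apply: le_trans (exit_sum_le1 Kt (~: [set y])%SET x).
by rewrite [leRHS](bigD1 y) //= lerDl sumr_ge0 // => z _; rewrite exit_ge0.
Qed.

Let p y := q (~: [set y])%SET y.

Lemma grow_at_hit A y : y \notin A -> \sum_z q A z * hit y z = p y.
Proof.
move=> yA; rewrite /p /grow_at; under eq_bigr do rewrite mulr_suml.
rewrite exchange_big /=; apply: eq_bigr => x _; rewrite -/(hit y x) -(hit_exit x yA).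
by rewrite mulr_sumr; apply: eq_bigr => z _; rewrite mulrA.
Qed.

Lemma grow_at_le A y : q A y <= p y.
Proof.
have [yA|yA] := boolP (y \in A); first by rewrite grow_at_in // grow_at_ge0.
have hyy : hit y y = 1 by rewrite /hit exit_out ?inE ?eqxx.
rewrite -(grow_at_hit yA) (bigD1 y) //= hyy mulr1 lerDl.
by apply: sumr_ge0 => z _; rewrite mulr_ge0 //; case/andP: (hit01 y z).
Qed.

Lemma unfilled_tail t y (th : R) : 0 <= th ->
  iter t Q (fun A => (y \notin A)%:R) finset.set0 <=
  expR (th * #|V|%:R * p y - t%:R * (th / (1 + th) * p y)).
Proof.
move=> th0; set b := th / (1 + th).
have b0 : 0 <= b by rewrite divr_ge0 // addr_ge0.
(* While [y] is vacant, the sum of [hit y z] over the occupied sites [z] grows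
   in mean by [p y] at each step, yet it never exceeds [#|V| * p y]. *)
pose Psi A : R := (y \notin A)%:R * expR (- (th * \sum_(z in A) hit y z)).
have QPsi A : Q Psi A <= expR (- (b * p y)) * Psi A.
  have [yA|yA] := boolP (y \in A).
    have P0 B : y \in B -> Psi B = 0 by rewrite /Psi => ->; rewrite mul0r.
    rewrite QE P0 // mulr0 add0r big1 // => z _.
    by rewrite P0 ?in_setU1 ?yA ?orbT // subrr mulr0.
  apply: (@le_trans _ _ ((1 - b * p y) * Psi A)); last first.
    rewrite ler_wpM2r ?mulr_ge0 ?expR_ge0 //.
    by have := expR_ge1Dx (- (b * p y)).
  rewrite QE mulrBl mul1r lerD2l -(grow_at_hit yA) mulr_sumr mulr_suml -sumrN.
  apply: ler_sum => z _; have [zA|zA] := boolP (z \in A).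
    by rewrite grow_at_in // !(mul0r, mulr0, oppr0).
  rewrite [leRHS](_ : _ = q A z * (- (b * hit y z) * Psi A)); last by ring.
  rewrite ler_wpM2l //.
  suff : Psi (z |: A)%SET <= (1 - b * hit y z) * Psi A by lra.
  apply: (@le_trans _ _ (expR (- (th * hit y z)) * Psi A)).
    rewrite /Psi yA mul1r -expRD big_setU1 //= mulrDr opprD.
    by rewrite ler_piMl ?expR_ge0 //; case: (_ \notin _).
  rewrite ler_wpM2r ?mulr_ge0 ?expR_ge0 //.
  have /andP[h0 h1] := hit01 y z.
  have th1 : 0 < 1 + th * hit y z by rewrite ltr_pwDl // mulr_ge0.
  (* The function [1 / (1 + th * h)] is convex in [h], and [1 - b * h] is its chord over [0, 1];
     this dictates the value of [b]. *)
  rewrite expRN; apply: (@le_trans _ _ (1 + th * hit y z)^-1).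
    by rewrite lef_pV2 ?posrE ?expR_gt0 // expR_ge1Dx.
  rewrite -div1r ler_pdivrMr // /b mulrBl mul1r.
  have th2 : 0 < 1 + th by rewrite ltr_pwDl.
  suff : th / (1 + th) * hit y z * (1 + th * hit y z) <= th * hit y z by lra.
  rewrite [leLHS](_ : _ = th * hit y z * ((1 + th * hit y z) / (1 + th))); last by ring.
  by rewrite ler_piMr ?mulr_ge0 // ler_pdivrMr // mul1r lerD2l ler_piMr.
have QtPsi A : iter t Q Psi A <= expR (- (b * p y)) ^+ t * Psi A.
  elim: t A => [|t IH] A; first by rewrite expr0 mul1r.
  rewrite iterS exprSr -mulrA; apply: le_trans (ler_wpM2l _ (QPsi A)); last first.
    by rewrite exprn_ge0 // expR_ge0.
  by rewrite -growZ //; apply: ler_grow.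
(* Uniformity of [nu] enters here. *)
have pE : \sum_z hit y z = #|V|%:R * p y.
  have V0 : #|V|%:R != 0 :> R.
    by rewrite pnatr_eq0 -lt0n; apply/card_gt0P; exists y.
  rewrite /p /grow_at mulr_sumr; apply: eq_bigr => z _.
  by rewrite nu_unif mulrA divff // mul1r.
(* Markov's inequality: the sum in [Psi] is at most [#|V| * p y], so the factor in front brings
   [Psi] above the indicator that [y] is vacant. *)
apply: (@le_trans _ _ (expR (th * #|V|%:R * p y) * iter t Q Psi finset.set0)).
  have -> : expR (th * #|V|%:R * p y) * iter t Q Psi finset.set0 =
     iter t Q (fun A => expR (th * #|V|%:R * p y) * Psi A) finset.set0.
    elim: t {QtPsi} finset.set0 => //= t IH A.
    by rewrite -growZ //; apply: (grow_ext Kt nu_sum) => B; rewrite IH.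
  apply: iter_grow_le => A; rewrite /Psi; case: (y \notin A); rewrite ?mul0r ?mulr0 //.
  rewrite mul1r -expRD; apply: le_trans (expR_ge1Dx _).
  rewrite lerDl -mulrA -mulrBr mulr_ge0 // -pE.
  rewrite (bigID (mem A)) /= addrAC subrr add0r sumr_ge0 // => z _.
  by case/andP: (hit01 y z).
rewrite expRD ler_wpM2l ?expR_ge0 //; apply: le_trans (QtPsi _) _.
rewrite /Psi big_set0 mulr0 oppr0 expR0 inE mulr1 mulr1 -expRM_natl.
by rewrite mulrN.
Qed.

(** After time [t] each vacant site costs at most [r], and a site is still vacant with probability
    at most [expR (- (d / r))], because [p y] is at least [1 / r]. *)
Lemma fill_time_upper t (th d : R) : 0 <= th -> 0 <= d ->
  th * #|V|%:R - t%:R * (th / (1 + th)) <= - d ->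
  f finset.set0 <= t%:R + r * #|V|%:R * expR (- (d / r)).
Proof.
move=> th0 d0 hd; apply: le_trans (fill_time_split t _) _; rewrite lerD2l.
have [V0|V0] := posnP #|V|.
  rewrite (_ : finset.set0 = full); last first.
    by apply/setP => x; have := card0_eq V0 x.
  rewrite iter_grow_full fill_time_full V0 mulr0 mul0r //.
have r1 : 0 < r.
  have /card_gt0P[y _] := V0; have := qr y; have := r_ge0 V0.
  rewrite le_eqVlt => /orP[/eqP <-|//]; rewrite mul0r; lra.
apply: le_trans (iter_grow_le t fill_time_le_card _) _.
have -> : (fun A => r * #|~: A|%:R) = (fun A => r * \sum_y (y \notin A)%:R).
  apply/funext => A; congr (_ * _); rewrite -sum1_card natr_sum big_mkcond /=.
  by apply: eq_bigr => y _; rewrite finset.in_setC; case: (y \in A).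
have -> A : iter t Q (fun A => r * \sum_y (y \notin A)%:R) A =
    r * \sum_y iter t Q (fun A => (y \notin A)%:R) A.
  elim: t {hd} A => //= t IH A; rewrite (grow_ext Kt nu_sum IH) // growZ //; congr (_ * _).
  rewrite QE [in RHS](eq_bigr _ (fun y _ => QE _ _)) big_split /=; congr (_ + _).
  rewrite exchange_big /=; apply: eq_bigr => z _.
  by rewrite -sumrB mulr_sumr.
rewrite -mulrA ler_wpM2l ?r_ge0 //.
have -> : #|V|%:R * expR (- (d / r)) = \sum_(y : V) expR (- (d / r)).
  by rewrite sumr_const -[RHS]mulr_natl.
apply: ler_sum => y _; apply: le_trans (unfilled_tail t y th0) _; rewrite ler_expR.
have py : r^-1 <= p y by rewrite -div1r ler_pdivrMr // mulrC qr.
rewrite mulrA -mulrBl; apply: (@le_trans _ _ (- d * p y)).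
  by rewrite ler_wpM2r // grow_at_ge0.
by rewrite mulNr lerN2 ler_wpM2l.
Qed.

End FillTime.

(** * Topplings *)

Lemma big_option (R : nmodType) (T : finType) (F : option T -> R) :
  \sum_m F m = F None + \sum_x F (Some x).
Proof.
rewrite (bigD1 None) //=; congr (_ + _).
rewrite (reindex_omap Some id) /=; last by case.
by apply: eq_bigl => x; rewrite eqxx.
Qed.

Section Toppling.
Context {R : realType} {V : finType} (K : V -> V -> R) (lam : R).
Implicit Types (eta zeta : @config V) (f g : @config V -> R) (x y z : V).

Definition active_on eta x : bool := (0 < active_at eta x)%N.

Definition unstable eta : bool := [exists x, active_on eta x].

(* The instructions at a site: [None] is sleep, [Some None] is killing and
   [Some (Some y)] is a jump to [y]. *)
Definition instr : finType := option (option V).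

Definition obey (m : instr) x eta : config :=
  match m with
  | None => if eta x == Some 1%N then put eta x None else eta
  | Some None => remove_active eta x
  | Some (Some y) => add_active (remove_active eta x) y
  end.

(* The proportion of sleep instructions; at a site with several active
   particles they are not obeyed but still used up, without which topplings of
   distinct sites would not commute. *)
Definition lazy_weight : R := lam / (1 + lam).

Definition instr_weight x (m : instr) : R :=
  match m with
  | None => lazy_weight
  | Some None => (1 - lazy_weight) * (1 - \sum_y K x y)
  | Some (Some y) => (1 - lazy_weight) * K x y
  end.

Definition topple f eta x : R := \sum_m instr_weight x m * f (obey m x eta).

Definition jump f eta x : R :=
  \sum_y K x y * f (add_active (remove_active eta x) y) +
  (1 - \sum_y K x y) * f (remove_active eta x).

Lemma toppleE f eta x : topple f eta x =
  (1 - lazy_weight) * jump f eta x + lazy_weight * f (obey None x eta).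
Proof.
rewrite /topple !big_option /jump mulrDr mulr_sumr /=.
under [in RHS]eq_bigr do rewrite mulrA.
by ring.
Qed.

Definition wake (o : option nat) : option nat := if o is Some k then Some k.+1 else Some 2%N.

Lemma obeyE m x eta z : obey m x eta z =
  match m with
  | None => if (z == x) && (eta z == Some 1%N) then None else eta z
  | Some None => if z == x then omap predn (eta z) else eta z
  | Some (Some y) =>
      let o := if z == x then omap predn (eta z) else eta z in
      if z == y then wake o else o
  end.
Proof.
case: m => [[y|]|] /=.
- rewrite /add_active /remove_active /put !ffunE /wake.
  by case: (eqVneq z y) => [->|zy]; case: eqP => // ->.
- by rewrite /remove_active /put ffunE; case: eqP => // ->.
- case: (eqVneq z x) => [->|zx] /=; last first.
    by case: ifP => // _; rewrite ffunE (negPf zx).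
  by case: ifP => h; rewrite ?ffunE ?eqxx ?h //=.
Qed.

Lemma active_onE eta x : active_on eta x -> exists k, eta x = Some k.+1.
Proof. by rewrite /active_on /active_at; case: (eta x) => [[|k]|] //= _; exists k. Qed.

(** The delicate case is a sleep instruction at a lone particle that is also joined by another:
    asleep and then woken, or joined first so that the instruction is void, the site ends up with
    [Some 2]. *)
Lemma obey_comm m m' x y eta : x != y -> active_on eta x -> active_on eta y ->
  obey m' y (obey m x eta) = obey m x (obey m' y eta).
Proof.
move=> xy /active_onE[k xk] /active_onE[l yl]; apply/ffunP => z.
rewrite !obeyE; case: (eqVneq z x) => [zx|zx].
  rewrite zx (negPf xy) xk; case: m => [[u|]|]; case: m' => [[v|]|];
  rewrite ?obeyE ?eqxx /= ?(negPf xy) ?xk //=; do ?case: eqP => //=; case: k {xk} => //=.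
case: (eqVneq z y) => [zy|zy].
  have yx : (y == x) = false by rewrite eq_sym (negPf xy).
  rewrite zy yl; case: m => [[u|]|]; case: m' => [[v|]|];
  rewrite ?obeyE ?eqxx /= ?yx ?yl //=; do ?case: eqP => //=; case: l {yl} => //=.
case: m => [[u|]|]; case: m' => [[v|]|];
rewrite ?obeyE /= ?(negPf zx) ?(negPf zy) //=; do ?case: eqP => //=.
Qed.

Lemma obey_active m x y eta : y != x -> active_on eta y -> active_on (obey m x eta) y.
Proof.
move=> yx /active_onE[k yk]; rewrite /active_on /active_at obeyE (negPf yx) yk.
by case: m => [[u|]|] //=; case: eqP.
Qed.

Lemma topple_comm f eta x y : x != y -> active_on eta x -> active_on eta y ->
  topple (fun zeta => topple f zeta y) eta x = topple (fun zeta => topple f zeta x) eta y.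
Proof.
move=> xy ax ay; rewrite /topple.
under eq_bigr do rewrite mulr_sumr.
rewrite exchange_big /=; apply: eq_bigr => m' _; rewrite mulr_sumr.
by apply: eq_bigr => m _; rewrite mulrCA obey_comm.
Qed.

Definition step f eta : R :=
  if [pick x | active_on eta x] is Some x then topple f eta x else f eta.

Lemma eq_topple f g eta x : (forall m, f (obey m x eta) = g (obey m x eta)) ->
  topple f eta x = topple g eta x.
Proof. by move=> fg; apply: eq_bigr => m _; rewrite fg. Qed.

Lemma step_stable f eta : ~~ unstable eta -> step f eta = f eta.
Proof.
by rewrite /step => /existsPn st; case: pickP => // x; rewrite (negPf (st x)).
Qed.

(* Toppling order is immaterial: an active site stays active until it is
   toppled, so its toppling can be moved to the front. *)
Lemma iter_step_topple k f eta x : (forall zeta, unstable zeta -> f zeta = 0) ->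
  active_on eta x -> iter k.+1 step f eta = topple (iter k step f) eta x.
Proof.
move=> f0; elim: k eta x => [|k IH] eta x ax.
  rewrite /= /step; case: pickP => [y ay|/(_ x)]; last by rewrite ax.
  have [->//|yx] := eqVneq y x.
  rewrite /topple !big1 // => m _; rewrite f0 ?mulr0 //.
    by apply/existsP; exists y; apply: obey_active.
  by apply/existsP; exists x; apply: obey_active; rewrite // eq_sym.
rewrite iterS {1}/step; case: pickP => [y ay|/(_ x)]; last by rewrite ax.
have [->//|yx] := eqVneq y x.
have e1 : topple (iter k.+1 step f) eta y = topple (fun zeta => topple (iter k step f) zeta x) eta y.
  by apply: eq_topple => m; apply: IH; apply: obey_active; rewrite // eq_sym.
rewrite e1 topple_comm //; apply: eq_topple => m.
by rewrite (IH _ y) //; apply: obey_active.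
Qed.

Lemma topple_lin (I : finType) (c : I -> R) (F : I -> @config V -> R) eta x :
  topple (fun zeta => \sum_i c i * F i zeta) eta x = \sum_i c i * topple (F i) eta x.
Proof.
rewrite /topple; under eq_bigr do rewrite mulr_sumr.
rewrite exchange_big /=; apply: eq_bigr => i _; rewrite mulr_sumr.
by apply: eq_bigr => m _; rewrite mulrCA.
Qed.

Lemma toppleB f g eta x :
  topple (fun zeta => f zeta - g zeta) eta x = topple f eta x - topple g eta x.
Proof. by rewrite /topple -sumrB; apply: eq_bigr => m _; rewrite mulrBr. Qed.

Lemma toppleZ c f eta x : topple (fun zeta => c * f zeta) eta x = c * topple f eta x.
Proof. by rewrite /topple mulr_sumr; apply: eq_bigr => m _; rewrite mulrCA. Qed.

Context (Kt : transient K) (lam_gt0 : 0 < lam).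

Let lw_gt0 : 0 < lazy_weight.
Proof. by rewrite divr_gt0 // addr_gt0. Qed.

Let lw_lt1 : lazy_weight < 1.
Proof. by rewrite ltr_pdivrMr ?addr_gt0 // mul1r ltrDr. Qed.

Lemma instr_weight_ge0 x m : 0 <= instr_weight x m.
Proof.
case: Kt => K0 K1 _; case: m => [[y|]|] /=; last exact: ltW.
  by rewrite mulr_ge0 ?K0 ?subr_ge0 // ltW.
by rewrite mulr_ge0 ?subr_ge0 ?K1 // ltW.
Qed.

Lemma instr_weight_sum x : \sum_m instr_weight x m = 1.
Proof. rewrite !big_option /= -mulr_sumr; ring. Qed.

Lemma topple_cst c eta x : topple (fun=> c) eta x = c.
Proof. by rewrite /topple -mulr_suml instr_weight_sum mul1r. Qed.

Lemma ler_topple f g eta x : (forall m, f (obey m x eta) <= g (obey m x eta)) ->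
  topple f eta x <= topple g eta x.
Proof. by move=> fg; apply: ler_sum => m _; rewrite ler_wpM2l ?instr_weight_ge0. Qed.

End Toppling.

(* [Phi / delta] bounds the mean absorption time, which is turned into a bound
   on the probability of not being absorbed yet. *)
Lemma iter_absorb {R : realType} {S : Type} (T : (S -> R) -> S -> R) (U : pred S)
    (Phi : S -> R) (delta : R) (f : S -> R) :
  (forall g h, (forall s, g s <= h s) -> forall s, T g s <= T h s) ->
  (forall c g s, T (fun s => c * g s) s = c * T g s) ->
  T (fun=> 1) =1 (fun=> 1) ->
  (forall g s, ~~ U s -> T g s = g s) ->
  0 < delta -> (forall s, 0 <= Phi s) -> (forall s, U s -> delta <= Phi s) ->
  (forall s, U s -> T Phi s <= Phi s - delta) ->
  (forall s, `|f s| <= (U s)%:R) ->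
  forall k s, `|iter k T f s| <= Phi s / (delta * k.+1%:R).
Proof.
move=> Tmono Thom T1 Tfix d0 Phi0 PhiU TPhi fU k s.
pose e k := iter k T (fun s => (U s)%:R : R).
have e_le1 j t : e j t <= 1.
  elim: j t => [|j IH] t; first by rewrite /e /= lern1 leq_b1.
  by rewrite -(T1 t); apply: Tmono.
have Tabs j t : `|iter j T f t| <= e j t.
  elim: j t => [|j IH] t; first exact: fU.
  rewrite ler_norml; apply/andP; split.
    have := Thom (-1) (e j) t; rewrite mulN1r => <-.
    by apply: Tmono => u; rewrite mulN1r; have := IH u; rewrite ler_norml => /andP[].
  by apply: Tmono => u; have := IH u; rewrite ler_norml => /andP[].
apply: (le_trans (Tabs _ _)); rewrite ler_pdivlMr ?mulr_gt0 // mulrC.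
elim: k s => [|j IH] t.
  by rewrite /e /= mulr1; case: (boolP (U t)) => Ut; rewrite ?mulr1 ?mulr0 ?PhiU.
have [Ut|Ut] := boolP (U t); last first.
  suff -> : e j.+1 t = 0 by rewrite mulr0.
  by rewrite /e; elim: j.+1 => [|i IHi]; rewrite /= ?(negPf Ut) ?Tfix.
rewrite -natr1 mulrDr mulr1 mulrDl.
have : delta * j.+1%:R * e j.+1 t <= T Phi t.
  by rewrite /e iterS -Thom; apply: Tmono.
have : delta * e j.+1 t <= delta by rewrite ler_piMr // ltW.
have := TPhi t Ut; lra.
Qed.

(** * A potential that decreases in mean under topplings *)

Section Potential.
Context {R : realType} {V : finType} {K : V -> V -> R} {lam : R}.
Context (Kt : transient K) (lam_gt0 : 0 < lam).
Implicit Types (eta zeta : @config V) (f g : @config V -> R) (x y z : V).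

Lemma lifetime_ex : exists phi : V -> R,
  (forall x, 0 <= phi x) /\ forall x, phi x = \sum_y K x y * phi y + 1.
Proof.
have [u uE] := dirichlet_ex [set: V]%SET (fun=> 1) Kt.
have uE' x : u x = \sum_y K x y * u y + 1 by rewrite uE inE.
exists u; split=> // x; rewrite -oppr_le0.
apply: (max_principle (C := [set: V]%SET) (u := fun x => - u x) Kt) => [y _|y].
  by rewrite uE' opprD; under [leRHS]eq_bigr do rewrite mulrN; rewrite sumrN; lra.
by rewrite inE.
Qed.

Definition lifetime : V -> R := projT1 (cid lifetime_ex).
Local Notation phi := lifetime.

Lemma lifetime_ge0 x : 0 <= phi x.
Proof. by rewrite /lifetime; case: cid => u []. Qed.

Lemma lifetimeE x : phi x = \sum_y K x y * phi y + 1.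
Proof. by rewrite /lifetime; case: cid => u /= [_ ->]. Qed.

(** Twice the mean lifetime of every particle, asleep or not, plus the number of active ones. A jump
    lowers the first part by 2 in mean and raises the second by at most 1, when it wakes a sleeper;
    falling asleep lowers the second. *)
Let pe z (o : option nat) : R := 2 * phi z * (odflt 1%N o)%:R + (odflt 0%N o)%:R.

Definition potential eta : R := \sum_z pe z (eta z).
Local Notation Phi := potential.

Lemma potential_put eta x o : Phi (put eta x o) = Phi eta - pe x (eta x) + pe x o.
Proof.
rewrite /potential (bigD1 x) //= [in RHS](bigD1 x) //= /put ffunE eqxx.
rewrite (eq_bigr (fun z => pe z (eta z))) => [|z /negPf zx]; last by rewrite ffunE zx.
by lra.
Qed.

Lemma pe_ge0 z o : 0 <= pe z o.
Proof. by rewrite addr_ge0 ?mulr_ge0 ?lifetime_ge0. Qed.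

Lemma potential_ge0 eta : 0 <= Phi eta.
Proof. by apply: sumr_ge0 => z _; apply: pe_ge0. Qed.

Lemma potential_unstable eta : unstable eta -> 1 <= Phi eta.
Proof.
move=> /existsP[x /active_onE[k xk]]; rewrite /potential (bigD1 x) //= xk /pe /=.
rewrite -natr1 -addrA; have := lifetime_ge0 x.
have : 0 <= k%:R :> R by [].
have : 0 <= \sum_(z | z != x) pe z (eta z) by apply: sumr_ge0 => z _; apply: pe_ge0.
rewrite -/(pe _ _); move=> h1 h2 h3; have : 0 <= 2 * phi x * (k%:R + 1) by nra.
rewrite /pe in h1 *; lra.
Qed.

Lemma potential_add eta y : Phi (add_active eta y) <= Phi eta + 2 * phi y + 2.
Proof.
rewrite potential_put /pe; have := lifetime_ge0 y.
by case: (eta y) => [k|] /=; rewrite -?(natr1 _ k); lra.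
Qed.

Lemma potential_remove eta x : active_on eta x ->
  Phi (remove_active eta x) = Phi eta - 2 * phi x - 1.
Proof.
by move=> /active_onE[k xk]; rewrite potential_put /pe xk /= -natr1; lra.
Qed.

Lemma jump_potential eta x : active_on eta x -> jump K Phi eta x <= Phi eta - 1.
Proof.
move=> ax; case: Kt => K0 K1 _; rewrite /jump potential_remove //.
have : \sum_y K x y * Phi (add_active (remove_active eta x) y) <=
    \sum_y K x y * (Phi eta - 2 * phi x + 1) + 2 * \sum_y K x y * phi y.
  rewrite mulr_sumr -big_split /=; apply: ler_sum => y _.
  have := potential_add (remove_active eta x) y; rewrite potential_remove // => h.
  have := K0 x y; nra.
rewrite -mulr_suml; have := lifetimeE x; have := K1 x.
move: (\sum_y K x y) (\sum_y K x y * phi y) (\sum_y _ * _) => a b c; nra.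
Qed.

Lemma potential_sleep eta x : Phi (obey None x eta) <= Phi eta.
Proof.
rewrite /obey; case: eqP => // h; rewrite potential_put h /pe /=.
have := lifetime_ge0 x; lra.
Qed.

End Potential.

Lemma cvg_lincomb {R : realType} {T : Type} (F : set_system T) {FF : Filter F}
    (I : finType) (c : I -> R) (u : I -> T -> R) (l : I -> R) :
  (forall i, u i t @[t --> F] --> l i)%classic ->
  (\sum_i c i * u i t @[t --> F] --> \sum_i c i * l i)%classic.
Proof.
move=> ul; elim: (index_enum I) => [|i s IH].
  by under eq_fun do rewrite big_nil; rewrite big_nil; apply: cvg_cst.
under eq_fun do rewrite big_cons.
rewrite big_cons; apply: cvgD => //; apply: cvgM => //; exact: cvg_cst.
Qed.

(** * The law of the stabilized configuration *)

Section Stabilization.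
Local Open Scope classical_set_scope.
Context {R : realType} {V : finType} {K : V -> V -> R} {lam : R}.
Context (Kt : transient K) (lam_gt0 : 0 < lam).
Implicit Types (eta zeta : @config V) (f g w : @config V -> R) (x y z : V).
Implicit Types (s : @stable V).

Local Notation top := (topple K lam).
Local Notation stp := (step K lam).

Lemma lazy_weight_gt0 : 0 < lazy_weight lam.
Proof. by rewrite divr_gt0 // addr_gt0. Qed.

Lemma lazy_weight_lt1 : lazy_weight lam < 1.
Proof. by rewrite ltr_pdivrMr ?addr_gt0 // mul1r ltrDr. Qed.

Lemma topple_potential eta x : active_on eta x ->
  top (potential Kt) eta x <= potential Kt eta - (1 - lazy_weight lam).
Proof.
move=> ax; rewrite toppleE.
have := jump_potential Kt ax; have := potential_sleep Kt eta x.
have := lazy_weight_gt0; have := lazy_weight_lt1; nra.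
Qed.

Lemma config_of_stableP eta : reflect (exists s, eta = config_of_stable s) (~~ unstable eta).
Proof.
apply: (iffP existsPn) => [st|[s ->] x]; last first.
  by rewrite /active_on /active_at /config_of_stable ffunE; case: (s x).
exists [ffun x => eta x == None]; apply/ffunP => x; rewrite !ffunE.
have := st x; rewrite /active_on /active_at; case: (eta x) => [[|k]|] //.
Qed.

Lemma config_of_stable_inj : injective (@config_of_stable V).
Proof.
move=> s t /ffunP e; apply/ffunP => x; have := e x; rewrite !ffunE.
by case: (s x) (t x) => [] [].
Qed.

Lemma stableN s : ~~ unstable (config_of_stable s).
Proof. by apply/config_of_stableP; exists s. Qed.

Lemma ler_step f g eta : (forall zeta, f zeta <= g zeta) -> stp f eta <= stp g eta.
Proof. by move=> fg; rewrite /step; case: pickP => // x _; apply: ler_topple. Qed.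

Lemma iter_step_decay f : (forall eta, `|f eta| <= (unstable eta)%:R) ->
  forall k eta, `|iter k stp f eta| <=
    potential Kt eta / ((1 - lazy_weight lam) * k.+1%:R).
Proof.
have b1 := lazy_weight_lt1; have b0 := lazy_weight_gt0.
move=> fU; apply: (iter_absorb (U := fun eta => unstable eta)) => //.
- by move=> g h gh eta; apply: ler_step.
- by move=> c g eta; rewrite /step; case: pickP => // x _; apply: toppleZ.
- by move=> eta; rewrite /step; case: pickP => // x _; apply: topple_cst.
- by move=> g eta; apply: step_stable.
- by rewrite subr_gt0.
- exact: potential_ge0.
- by move=> eta /(potential_unstable Kt); lra.
- move=> eta /existsP[x ax]; rewrite /step; case: pickP => [y ay|/(_ x)]; last by rewrite ax.
  exact: topple_potential.
Qed.

Definition at_stable s eta : R := (eta == config_of_stable s)%:R.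

Lemma at_stable_unstable s eta : unstable eta -> at_stable s eta = 0.
Proof. by rewrite /at_stable; case: eqP => // ->; rewrite (negPf (stableN s)). Qed.

(* Law of the final state when active sites are toppled until none is left. *)
Definition stab s eta : R := limn (fun k => iter k stp (at_stable s) eta).

Lemma iter_step_01 s k eta : 0 <= iter k stp (at_stable s) eta <= 1.
Proof.
elim: k eta => [|k IH] eta; first by rewrite /= /at_stable ler0n lern1 leq_b1.
have cst c : stp (fun=> c) eta = c.
  by rewrite /step; case: pickP => // x _; apply: topple_cst.
apply/andP; split.
  by rewrite -[leLHS](cst 0) iterS; apply: ler_step => z; case/andP: (IH z).
by rewrite -[leRHS](cst 1) iterS; apply: ler_step => z; case/andP: (IH z).
Qed.

Lemma stab_cvg s eta : iter k stp (at_stable s) eta @[k --> \oo] --> stab s eta.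
Proof.
apply: nondecreasing_is_cvgn; last first.
  exists 1 => _ [k _ <-]; by case/andP: (iter_step_01 s k eta).
apply/nondecreasing_seqP => k; elim: k eta => [|k IH] eta; last exact: ler_step.
rewrite /=; have [U|U] := boolP (unstable eta); last by rewrite step_stable.
rewrite at_stable_unstable //; have := iter_step_01 s 1 eta => /andP[]//.
Qed.

Lemma stab_ge0 s eta : 0 <= stab s eta.
Proof.
apply: limr_ge; first exact: stab_cvg.
by apply: nearW => k; case/andP: (iter_step_01 s k eta).
Qed.

Lemma stab_le1 s eta : stab s eta <= 1.
Proof.
apply: limr_le; first exact: stab_cvg.
by apply: nearW => k; case/andP: (iter_step_01 s k eta).
Qed.

Lemma iter_step_stable f k eta : ~~ unstable eta -> iter k stp f eta = f eta.
Proof. by move=> U; elim: k => //= k IH; rewrite step_stable. Qed.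

Lemma stab_stable s s' : stab s (config_of_stable s') = (s' == s)%:R.
Proof.
apply: cvg_lim => //; apply: cvg_near_cst; apply: nearW => k.
rewrite iter_step_stable ?stableN // /at_stable; congr (nat_of_bool _)%:R.
by apply/eqP/eqP => [/config_of_stable_inj|->].
Qed.

(** Harmonicity for all legal topplings at once, not only for those chosen by [step]; functions of
    this kind carry the abelian property. *)
Definition toppling_inv w : Prop :=
  forall eta x, active_on eta x -> top w eta x = w eta.

(** By [iter_step_topple] any active site may be toppled first; one more step does not matter in the
    limit. *)
Lemma stab_inv s : toppling_inv (stab s).
Proof.
move=> eta x ax; have := @stab_cvg s eta; rewrite -(cvg_shiftS _) => h.
apply: (cvg_unique _ _ h) => //.
rewrite (_ : (fun k => iter k.+1 stp (at_stable s) eta) =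
   (fun k => \sum_m instr_weight K lam x m * iter k stp (at_stable s) (obey m x eta))).
  by apply: cvg_lincomb => m; apply: stab_cvg.
by apply/funext => k; apply: iter_step_topple => // z; apply: at_stable_unstable.
Qed.

Lemma iter_step_lin (I : finType) (c : I -> R) (F : I -> @config V -> R) k eta :
  iter k stp (fun zeta => \sum_i c i * F i zeta) eta = \sum_i c i * iter k stp (F i) eta.
Proof.
elim: k eta => //= k IH eta; rewrite (_ : iter k stp _ = fun zeta => \sum_i c i * iter k stp (F i) zeta).
  by rewrite /step; case: pickP => // x _; rewrite topple_lin.
exact/funext.
Qed.

Lemma iter_stepB f g k eta :
  iter k stp (fun zeta => f zeta - g zeta) eta = iter k stp f eta - iter k stp g eta.
Proof.
elim: k eta => //= k IH eta; rewrite (_ : iter k stp _ = fun zeta => iter k stp f zeta - iter k stp g zeta).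
  by rewrite /step; case: pickP => // x _; rewrite toppleB.
exact/funext.
Qed.

Lemma cvg_inv_decay (C : R) : (C / k.+1%:R) @[k --> \oo] --> (0 : R).
Proof. by rewrite -[X in _ --> X](mulr0 C); apply: cvgM; [exact: cvg_cst|exact: cvg_harmonic]. Qed.

(** The invariant [w] and its combination of indicators agree on stable configurations, and iterates
    of their difference tend to 0 by [iter_step_decay]. *)
Lemma inv_stab w eta : toppling_inv w -> (forall zeta, `|w zeta| <= 1) ->
  w eta = \sum_s w (config_of_stable s) * stab s eta.
Proof.
move=> wi w1.
pose f zeta := w zeta - \sum_s w (config_of_stable s) * at_stable s zeta.
have fU zeta : `|f zeta| <= (unstable zeta)%:R.
  rewrite /f; have [U|/config_of_stableP[s ->]] := boolP (unstable zeta).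
    by rewrite big1 ?subr0 // => s _; rewrite at_stable_unstable ?mulr0.
  have ss : at_stable s (config_of_stable s) = 1 by rewrite /at_stable eqxx.
  rewrite (bigD1 s) //= ss mulr1 big1 ?addr0 ?subrr ?normr0 // => t ts.
  rewrite /at_stable; case: eqP => [/config_of_stable_inj e|]; last by rewrite mulr0.
  by rewrite e eqxx in ts.
have wk k : iter k stp w eta = w eta.
  elim: k => //= k IH; rewrite (_ : iter k stp w = w).
    by rewrite /step; case: pickP => // x /wi.
  elim: k {IH} => //= k ->; apply/funext => zeta.
  by rewrite /step; case: pickP => // x /wi.
have lim1 : (w eta - \sum_s w (config_of_stable s) * iter k stp (at_stable s) eta) @[k --> \oo] -->
    w eta - \sum_s w (config_of_stable s) * stab s eta.
  by apply: cvgB; [exact: cvg_cst|apply: cvg_lincomb => s; apply: stab_cvg].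
have lim2 : (w eta - \sum_s w (config_of_stable s) * iter k stp (at_stable s) eta) @[k --> \oo] --> (0 : R).
  apply/norm_cvg0P.
  apply: (squeeze_cvgr (f := fun=> 0) (h := fun k => (potential Kt eta / (1 - lazy_weight lam)) / k.+1%:R)).
  - apply: nearW => k; rewrite normr_ge0 /=.
    have := iter_step_decay fU k eta; rewrite /f iter_stepB iter_step_lin wk.
    by rewrite invfM mulrA.
  - exact: cvg_cst.
  - exact: cvg_inv_decay.
by apply/eqP; rewrite -subr_eq0; apply/eqP; apply: (cvg_unique _ lim1 lim2).
Qed.

Lemma stab_sum eta : \sum_s stab s eta = 1.
Proof.
have inv1 : toppling_inv (fun=> 1 : R) by move=> z x _; rewrite topple_cst.
have -> : 1 = \sum_s 1 * stab s eta.
  by apply: (inv_stab eta inv1) => z; rewrite normr1.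
by apply: eq_bigr => s _; rewrite mul1r.
Qed.

End Stabilization.

(** * The absorption probabilities *)

Section ExponentialSeries.
Context {R : realType}.
Local Open Scope classical_set_scope.

Lemma triangular_sum (F : nat -> nat -> R) n :
  \sum_(k < n) \sum_(i < k.+1) F i (k - i)%N = \sum_(i < n) \sum_(j < n - i) F i j.
Proof.
elim: n => [|n IH]; first by rewrite !big_ord0.
rewrite big_ord_recr /= IH [RHS]big_ord_recr /= subSnn big_ord1.
rewrite (big_ord_recr n) /= subnn addrA; congr (_ + _).
rewrite -big_split /=; apply: eq_bigr => i _.
by rewrite subSn ?(ltnW (ltn_ord i)) // big_ord_recr.
Qed.

Let defect (F : nat -> nat -> R) n := \sum_(i < n) \sum_(n - i <= j < n) F i j.

Let defectE (F : nat -> nat -> R) n :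
  \sum_(i < n) \sum_(j < n) F i j - \sum_(k < n) \sum_(i < k.+1) F i (k - i)%N = defect F n.
Proof.
rewrite triangular_sum -sumrB; apply: eq_bigr => i _.
by rewrite -!(big_mkord predT) (@big_cat_nat _ _ _ (n - i)) ?leq_subr //= addrAC subrr add0r.
Qed.

Lemma exp_coeffD (a b : R) k :
  exp_coeff (a + b) k = \sum_(i < k.+1) exp_coeff a i * exp_coeff b (k - i)%N.
Proof.
rewrite /exp_coeff /= addrC exprDn mulr_suml; apply: eq_bigr => -[i /= ik] _.
have f0 n : n`!%:R != 0 :> R by rewrite pnatr_eq0 -lt0n fact_gt0.
rewrite ltnS in ik; rewrite -mulr_natr -(bin_fact ik) !natrM.
have C0 : 'C(k, i)%:R != 0 :> R by rewrite pnatr_eq0 -lt0n bin_gt0.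
by field; rewrite !f0 C0.
Qed.

(** The gap is the sum over the part of the square outside the triangle. It is dominated by the gap
    for two exponential series, which vanishes by [expRD]. *)
Lemma cauchy_product_exp (u : R ^nat) (M a b : R) : 0 <= M -> 0 <= a -> 0 <= b ->
  (forall i, `|u i| <= M * exp_coeff a i) ->
  series u n * series (exp_coeff b) n -
    series (fun k => \sum_(i < k.+1) u i * exp_coeff b (k - i)%N) n @[n --> \oo] --> (0 : R).
Proof.
move=> M0 a0 b0 uM.
have prodE (v w : R ^nat) n : series v n * series w n -
    series (fun k => \sum_(i < k.+1) v i * w (k - i)%N) n = defect (fun i j => v i * w j) n.
  rewrite -defectE /series /= !big_mkord mulr_suml; congr (_ - _).
  by apply: eq_bigr => i _; rewrite mulr_sumr.
have eC : (fun n => M * (series (exp_coeff a) n * series (exp_coeff b) n -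
    series (exp_coeff (a + b)) n)) @ \oo --> (0 : R).
  have e x : series (exp_coeff x) n @[n --> \oo] --> (expR x : R).
    exact: is_cvg_series_exp_coeff.
  rewrite -[X in _ --> X](mulr0 M) -[X in _ --> M * X](subrr (expR (a + b))) {1}expRD.
  by apply: cvgM; [exact: cvg_cst|apply: cvgB => //; apply: cvgM].
apply/norm_cvg0P; apply: (squeeze_cvgr (f := fun=> 0) _ (cvg_cst _) eC).
apply: nearW => n; rewrite normr_ge0 /= prodE.
have -> : series (exp_coeff (a + b)) n =
   series (fun k => \sum_(i < k.+1) exp_coeff a i * exp_coeff b (k - i)%N) n.
  by apply: eq_bigr => k _; apply: exp_coeffD.
rewrite prodE /defect mulr_sumr; apply: le_trans (ler_norm_sum _ _ _) _.
apply: ler_sum => i _; rewrite mulr_sumr; apply: le_trans (ler_norm_sum _ _ _) _.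
apply: ler_sum => j _; rewrite normrM mulrA.
have eb : 0 <= exp_coeff b j by rewrite divr_ge0 // exprn_ge0.
by rewrite (ger0_norm eb) ler_wpM2r.
Qed.

(** Pascal's rule; [U i j] will be [Q ^ i] applied to the [j]-th iterate of [Q - 1]. *)
Lemma binomial_transform (U : nat -> nat -> R) :
  (forall i j, U i.+1 j = U i j.+1 + U i j) ->
  forall k j, U k j = \sum_(i < k.+1) 'C(k, i)%:R * U 0%N (j + i)%N.
Proof.
move=> US; elim=> [|k IH] j.
  by rewrite big_ord_recl big_ord0 bin0 mul1r !addr0 addn0.
rewrite US !IH [RHS]big_ord_recl bin0 mul1r addn0.
under [in RHS]eq_bigr => i _ do rewrite lift0 binS natrD mulrDl.
rewrite big_split /= [RHS]addrA [LHS]addrC; congr (_ + _); last first.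
  by apply: eq_bigr => i _; rewrite addSnnS.
rewrite big_ord_recl bin0 mul1r addn0; congr (_ + _).
by rewrite [RHS]big_ord_recr /= bin_small // mul0r addr0.
Qed.

(* With [X j = (Q - 1)^j f] and [U k = Q^k f], the series is the value of
   [exp (s (Q - 1)) f = exp (- s) * exp (s Q) f]. *)
Lemma uniformized_series (X U : R ^nat) (s D : R) : 0 < s -> 0 <= D ->
  (forall j, `|X j| <= 2 ^+ j) -> (forall k, `|U k| <= D / k.+1%:R) ->
  (forall k, U k = \sum_(i < k.+1) 'C(k, i)%:R * X i) ->
  exists2 A, series (fun j => s ^+ j / j`!%:R * X j) @ \oo --> A & `|A| <= D / s.
Proof.
move=> s0 D0 X2 UD UE; pose u j := s ^+ j / j`!%:R * X j.
have f0 n : 0 < n`!%:R :> R by rewrite ltr0n fact_gt0.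
have e0 x n : 0 <= x -> 0 <= exp_coeff x n :> R by move=> x0; rewrite divr_ge0 ?exprn_ge0 // ltW.
have uM j : `|u j| <= 1 * exp_coeff (2 * s) j.
  rewrite mul1r /u normrM ger0_norm; last by rewrite divr_ge0 ?exprn_ge0 // ltW.
  rewrite /exp_coeff /= exprMn mulrC -mulrA ler_wpM2r //.
  by rewrite divr_ge0 ?exprn_ge0 // ltW.
have s20 : 0 <= 2 * s by rewrite mulr_ge0 // ltW.
have uC : cvgn (series u).
  apply: normed_cvg; apply: (@series_le_cvg _ _ (exp_coeff (2 * s))) => [n|n|n|] /=.
  - exact: normr_ge0.
  - exact: e0.
  - by rewrite -[leRHS]mul1r.
  - exact: is_cvg_series_exp_coeff.
exists (limn (series u)) => //.
set A := limn (series u).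
have := cauchy_product_exp ler01 s20 (ltW s0) uM.
set W := series (fun k => \sum_(i < k.+1) _) => WC.
have WE n : W n = \sum_(0 <= k < n) s ^+ k / k`!%:R * U k.
  rewrite /W /series /=; apply: eq_bigr => k _; rewrite UE mulr_sumr.
  apply: eq_bigr => -[i /= ik] _; rewrite ltnS in ik.
  rewrite /u /exp_coeff /= -(bin_fact ik) !natrM.
  have C0 : 'C(k, i)%:R != 0 :> R by rewrite pnatr_eq0 -lt0n bin_gt0.
  have -> : s ^+ k = s ^+ i * s ^+ (k - i) by rewrite -exprD subnKC.
  by field; rewrite C0 !(gt_eqF (f0 _)).
have WA : W n @[n --> \oo] --> A * expR s.
  have eC : series (exp_coeff s) n @[n --> \oo] --> (expR s : R).
    exact: is_cvg_series_exp_coeff.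
  have h := cvgB (cvgM uC eC) WC; rewrite subr0 in h.
  have EW : (fun n => series u n * series (exp_coeff s) n -
      (series u n * series (exp_coeff s) n - W n)) = W.
    by apply/funext => n; rewrite opprB addrCA subrr addr0.
  by rewrite -EW; exact: h.
have Wle n : `|W n| <= D / s * expR s.
  rewrite WE; apply: le_trans (ler_norm_sum _ _ _) _.
  (* The factor [1 / (k + 1)] shifts the exponential series by one index and costs [1 / s]; the term
     of index 0 is added for free. *)
  apply: (@le_trans _ _ (D / s * series (exp_coeff s) n.+1)).
    rewrite /series /= big_nat_recl //= mulrDr mulr_sumr.
    rewrite -[leLHS]add0r lerD //; first by rewrite mulr_ge0 ?e0 ?divr_ge0 // ltW.
    apply: ler_sum => k _; rewrite normrM ger0_norm; last by rewrite divr_ge0 ?exprn_ge0 // ltW.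
    apply: (@le_trans _ _ (s ^+ k / k`!%:R * (D / k.+1%:R))).
      by rewrite ler_wpM2l // divr_ge0 ?exprn_ge0 // ltW.
    rewrite /exp_coeff /= factS natrM exprS le_eqVlt; apply/orP; left; apply/eqP.
    by field; rewrite !gt_eqF //= pnatr_eq0.
  rewrite ler_wpM2l ?divr_ge0 ?(ltW s0) //.
  apply: nondecreasing_cvgn_le; last exact: is_cvg_series_exp_coeff.
  by apply/nondecreasing_seqP => k; rewrite /series /= big_nat_recr //= lerDl e0 // ltW.
have : `|A * expR s| <= D / s * expR s.
  have /cvg_norm WN := WA.
  rewrite -(cvg_lim _ WN) //; apply: limr_le; first by apply/cvg_ex; exists `|A * expR s|.
  exact: nearW.
by rewrite normrM (ger0_norm (expR_ge0 s)) ler_pM2r ?expR_gt0.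
Qed.

End ExponentialSeries.

(** * The generator and its uniformization *)

Section Absorption.
Context {R : realType} {V : finType} {K : V -> V -> R} {lam : R}.
Context (Kt : transient K) (lam_gt0 : 0 < lam).
Implicit Types (eta zeta : @config V) (f g w : @config V -> R) (x y z : V).
Implicit Types (s : @stable V).

Local Notation L := (arw_generator K lam).
Local Notation Phi := (potential Kt).

Definition particles eta : nat := \sum_z odflt 1%N (eta z).

Let act eta x : R := (active_at eta x)%:R.
Let nap eta x : R := if eta x == Some 1%N then lam else 0.

Lemma generatorE f eta : L f eta =
  \sum_x (act eta x * (jump K f eta x - f eta) + nap eta x * (f (put eta x None) - f eta)).
Proof.
apply: eq_bigr => x _; congr (_ + _); last first.
  by rewrite /nap; case: ifP => // _; rewrite mul0r.
congr (_ * _); rewrite /jump; under eq_bigr do rewrite mulrBr.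
rewrite sumrB -mulr_suml; ring.
Qed.

Lemma generatorZ c f eta : L (fun zeta => c * f zeta) eta = c * L f eta.
Proof.
rewrite !generatorE mulr_sumr; apply: eq_bigr => x _.
have -> : jump K (fun zeta => c * f zeta) eta x = c * jump K f eta x.
  by rewrite /jump mulrDr mulr_sumr mulrCA; congr (_ + _); apply: eq_bigr => y _; rewrite mulrCA.
ring.
Qed.

Lemma generatorD f g eta : L (fun zeta => f zeta + g zeta) eta = L f eta + L g eta.
Proof.
rewrite !generatorE -big_split /=; apply: eq_bigr => x _.
have -> : jump K (fun zeta => f zeta + g zeta) eta x = jump K f eta x + jump K g eta x.
  rewrite /jump addrACA -big_split /= -mulrDr; congr (_ + _).
  by apply: eq_bigr => y _; rewrite mulrDr.
ring.
Qed.

(** At a lone active particle, [1 + lam] times the change under toppling is the site's term in the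
    generator; at a fuller site sleep instructions change nothing, so invariance under toppling is
    invariance under the jump. *)
Lemma generator_inv g eta : toppling_inv (K := K) (lam := lam) g -> L g eta = 0.
Proof.
move=> gi; rewrite generatorE big1 // => x _.
rewrite /act /nap /active_at.
have l1 : 1 + lam != 0 by rewrite gt_eqF // addr_gt0.
have [ax|] := boolP (active_on eta x); last first.
  by rewrite /active_on /active_at; case: (eta x) => [[|k]|] //= _; rewrite !mul0r addr0.
have := gi _ _ ax; have [k xk] := active_onE ax; rewrite xk toppleE /obey xk /=.
case: k {xk} => [|k] /=; rewrite /lazy_weight => e.
  have : (1 + lam) * ((1 - lam / (1 + lam)) * jump K g eta x +
      lam / (1 + lam) * g (put eta x None)) = (1 + lam) * g eta by rewrite e.
  have -> : (1 + lam) * ((1 - lam / (1 + lam)) * jump K g eta x +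
      lam / (1 + lam) * g (put eta x None)) = jump K g eta x + lam * g (put eta x None).
    by field.
  by move=> e'; rewrite mul1r; lra.
have : (1 + lam) * ((1 - lam / (1 + lam)) * jump K g eta x +
    lam / (1 + lam) * g eta) = (1 + lam) * g eta by rewrite e.
have -> : (1 + lam) * ((1 - lam / (1 + lam)) * jump K g eta x +
    lam / (1 + lam) * g eta) = jump K g eta x + lam * g eta by field.
move=> e'; have -> : jump K g eta x = g eta by lra.
by rewrite subrr mulr0 mul0r addr0.
Qed.

Lemma particles_put eta x o :
  (particles (put eta x o) + odflt 1 (eta x) = particles eta + odflt 1 o)%N.
Proof.
rewrite /particles (bigD1 x) //= [in RHS](bigD1 x) //= /put ffunE eqxx.
rewrite (eq_bigr (fun z => odflt 1%N (eta z))) => [|z /negPf zx]; last by rewrite ffunE zx.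
by rewrite addnC (addnC (odflt 1%N o)) addnA.
Qed.

Lemma particles_remove eta x : active_on eta x ->
  particles eta = (particles (remove_active eta x)).+1.
Proof.
move=> /active_onE[k xk]; have := particles_put eta x (omap predn (eta x)).
by rewrite -/(remove_active eta x) xk /= addnS -addSn => /addIn.
Qed.

Lemma particles_add eta x : (particles (add_active eta x) = (particles eta).+1)%N.
Proof.
have := particles_put eta x (wake (eta x)); rewrite -/(add_active eta x).
by case: (eta x) => [k|] /=; [rewrite addnS -addSn => /addIn|rewrite addn1 addn2 => -[]].
Qed.

Lemma particles_sleep eta x : eta x = Some 1%N -> particles (put eta x None) = particles eta.
Proof. by move=> x1; have := particles_put eta x None; rewrite x1 /= => /addIn. Qed.

Lemma eq_generator f g eta :
  (forall zeta, (particles zeta <= particles eta)%N -> f zeta = g zeta) ->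
  L f eta = L g eta.
Proof.
move=> fg; rewrite !generatorE; apply: eq_bigr => x _.
congr (_ + _); last first.
  rewrite /nap; case: eqP => x1; last by rewrite !mul0r.
  by rewrite !fg // particles_sleep.
have [ax|] := boolP (active_on eta x); last first.
  by rewrite /act /active_on -eqn0Ngt => /eqP ->; rewrite !mul0r.
have := particles_remove ax => e.
congr (_ * (_ - _)); last exact: fg.
rewrite /jump fg ?e //; congr (_ + _); apply: eq_bigr => y _; rewrite fg //.
by rewrite particles_add -e.
Qed.

Context (N : nat).
Let c : R := N.+1%:R * (1 + lam).
Let c_ge1 : 1 <= c.
Proof.
have : 1 <= N.+1%:R :> R by rewrite ler1n.
by move=> h; rewrite /c -[leLHS]mul1r ler_pM // lerDl ltW.
Qed.
Let c_gt0 : 0 < c. Proof. exact: lt_le_trans c_ge1. Qed.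

(* Uniformization: on at most [N] particles the total jump rate is at most [c]. *)
Let Q f eta : R := if (particles eta <= N)%N then f eta + L f eta / c else f eta.

Let U eta : bool := unstable eta && (particles eta <= N)%N.

Let rate eta : R := \sum_x (act eta x + nap eta x).

Let rate_le eta : (particles eta <= N)%N -> rate eta <= c.
Proof.
move=> eN; apply: (@le_trans _ _ ((particles eta)%:R * (1 + lam))); last first.
  by rewrite ler_wpM2r ?addr_ge0 ?(ltW lam_gt0) // ler_nat leqW.
rewrite /rate /particles natr_sum mulr_suml; apply: ler_sum => x _.
rewrite /act /nap /active_at; case: (eta x) => [k|] /=; last by have := lam_gt0; rewrite addr0; lra.
case: eqP => [[->]|_]; first by rewrite mul1r.
by rewrite addr0 mulrDr mulr1 lerDl mulr_ge0 // ltW.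
Qed.

Let QE f eta : (particles eta <= N)%N -> Q f eta = (1 - rate eta / c) * f eta +
  (\sum_x (act eta x * jump K f eta x + nap eta x * f (put eta x None))) / c.
Proof.
move=> eN; rewrite /Q eN generatorE.
have -> : \sum_x (act eta x * (jump K f eta x - f eta) + nap eta x * (f (put eta x None) - f eta)) =
  \sum_x (act eta x * jump K f eta x + nap eta x * f (put eta x None)) - rate eta * f eta.
  by rewrite /rate mulr_suml -sumrB; apply: eq_bigr => x _; ring.
by field; rewrite gt_eqF.
Qed.

Let Q_mono f g : (forall eta, f eta <= g eta) -> forall eta, Q f eta <= Q g eta.
Proof.
move=> fg eta; have [eN|eN] := boolP (particles eta <= N)%N; last by rewrite /Q (negPf eN).
have [K0 K1 _] := Kt; rewrite !QE // lerD //.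
  by rewrite ler_wpM2l // subr_ge0 ler_pdivrMr // mul1r rate_le.
rewrite ler_wpM2r ?invr_ge0 ?(ltW c_gt0) //; apply: ler_sum => x _.
rewrite lerD // ler_wpM2l //; last by rewrite /nap; case: ifP => // _; apply: ltW.
rewrite /jump lerD ?ler_wpM2l ?subr_ge0 //.
by apply: ler_sum => y _; rewrite ler_wpM2l.
Qed.

Let QZ a f eta : Q (fun zeta => a * f zeta) eta = a * Q f eta.
Proof. by rewrite /Q generatorZ; case: ifP => // _; rewrite mulrDr mulrA. Qed.

Let QD f g eta : Q (fun zeta => f zeta + g zeta) eta = Q f eta + Q g eta.
Proof. by rewrite /Q generatorD; case: ifP => // _; rewrite mulrDl addrACA. Qed.

Let Q1 : Q (fun=> 1) =1 (fun=> 1).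
Proof.
move=> eta; rewrite /Q generator_inv ?mul0r ?addr0 ?if_same // => zeta x _.
exact: topple_cst.
Qed.

Let Q_fix f eta : ~~ U eta -> Q f eta = f eta.
Proof.
rewrite negb_and => /orP[st|eN]; last by rewrite /Q (negPf eN).
rewrite /Q generatorE big1 ?mul0r ?addr0 ?if_same // => x _.
have /existsPn/(_ x) := st; rewrite /active_on /active_at /act /nap /active_at.
by case: (eta x) => [[|k]|] //= _; rewrite !mul0r addr0.
Qed.

Let Q_potential eta : U eta -> Q Phi eta <= Phi eta - c^-1.
Proof.
move=> /andP[/existsP[x ax] eN]; rewrite /Q eN lerD2l.
rewrite -[leRHS]mulN1r ler_wpM2r ?invr_ge0 ?(ltW c_gt0) //.
apply: (@le_trans _ _ (\sum_x - act eta x)).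
  rewrite generatorE; apply: ler_sum => y _.
  have h1 : nap eta y * (Phi (put eta y None) - Phi eta) <= 0.
    rewrite /nap; case: eqP => [y1|]; last by rewrite mul0r.
    have := potential_sleep Kt eta y; rewrite /obey y1 eqxx -subr_le0 => h.
    by rewrite pmulr_rle0.
  have h2 : act eta y * (jump K Phi eta y - Phi eta) <= - act eta y.
    have [ay|] := boolP (active_on eta y); last first.
      by rewrite /act /active_on -eqn0Ngt => /eqP ->; rewrite mul0r oppr0.
    have := jump_potential Kt ay; have : 0 <= act eta y by []. nra.
  lra.
rewrite sumrN lerN2 (bigD1 x) //= -[leLHS]addr0 lerD ?sumr_ge0 //.
by rewrite ler1n.
Qed.

Let D f eta : R := Q f eta - f eta.

Section Decay.
Variable w : @config V -> R.
Hypothesis wU : forall eta, `|w eta| <= (unstable eta)%:R.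

(** Above [N] particles [Q] is frozen, so the function has to vanish there for its iterates to
    decay. *)
Let wN eta : R := if (particles eta <= N)%N then w eta else 0.

Let iterD j eta : (particles eta <= N)%N -> iter j L w eta = c ^+ j * iter j D wN eta.
Proof.
elim: j eta => [|j IH] eta eN; first by rewrite /= mul1r /wN eN.
rewrite !iterS (@eq_generator _ (fun zeta => c ^+ j * iter j D wN zeta)); last first.
  by move=> zeta le; apply: IH; apply: leq_trans eN.
rewrite generatorZ exprSr -mulrA; congr (_ * _).
by rewrite {2}/D /Q eN addrAC subrr add0r mulrCA divff ?mulr1 // gt_eqF.
Qed.

(** On at most [N] particles the generator is [c * (Q - 1)], and the decay of the iterates of [Q]
    passes to the exponential series by [uniformized_series]; the constant [c] cancels. *)
Lemma semigroup_decay (t : R) eta : 0 < t -> (particles eta <= N)%N ->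
  exists2 A, (series (fun j => t ^+ j / j`!%:R * iter j L w eta) @ \oo --> A)%classic &
    `|A| <= Phi eta / t.
Proof.
move=> t0 eN.
have cstU B j g : (forall zeta, `|g zeta| <= B) -> forall zeta, `|iter j D g zeta| <= B * 2 ^+ j.
  move=> gB; elim: j => [|j IH] zeta; first by rewrite mulr1.
  have QB : `|Q (iter j D g) zeta| <= B * 2 ^+ j.
    have Qc a xi : Q (fun=> a) xi = a.
      have -> : (fun=> a) = (fun _ : @config V => a * 1) by apply/funext => ?; rewrite mulr1.
      by rewrite (QZ a (fun=> 1)) Q1 mulr1.
    rewrite ler_norml -(Qc (- _) zeta) -{2}(Qc (B * 2 ^+ j) zeta); apply/andP; split.
      by apply: Q_mono => xi; have := IH xi; rewrite ler_norml => /andP[].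
    by apply: Q_mono => xi; have := IH xi; rewrite ler_norml => /andP[].
  rewrite iterS {1}/D; apply: le_trans (ler_normB _ _) _.
  by have := IH zeta; rewrite exprS; lra.
have ct0 : 0 < c * t by rewrite mulr_gt0.
have P0 : 0 <= Phi eta * c by rewrite mulr_ge0 ?potential_ge0 // ltW.
have UD : forall k, `|iter k Q wN eta| <= Phi eta * c / k.+1%:R.
  move=> k; rewrite (_ : _ / _ = Phi eta / (c^-1 * k.+1%:R)); last first.
    by rewrite (invfM c^-1) invrK [RHS]mulrA.
  apply: (@iter_absorb _ _ Q U Phi c^-1 wN Q_mono QZ Q1 Q_fix).
  - by rewrite invr_gt0.
  - exact: potential_ge0.
  - move=> zeta /andP[/(potential_unstable Kt) h _]; apply: le_trans h.
    by rewrite invf_le1.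
  - exact: Q_potential.
  - move=> zeta; rewrite /wN /U; case: (particles zeta <= N)%N; last by rewrite normr0 andbF.
    by rewrite andbT.
have QDk k g h zeta : iter k Q (fun xi => g xi + h xi) zeta = iter k Q g zeta + iter k Q h zeta.
  elim: k zeta => //= k IH zeta; rewrite -QD; congr (Q _ _); exact/funext.
pose UU k j := iter k Q (iter j D wN) eta.
have UUS i j : UU i.+1 j = UU i j.+1 + UU i j.
  rewrite /UU iterSr -QDk; congr (iter _ _ _ _); apply/funext => zeta.
  by rewrite iterS {2}/D subrK.
have [||A SA AD] := @uniformized_series _ (fun j => iter j D wN eta) (fun k => iter k Q wN eta)
   (c * t) (Phi eta * c) ct0 P0 _ UD.
- move=> j; rewrite -[leRHS]mul1r; apply: cstU => zeta; rewrite /wN.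
  by case: ifP => _; rewrite ?normr0 //; apply: le_trans (wU _) _; rewrite lern1 leq_b1.
- by move=> k; have := binomial_transform UUS k 0; under eq_bigr do rewrite add0n.
exists A; last first.
  apply: le_trans AD _; rewrite (invfM c) [leLHS]mulrA -(mulrA _ c c^-1) divff ?gt_eqF // mulr1 //.
rewrite (_ : (fun j => t ^+ j / j`!%:R * iter j L w eta) =
  (fun j => (c * t) ^+ j / j`!%:R * iter j D wN eta)) //.
by apply/funext => j; rewrite iterD // [(c * t) ^+ j]exprMn [LHS]mulrCA -!mulrA.
Qed.

End Decay.

End Absorption.

Section AbsorptionLaw.
Context {R : realType} {V : finType} {K : V -> V -> R} {lam : R}.
Context (Kt : transient K) (lam_gt0 : 0 < lam).
Local Open Scope classical_set_scope.

(** The indicator [f] is [g + w] with [g] the toppling law. The generator kills [g], so only the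
    first term of its exponential series remains, while [w] vanishes on stable configurations and
    decays like [1 / t]. *)
Theorem absorptionE eta (s : @stable V) : absorption K lam eta s = stab (K := K) (lam := lam) s eta.
Proof.
pose g := stab (K := K) (lam := lam) s; pose f := @at_stable R V s.
pose L := arw_generator K lam.
pose w zeta := f zeta - g zeta.
have gi : toppling_inv (K := K) (lam := lam) g by apply: stab_inv.
have wU zeta : `|w zeta| <= (unstable zeta)%:R.
  rewrite /w /f /g; have [Uz|/config_of_stableP[s' ->]] := boolP (unstable zeta).
    by rewrite at_stable_unstable // sub0r normrN ger0_norm ?stab_ge0 ?stab_le1.
  rewrite stab_stable // /at_stable.
  rewrite (_ : (config_of_stable s' == config_of_stable s) = (s' == s)) ?subrr ?normr0 //.
  by apply/eqP/eqP => [/config_of_stable_inj|->].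
have semiE t : 0 < t -> `|g eta - arw_semigroup K lam t f eta| <= potential Kt eta / t.
  move=> t0; have [A SA AD] := semigroup_decay Kt lam_gt0 wU t0 (leqnn (particles eta)).
  suff -> : arw_semigroup K lam t f eta = A + g eta by rewrite opprD addrCA subrr addr0 normrN.
  apply: cvg_lim => //.
  rewrite -(cvg_shiftS _) in SA; rewrite -(cvg_shiftS _).
  have -> : (fun n => series (fun k => t ^+ k / k`!%:R * iter k L f eta) n.+1) =
     (fun n => series (fun k => t ^+ k / k`!%:R * iter k L w eta) n.+1 + g eta).
    apply/funext => n; rewrite /series /= !big_nat_recl //= expr0 fact0 divr1 !mul1r.
    rewrite addrAC /w subrK; congr (_ + _); apply: eq_bigr => k _; congr (_ * _).
    rewrite -!iterS !iterSr; congr (iter _ _ _ _); apply/funext => zeta.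
    rewrite -[LHS]addr0 -[X in _ + X](mulr0 (-1)) -(generator_inv lam_gt0 zeta gi) -generatorZ -generatorD.
    by congr (arw_generator _ _ _ _); apply/funext => xi; rewrite mulN1r.
  by apply: cvgD => //; apply: cvg_cst.
rewrite /absorption; apply: cvg_lim => //.
apply/cvgrPdist_le => e e0.
near=> t.
have t0 : 0 < t by near: t; apply: nbhs_pinfty_gt.
apply: le_trans (semiE t t0) _; rewrite ler_pdivrMr // mulrC -ler_pdivrMr //.
Unshelve. all: by end_near. Qed.

End AbsorptionLaw.

(** * The driven chain *)

Section InvariantFunctions.
Context {R : realType} {V : finType} {K : V -> V -> R} {lam : R}.
Context (Kt : transient K) (lam_gt0 : 0 < lam).
Implicit Types (eta zeta : @config V) (w : @config V -> R) (x y z : V) (B : {set V}).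
Implicit Types (s : @stable V).

Local Notation inv := (toppling_inv (K := K) (lam := lam)).

Lemma add_activeE eta x z : add_active eta x z = if z == x then wake (eta z) else eta z.
Proof. by rewrite /add_active /put ffunE; case: eqP => // ->. Qed.

Lemma removeE eta x z : remove_active eta x z = if z == x then omap predn (eta z) else eta z.
Proof. by rewrite /remove_active /put ffunE; case: eqP => // ->. Qed.

Lemma active_add eta x y : active_on eta y -> active_on (add_active eta x) y.
Proof.
by move=> /active_onE[k yk]; rewrite /active_on /active_at add_activeE yk; case: eqP.
Qed.

Lemma active_add_self eta x : active_on (add_active eta x) x.
Proof. by rewrite /active_on /active_at add_activeE eqxx; case: (eta x). Qed.

Lemma obey_add m x y eta : active_on eta y ->
  obey m y (add_active eta x) = add_active (obey m y eta) x.
Proof.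
move=> /active_onE[k yk]; apply/ffunP => z.
rewrite !(obeyE, add_activeE); case: (eqVneq z y) => [->|zy].
  rewrite yk; case: m => [[v|]|] //=; do ?case: eqP => //=; by case: k yk.
by case: m => [[v|]|] //=; do ?case: eqP.
Qed.

Lemma inv_add w x : inv w -> inv (fun eta => w (add_active eta x)).
Proof.
move=> wi eta y ay; rewrite -(wi _ _ (active_add x ay)).
by apply: eq_bigr => m _; rewrite obey_add.
Qed.

(** With two or more particles sleep instructions are void, and the factor [1 - lazy_weight lam]
    cancels. *)
Lemma inv_jump w eta x k : inv w -> eta x = Some k.+2 -> w eta = jump K w eta x.
Proof.
move=> wi xk; have ax : active_on eta x by rewrite /active_on /active_at xk.
have := wi _ _ ax; rewrite toppleE /obey xk /= => e.
have b1 := lazy_weight_lt1 lam_gt0.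
have n0 : 1 - lazy_weight lam != 0 by rewrite subr_eq0 eq_sym lt_eqF.
by apply: (mulfI n0); lra.
Qed.

Lemma remove_add eta x k : eta x = Some k -> remove_active (add_active eta x) x = eta.
Proof.
by move=> xk; apply/ffunP => z; rewrite removeE add_activeE; case: eqP => // ->; rewrite xk.
Qed.

(* Active particles on [B] are laid on top of the sleeping configuration [s]. *)
Definition overlay s B : @config V :=
  [ffun x => if x \in B then Some (s x).+1 else if s x then None else Some 0%N].

Definition nobody : @stable V := [ffun=> false].

Lemma overlay0 s : overlay s finset.set0 = config_of_stable s.
Proof. by apply/ffunP => x; rewrite !ffunE inE. Qed.

Lemma add_overlay s B x : x \notin B -> add_active (overlay s B) x = overlay s (x |: B)%SET.
Proof.
move=> xB; apply/ffunP => z; rewrite add_activeE !ffunE !inE.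
by case: (eqVneq z x) => //= ->; rewrite (negPf xB); case: (s x).
Qed.

(** On a site of [B] the incoming particle has company, so it performs a [K]-walk until it finds a
    site outside [B]; there it stops, waking the sleeper if there is one, and the site joins [B]. *)
Lemma inv_settle w s B x : inv w ->
  w (add_active (overlay s B) x) = settle Kt (fun B => w (overlay s B)) B x.
Proof.
move=> wi; move: x; apply: settle_unique => x xB; last by rewrite add_overlay.
have xs : overlay s B x = Some (s x).+1 by rewrite ffunE xB.
by rewrite (@inv_jump w _ x (s x)) //; [rewrite /jump (remove_add xs)|rewrite add_activeE eqxx xs].
Qed.

(** The extra particle can be moved until it is killed: as a function of its start, the left side
    solves a Dirichlet problem on all of [V] whose solution is constant. *)
Lemma inv_extra w eta x : inv w -> (forall y, active_on eta y) -> w (add_active eta x) = w eta.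
Proof.
move=> wi ae.
apply: (@dirichlet_unique _ _ K [set: V]%SET (fun x => (1 - \sum_y K x y) * w eta)
  (fun x => w (add_active eta x)) (fun=> w eta) Kt).
- move=> y _; have [k yk] := active_onE (ae y).
  by rewrite (@inv_jump w _ y k) //; [rewrite /jump (remove_add yk)|rewrite add_activeE eqxx yk].
- by move=> y _; rewrite -mulr_suml; lra.
- by move=> y; rewrite inE.
Qed.

Lemma inv_overlay_full w s : inv w ->
  w (overlay s [set: V]%SET) = w (overlay nobody [set: V]%SET).
Proof.
move=> wi; have [n] := ubnP #|[set x | s x]%SET|; elim: n s => // n IH s sn.
have [/existsP[x sx]|/existsPn s0] := boolP [exists x, s x]; last first.
  by congr w; apply/ffunP => x; rewrite !ffunE inE (negPf (s0 x)).
pose s' : @stable V := [ffun y => (y != x) && s y].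
rewrite -(IH s'); last first.
  move: sn; rewrite (cardsD1 x) inE sx add1n ltnS; apply: leq_trans; rewrite ltnS.
  by apply: subset_leq_card; apply/fintype.subsetP => y; rewrite !inE ffunE.
rewrite -(inv_extra x wi (eta := overlay s' [set: V]%SET)); last first.
  by move=> y; rewrite /active_on /active_at ffunE inE.
congr w; apply/ffunP => z; rewrite add_activeE !ffunE inE.
by case: (eqVneq z x) => //= ->; rewrite sx.
Qed.

Section Driven.
Context (nu : V -> R) (nu_gt0 : forall x, 0 < nu x) (nu_sum : \sum_x nu x = 1).

Definition drive w eta : R := \sum_x nu x * w (add_active eta x).

Lemma inv_drive w : inv w -> inv (drive w).
Proof.
move=> wi eta y ay; rewrite /drive topple_lin; apply: eq_bigr => x _.
by rewrite (inv_add x wi).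
Qed.

Lemma inv_iter_drive t w : inv w -> inv (iter t drive w).
Proof. by move=> wi; elim: t => //= t; apply: inv_drive. Qed.

Lemma iter_drive_norm t w : (forall eta, `|w eta| <= 1) -> forall eta, `|iter t drive w eta| <= 1.
Proof.
move=> w1; elim: t => //= t IH eta; apply: le_trans (ler_norm_sum _ _ _) _.
rewrite -nu_sum; apply: ler_sum => x _; rewrite normrM ger0_norm; last exact: ltW.
by rewrite ler_piMr // ltW.
Qed.

Local Notation stb := (stab (K := K) (lam := lam)).

Lemma stab_norm s eta : `|stb s eta| <= 1.
Proof. by rewrite ger0_norm ?stab_ge0 ?stab_le1. Qed.

(** By [inv_stab], stabilizing after each addition may be postponed until all particles are
    added. *)
Lemma kernel_powE t s s' :
  kernel_pow (arw K lam nu) t s s' = iter t drive (stb s') (config_of_stable s).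
Proof.
elim: t s => [|t IH] s /=; first by rewrite stab_stable.
under eq_bigr do rewrite IH /arw mulr_suml.
rewrite exchange_big /=; apply: eq_bigr => x _.
under eq_bigr do rewrite absorptionE // -mulrA.
rewrite -mulr_sumr; congr (_ * _).
rewrite [RHS](inv_stab Kt lam_gt0).
- by apply: eq_bigr => z _; rewrite mulrC.
- by apply: inv_iter_drive; apply: stab_inv.
- by apply: iter_drive_norm => z; apply: stab_norm.
Qed.

Lemma iter_drive_overlay t w s B : inv w ->
  iter t drive w (overlay s B) = iter t (grow Kt nu) (fun B => w (overlay s B)) B.
Proof.
move=> wi; elim: t B => //= t IH B; rewrite /drive /grow; apply: eq_bigr => x _.
rewrite inv_settle; last exact: inv_iter_drive.
by congr (_ * _); apply: settle_ext.
Qed.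

Lemma iter_grow_indic t c A :
  iter t (grow Kt nu) (fun B => c * (1 - (B != [set: V]%SET)%:R)) A = c * (1 - surv Kt nu t A).
Proof.
elim: t A => //= t IH A; rewrite (grow_ext Kt nu_sum IH) growZ //.
by rewrite growB // growC.
Qed.

Definition target s : R := stb s (overlay nobody [set: V]%SET).

Lemma target_sum : \sum_s target s = 1.
Proof. exact: stab_sum. Qed.

Lemma target_ge0 s : 0 <= target s.
Proof. exact: stab_ge0. Qed.

Lemma kernel_pow_ge t s s' :
  (1 - surv Kt nu t finset.set0) * target s' <= kernel_pow (arw K lam nu) t s s'.
Proof.
rewrite kernel_powE -overlay0 iter_drive_overlay; last exact: stab_inv.
rewrite mulrC -iter_grow_indic; apply: iter_grow_le => // B.
case: eqP => [->|_]; last by rewrite subrr mulr0 stab_ge0.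
by rewrite subr0 mulr1 inv_overlay_full //; apply: stab_inv.
Qed.

Definition everybody : @stable V := [ffun=> true].

Lemma particles_obey m x eta : active_on eta x -> (particles (obey m x eta) <= particles eta)%N.
Proof.
move=> ax; have e := particles_remove ax; case: m => [[y|]|] /=.
- by rewrite particles_add -e.
- by rewrite e.
- by case: eqP => // x1; rewrite particles_sleep.
Qed.

Lemma stab_particles s eta : (particles eta < particles (config_of_stable s))%N -> stb s eta = 0.
Proof.
move=> lt; apply: cvg_lim => //; rewrite (_ : (fun k => _) = fun=> 0); first exact: cvg_cst.
apply/funext => k; elim: k eta lt => [|k IH] eta lt /=.
  by rewrite /at_stable; case: eqP => // e; rewrite e ltnn in lt.
rewrite /step; case: pickP => [x ax|_]; last exact: IH.
rewrite /topple big1 // => m _; rewrite IH ?mulr0 //.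
by apply: leq_ltn_trans lt; apply: particles_obey.
Qed.

(** From [nobody], the overlay holds one particle per occupied site, too few to end in [everybody]
    unless all sites are occupied; the minorization [kernel_pow_ge] is an equality here. *)
Lemma kernel_pow_everybody t :
  kernel_pow (arw K lam nu) t nobody everybody =
  (1 - surv Kt nu t finset.set0) * target everybody.
Proof.
rewrite kernel_powE -overlay0 iter_drive_overlay; last exact: stab_inv.
rewrite mulrC -iter_grow_indic; congr (iter _ _ _ _); apply/funext => B.
have [->|BT] := eqVneq B [set: V]%SET; first by rewrite subr0 mulr1.
rewrite subrr mulr0 stab_particles //.
have -> : particles (overlay nobody B) = #|B|.
  rewrite /particles -sum1_card [in RHS]big_mkcond /=; apply: eq_bigr => x _.
  by rewrite !ffunE; case: ifP.
have -> : particles (config_of_stable everybody) = #|[set: V]%SET|.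
  rewrite /particles -sum1_card [in RHS]big_mkcond /=; apply: eq_bigr => x _.
  by rewrite !ffunE inE.
by rewrite proper_card // finset.properT.
Qed.

(* Each active particle of [C] is alone at its site, the others sleep. *)
Let resting (C : {set V}) s : @config V :=
  [ffun x => if x \in C then Some 1%N else if s x then None else Some 0%N].

(** All particles of [C] may fall asleep at their first instruction; the linear bound is Bernoulli's
    inequality. *)
Lemma stab_resting (C : {set V}) s : (forall x, x \in C -> s x) ->
  0 < stb s (resting C s) /\ 1 - #|C|%:R * (1 - lazy_weight lam) <= stb s (resting C s).
Proof.
have b0 := lazy_weight_gt0 lam_gt0; have b1 := lazy_weight_lt1 lam_gt0.
have [n] := ubnP #|C|; elim: n C => // n IH C Cn Cs.
have [->|[x xC]] := set_0Vmem C.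
  rewrite (_ : resting _ _ = config_of_stable s); last by apply/ffunP => x; rewrite !ffunE inE.
  by rewrite stab_stable // eqxx cards0 mul0r subr0.
have ax : active_on (resting C s) x by rewrite /active_on /active_at ffunE xC.
have e : obey None x (resting C s) = resting (C :\ x)%SET s.
  apply/ffunP => z; rewrite obeyE !ffunE !inE; case: (eqVneq z x) => //= ->.
  by rewrite xC /= Cs.
have := IH (C :\ x)%SET; rewrite (cardsD1 x) xC add1n ltnS in Cn => /(_ Cn).
case=> [y|p1 p2]; first by rewrite !inE => /andP[_ /Cs].
have : lazy_weight lam * stb s (resting (C :\ x)%SET s) <= stb s (resting C s).
  rewrite -(stab_inv Kt lam_gt0 s ax) /topple (bigD1 None) // e /= lerDl.
  by apply: sumr_ge0 => m _; rewrite mulr_ge0 ?stab_ge0 ?instr_weight_ge0.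
have : 0 < lazy_weight lam * stb s (resting (C :\ x)%SET s) by rewrite mulr_gt0.
rewrite (cardsD1 x C) xC add1n -natr1.
have := stab_le1 Kt lam_gt0 s (resting (C :\ x)%SET s).
have : 0 <= #|(C :\ x)%SET|%:R :> R by [].
move: (#|_|%:R) (stb s (resting (C :\ x)%SET s)) p1 p2 => k p p1 p2 h0 h1 h2 h3.
split; first lra.
apply: le_trans h3; have : lazy_weight lam * (1 - k * (1 - lazy_weight lam)) <= lazy_weight lam * p.
  by rewrite ler_wpM2l // ltW.
nra.
Qed.

(** A particle outside [s] can be driven to its death: otherwise the starts from which [s] has
    probability 0 would carry a stochastic principal sub-matrix. Once only [s] is occupied,
    [stab_resting] applies. *)
Lemma stab_overlay_gt0 s B : (forall x, s x -> x \in B) -> 0 < stb s (overlay nobody B).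
Proof.
have b0 := lazy_weight_gt0 lam_gt0; have b1 := lazy_weight_lt1 lam_gt0.
have [n] := ubnP #|B|; elim: n B => // n IH B Bn sB.
have [/existsP[x /andP[xB sx]]|/existsPn h] := boolP [exists x, (x \in B) && ~~ s x]; last first.
  have -> : overlay nobody B = resting B s.
    apply/ffunP => x; rewrite !ffunE; case: ifP => // xB.
    by case: ifP => // /sB; rewrite xB.
  by have [] := @stab_resting B s => // x xB; have := h x; rewrite xB negbK.
pose B' := (B :\ x)%SET; pose c := overlay nobody B'.
have xB' : x \notin B' by rewrite !inE eqxx.
have -> : overlay nobody B = add_active c x by rewrite add_overlay // finset.setD1K.
have c0 : 0 < stb s c.
  apply: IH; first by move: Bn; rewrite (cardsD1 x) xB add1n ltnS.
  by move=> y sy; rewrite !inE sB // andbT; apply: contraNneq sx => <-.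
have cE y : exists k, c y = Some k.
  by rewrite ffunE; case: ifP => _; [exists 1%N; rewrite ffunE|exists 0%N; rewrite ffunE].
rewrite lt_neqAle stab_ge0 // andbT eq_sym; apply/negP => /eqP u0.
pose Z := [set z | stb s (add_active c z) == 0]%SET.
have [_ _ KZ] := Kt; have [K0 K1 _] := Kt.
have [|z] := KZ Z; first by apply/set0Pn; exists x; rewrite inE u0.
rewrite inE => /eqP uz; rewrite ltNge => /negP; apply.
have := stab_inv Kt lam_gt0 s (active_add_self c z); rewrite uz toppleE.
have [k zk] := cE z; rewrite /jump (remove_add zk) => e.
have t1 y : 0 <= K z y * stb s (add_active c y) by rewrite mulr_ge0 ?stab_ge0.
have t2 : 0 <= (1 - \sum_y K z y) * stb s c by rewrite mulr_ge0 ?subr_ge0 // ltW.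
have t3 : 0 <= \sum_y K z y * stb s (add_active c y) by apply: sumr_ge0.
have t4 := stab_ge0 Kt lam_gt0 s (obey None z (add_active c z)).
have e1 : \sum_y K z y * stb s (add_active c y) = 0 by nra.
have e2 : (1 - \sum_y K z y) * stb s c = 0 by nra.
move/eqP: e2; rewrite mulf_eq0 (gt_eqF c0) orbF subr_eq0 => /eqP ->.
rewrite (bigID (mem Z)) /= [X in _ + X]big1 ?addr0 // => y yZ.
move/eqP: e1; rewrite psumr_eq0 // => /allP /(_ y (mem_index_enum y)).
by rewrite mulf_eq0 => /orP[/eqP//|]; move: yZ; rewrite inE => /negPf ->.
Qed.

Lemma target_gt0 s : 0 < target s.
Proof. by apply: stab_overlay_gt0 => x _; rewrite inE. Qed.

Lemma target_everybody_ge : 1 - #|V|%:R / (1 + lam) <= target everybody.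
Proof.
have [x xV|_] := @stab_resting [set: V]%SET everybody; first by rewrite ffunE.
rewrite cardsT /target (_ : overlay _ _ = resting [set: V]%SET everybody); last first.
  by apply/ffunP => x; rewrite !ffunE inE.
apply: le_trans; rewrite lerD2l lerN2 ler_wpM2l //.
have : 1 + lam != 0 by rewrite gt_eqF // addr_gt0.
move=> l0; rewrite /lazy_weight le_eqVlt; apply/orP; left; apply/eqP; by field.
Qed.

Context (pi : @stable V -> R) (piP : stationary (arw K lam nu) pi).
Context (surv0 : forall e, 0 < e -> exists t, surv Kt nu t finset.set0 <= e).

Lemma stationary_pow t s : \sum_x pi x * kernel_pow (arw K lam nu) t x s = pi s.
Proof.
case: piP => _ _ piS; elim: t => [|t IH].
  by rewrite (bigD1 s) //= eqxx mulr1 big1 ?addr0 // => x /negPf ->; rewrite mulr0.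
rewrite -[RHS]IH /=; under eq_bigr do rewrite mulr_sumr.
rewrite exchange_big /=; apply: eq_bigr => z _.
by rewrite -piS mulr_suml; apply: eq_bigr => x _; rewrite mulrA.
Qed.

(** Letting the time grow in [kernel_pow_ge] gives [target <= pi], and both sum to 1. *)
Lemma stationaryE s : pi s = target s.
Proof.
have [pi0 pi1 _] := piP.
have ge (z : @stable V) : target z <= pi z.
  apply/ler_addgt0Pl => e e0; have [t st] := surv0 e0.
  apply: (@le_trans _ _ ((1 - e) * target z + e)).
    have : target z <= 1 by apply: stab_le1.
    by move=> h; nra.
  rewrite addrC lerD2l; apply: (@le_trans _ _ ((1 - surv Kt nu t finset.set0) * target z)).
    by rewrite ler_wpM2r ?target_ge0 //; lra.
  rewrite -(stationary_pow t).
  apply: (@le_trans _ _ (\sum_x pi x * ((1 - surv Kt nu t finset.set0) * target z))).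
    by rewrite -mulr_suml pi1 mul1r.
  apply: ler_sum => x _.
  by rewrite ler_wpM2l // kernel_pow_ge.
apply/eqP; rewrite -subr_eq0.
have : \sum_z (pi z - target z) = 0 by rewrite sumrB pi1 target_sum subrr.
move/eqP; rewrite psumr_eq0 => [|z _]; last by rewrite subr_ge0.
by move/allP/(_ s (mem_index_enum s)).
Qed.

Lemma dsepE t : dsep (arw K lam nu) pi t = surv Kt nu t finset.set0.
Proof.
have s0 : 0 <= surv Kt nu t finset.set0 by apply: surv_ge0.
apply/eqP; rewrite eq_le; apply/andP; split.
  apply: bigmax_le => // x _; apply: bigmax_le => // y _.
  rewrite stationaryE lerBlDr -lerBlDl ler_pdivlMr ?target_gt0 //.
  exact: kernel_pow_ge.
apply: le_trans (le_bigmax _ _ nobody); apply: le_trans (le_bigmax _ _ everybody).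
rewrite stationaryE kernel_pow_everybody -mulrA divff ?gt_eqF ?target_gt0 //.
by rewrite mulr1 opprB addrCA subrr addr0.
Qed.

Lemma kernel_pow_sum t s : \sum_z kernel_pow (arw K lam nu) t s z = 1.
Proof.
elim: t s => [|t IH] s /=.
  by rewrite (bigD1 s) //= eqxx big1 ?addr0 // => z; rewrite eq_sym => /negPf ->.
rewrite exchange_big /=; under eq_bigr do rewrite -mulr_sumr IH mulr1.
rewrite /arw exchange_big /=; under eq_bigr do rewrite -mulr_sumr.
rewrite -[RHS]nu_sum; apply: eq_bigr => x _.
under eq_bigr do rewrite absorptionE //.
by rewrite stab_sum ?mulr1.
Qed.

Lemma dtv_le t : dtv (arw K lam nu) pi t <= surv Kt nu t finset.set0.
Proof.
have s0 : 0 <= surv Kt nu t finset.set0 by apply: surv_ge0.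
apply: bigmax_le => // x _; apply: bigmax_le => // A _.
have half (B : {set @stable V}) :
    \sum_(y in B) pi y - surv Kt nu t finset.set0 <= \sum_(y in B) kernel_pow (arw K lam nu) t x y.
  apply: (@le_trans _ _ (\sum_(y in B) (1 - surv Kt nu t finset.set0) * pi y)).
    rewrite -mulr_sumr mulrBl mul1r lerD2l lerN2 ler_piMr //.
    have [pi0 <- _] := piP; rewrite [leRHS](bigID (mem B)) /= lerDl.
    by apply: sumr_ge0.
  by apply: ler_sum => y _; rewrite stationaryE kernel_pow_ge.
have c1 (F : @stable V -> R) : \sum_(y in A) F y = \sum_y F y - \sum_(y in ~: A) F y.
  rewrite [\sum_y F y](bigID (mem A)) /= -addrA -[LHS]addr0; congr (_ + _).
  apply/eqP; rewrite eq_sym subr_eq0; apply/eqP; apply: eq_bigl => y.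
  by rewrite finset.in_setC.
have [_ pi1 _] := piP.
rewrite ler_norml; apply/andP; split; first by have := half A; lra.
rewrite !c1 kernel_pow_sum pi1; have := half (~: A)%SET; lra.
Qed.

Lemma dtv_ge t : (1 - #|V|%:R / (1 + lam)) * surv Kt nu t finset.set0 <= dtv (arw K lam nu) pi t.
Proof.
have s0 : 0 <= surv Kt nu t finset.set0 by apply: surv_ge0.
apply: le_trans (le_bigmax _ _ nobody); apply: le_trans (le_bigmax _ _ [set everybody]%SET).
rewrite !big_set1 stationaryE kernel_pow_everybody.
rewrite [X in `|X|](_ : _ = - (surv Kt nu t finset.set0 * target everybody)); last by ring.
rewrite normrN ger0_norm ?mulr_ge0 ?target_ge0 //.
by rewrite [leRHS]mulrC ler_wpM2r // target_everybody_ge.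
Qed.

End Driven.
End InvariantFunctions.

(** * Cutoff *)

Lemma least_le (p : pred nat) t : p t -> (least p <= t)%N.
Proof. by rewrite /least; case: pselect => // h pt; case: ex_minnP => i _; apply. Qed.

Lemma leastP (p : pred nat) t : p t -> p (least p).
Proof.
by move=> pt; rewrite /least; case: pselect => [h|[]]; [case: ex_minnP|exists t].
Qed.

(** * From second-moment bounds to mixing times *)

Section Concentration.
Context {R : realType} (sv d : nat -> R) (m s e : R).
Hypotheses (m0 : 0 <= m) (s0 : 0 <= s).
Hypothesis sv_hi : forall t, m <= t%:R -> sv t * (t%:R - m) ^+ 2 <= s ^+ 2.
Hypothesis sv_lo : forall t, t%:R <= m -> (1 - sv t) * (m - t%:R) ^+ 2 <= s ^+ 2.
Hypothesis sv_ge0 : forall t, 0 <= sv t.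
Hypothesis d_le : forall t, d t <= sv t.
Hypothesis d_ge : forall t, (1 - e) * sv t <= d t.

Lemma sv_le_of_far t eps C : 0 <= C -> 1 <= eps * C ^+ 2 ->
  C * s <= t%:R - m -> 0 < t%:R - m -> sv t <= eps.
Proof.
move=> C0 Ceps h h0; have := sv_hi (t := t); rewrite -subr_ge0 (ltW h0) => /(_ isT) le.
rewrite -(ler_pM2r (exprn_gt0 2 h0)); apply: le_trans le _.
have eps0 : 0 <= eps.
  rewrite leNgt; apply/negP => en; have : eps * C ^+ 2 <= 0 by rewrite nmulr_rle0 // sqr_ge0.
  lra.
apply: (@le_trans _ _ (eps * (C * s) ^+ 2)).
  by rewrite exprMn mulrA ler_peMl // sqr_ge0.
by rewrite ler_wpM2l // lerXn2r // nnegrE ?mulr_ge0 // ltW.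
Qed.

Lemma far_of_sv_le t k C : 0 <= C -> 1 <= k * C ^+ 2 ->
  k <= 1 - sv t -> m - t%:R <= C * s.
Proof.
move=> C0 kC ks; have [mt|tm] := leP m t%:R.
  by apply: (@le_trans _ _ 0); rewrite ?mulr_ge0 // subr_le0.
rewrite leNgt; apply/negP => lt.
have h0 : 0 < m - t%:R by rewrite subr_gt0.
have le := sv_lo (ltW tm).
have k0 : 0 < k.
  rewrite ltNge; apply/negP => en; have : k * C ^+ 2 <= 0 by rewrite mulr_le0_ge0 // sqr_ge0.
  lra.
have : k * (m - t%:R) ^+ 2 <= s ^+ 2.
  by apply: le_trans le; rewrite ler_wpM2r // sqr_ge0.
apply/negP; rewrite -ltNge.
apply: (@le_lt_trans _ _ (k * (C * s) ^+ 2)).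
  by rewrite exprMn mulrA ler_peMl // sqr_ge0.
by rewrite ltr_pM2l // !expr2 ltr_pM ?mulr_ge0.
Qed.

(** Chebyshev on both sides of [m]. Above it, [eps * C ^ 2 >= 1] is needed; below it, half of
    [1 - eps] is given up to the discrepancy [e] between [d] and [sv], whence [2 / (1 - eps)]. The
    final 1 is for rounding to an integer time. *)
Lemma least_concentration eps : 0 < eps -> eps < 1 -> e <= (1 - eps) / 2 ->
  `|(least (fun t => d t <= eps))%:R - m| <= (eps^-1 + 2 / (1 - eps)) * s + 1.
Proof.
move=> eps0 eps1 ee; set C := eps^-1 + _.
have C1 : eps^-1 <= C by rewrite lerDl divr_ge0 //; lra.
have C2 : 2 / (1 - eps) <= C by rewrite lerDr invr_ge0 ltW.
have i1 : 1 <= eps^-1 by rewrite invf_ge1 // ltW.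
have C0 : 0 <= C by lra.
have Cs : 0 <= C * s by rewrite mulr_ge0.
have epsC : 1 <= eps * C ^+ 2.
  have : eps * C >= 1 by rewrite -ler_pdivrMl // mulr1.
  rewrite expr2 mulrA => h; nra.
have kC : 1 <= (1 - eps) / 2 * C ^+ 2.
  have : (1 - eps) / 2 * C >= 1.
    rewrite -ler_pdivrMl ?divr_gt0 ?subr_gt0 // mulr1 invf_div //.
  rewrite expr2 mulrA => h; nra.
pose t0 := (Num.truncn (m + C * s)).+1.
have [t0a t0b] : m + C * s < t0%:R /\ t0%:R <= m + C * s + 1.
  rewrite /t0 truncnS_gt -natr1 lerD2r truncn_le ?addr_ge0 //.
have dt0 : d t0 <= eps.
  by apply: le_trans (d_le _) _; apply: (sv_le_of_far C0 epsC); lra.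
rewrite ler_norml; apply/andP; split; last first.
  have : (least (fun t => d t <= eps))%:R <= t0%:R :> R by rewrite ler_nat least_le.
  lra.
have := leastP (p := fun t => d t <= eps) dt0; set t := least _ => dt.
have : m - t%:R <= C * s.
  apply: (far_of_sv_le C0 kC).
  have := d_ge t; have := sv_ge0 t => h1 h2; nra.
lra.
Qed.

End Concentration.

Section Asymptotics.
Context {R : realType} {S : nat -> finType}.
Context (P : forall n, S n -> S n -> R) (pi : forall n, S n -> R).
Context (sv : nat -> nat -> R) (m w e : nat -> R) (B : R).
Local Open Scope classical_set_scope.

Hypothesis B_gt0 : 0 < B.
Hypothesis w_ge1 : \forall n \near \oo, 1 <= w n.
Hypothesis w_small : forall eps, 0 < eps -> \forall n \near \oo, w n <= eps * m n.
Hypothesis e_small : forall eps, 0 < eps -> \forall n \near \oo, e n <= eps.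
Hypothesis dsep_sv : \forall n \near \oo, forall t, dsep (@P n) (@pi n) t = sv n t.
Hypothesis dtv_sv : \forall n \near \oo, forall t,
  (1 - e n) * sv n t <= dtv (@P n) (@pi n) t <= sv n t.
Hypothesis sv01 : \forall n \near \oo, forall t, 0 <= sv n t <= 1.
Hypothesis sv_up : \forall n \near \oo, forall t, m n <= t%:R ->
  sv n t * (t%:R - m n) ^+ 2 <= (B * w n) ^+ 2.
Hypothesis sv_low : \forall n \near \oo, forall t, t%:R <= m n ->
  (1 - sv n t) * (m n - t%:R) ^+ 2 <= (B * w n) ^+ 2.

Let T eps n : R := (tmix (@P n) (@pi n) eps)%:R.
Let C eps : R := eps^-1 + 2 / (1 - eps).

Let C_gt0 eps : 0 < eps -> eps < 1 -> 0 < C eps.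
Proof. by move=> e0 e1; rewrite addr_gt0 ?divr_gt0 ?invr_gt0 ?subr_gt0. Qed.

Let m_ge0 : \forall n \near \oo, 0 <= m n.
Proof.
near=> n; have w1 : 1 <= w n by near: n.
have : w n <= 1 * m n by near: n; apply: w_small.
lra.
Unshelve. all: by end_near. Qed.

Lemma tmix_near eps : 0 < eps -> eps < 1 ->
  \forall n \near \oo, `|T eps n - m n| <= (C eps * B + 1) * w n.
Proof.
move=> eps0 eps1; near=> n.
have w1 : 1 <= w n by near: n.
have mn : 0 <= m n by near: n.
have dn t : (1 - e n) * sv n t <= dtv (@P n) (@pi n) t <= sv n t by move: t; near: n.
have := @least_concentration R (sv n) (dtv (@P n) (@pi n)) (m n) (B * w n) (e n) mn.
move=> /(_ _ _ _ _ _ _ eps eps0 eps1) h.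
apply: (@le_trans _ _ (C eps * (B * w n) + 1)).
  2: by rewrite (mulrDl (C eps * B) 1) mul1r mulrA lerD2l.
apply: h => [||||t|t|].
- by rewrite mulr_ge0 ?(ltW B_gt0) //; lra.
- by near: n.
- by near: n.
- by move=> t; have /andP[] : 0 <= sv n t <= 1 by move: t; near: n.
- by case/andP: (dn t).
- by case/andP: (dn t).
- by near: n; apply: e_small; rewrite divr_gt0 ?subr_gt0.
Unshelve. all: by end_near. Qed.

Lemma tsep_near : \forall n \near \oo,
  `|(tsep (@P n) (@pi n))%:R - m n| <= (C 2^-1 * B + 1) * w n.
Proof.
near=> n.
have w1 : 1 <= w n by near: n.
have mn : 0 <= m n by near: n.
have -> : tsep (@P n) (@pi n) = least (fun t => sv n t <= 2^-1).
  rewrite /tsep; congr least; apply/funext => t.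
  by have -> : dsep (@P n) (@pi n) t = sv n t by move: t; near: n.
apply: (@le_trans _ _ (C 2^-1 * (B * w n) + 1)).
  2: by rewrite (mulrDl (C 2^-1 * B) 1) mul1r mulrA lerD2l.
apply: (@least_concentration R (sv n) (sv n) (m n) (B * w n) 0 mn) => //.
- by rewrite mulr_ge0 ?(ltW B_gt0) //; lra.
- by near: n.
- by near: n.
- by move=> t; have /andP[] : 0 <= sv n t <= 1 by move: t; near: n.
- by move=> t; rewrite subr0 mul1r.
- by lra.
- by lra.
Unshelve. all: by end_near. Qed.

Lemma window_of_concentration : cutoff_window P pi w.
Proof.
move=> eps eps0 eps2; apply/eqO_exP.
have eps1 : eps < 1 by lra.
have eps1' : 0 < 1 - eps by lra.
have eps1'' : 1 - eps < 1 by lra.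
have h1 := C_gt0 eps0 eps1; have h2 := C_gt0 eps1' eps1''.
exists ((C eps * B + 1) + (C (1 - eps) * B + 1)).
  by rewrite !addr_gt0 // mulr_gt0.
near=> n.
have : `|T eps n - m n| <= (C eps * B + 1) * w n by near: n; apply: tmix_near.
have : `|T (1 - eps) n - m n| <= (C (1 - eps) * B + 1) * w n by near: n; apply: tmix_near.
have w1 : 1 <= w n by near: n.
rewrite (ger0_norm (x := w n)); last lra.
rewrite (mulrDl (C eps * B + 1)) => a b; apply: le_trans _ (lerD b a).
rewrite [X in _ <= _ + X]distrC; apply: le_trans _ (ler_normD _ _).
by rewrite addrA subrK.
Unshelve. all: by end_near. Qed.

Lemma small_window (c eps : R) : 0 < c -> 0 < eps -> \forall n \near \oo, c * w n <= eps * m n.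
Proof.
move=> c0 eps0; near=> n; rewrite -ler_pdivlMl // mulrA.
by near: n; apply: w_small; rewrite mulr_gt0 ?invr_gt0.
Unshelve. all: by end_near. Qed.

Lemma equiv_of_near (f g : nat -> R) (c : R) : 0 < c ->
  (\forall n \near \oo, `|f n - g n| <= c * w n) ->
  (\forall n \near \oo, m n <= 2 * g n) -> f ~_\oo g.
Proof.
move=> c0 fg mg; apply/eqaddoP => _/posnumP[eps].
near=> n; rewrite /=.
have mn : 0 <= m n by near: n.
have g2 : m n <= 2 * g n by near: n.
apply: (@le_trans _ _ (c * w n)); first by near: n.
apply: (@le_trans _ _ (eps%:num / 2 * m n)); first by near: n; apply: small_window.
rewrite (ger0_norm (x := g n)); last lra.
by rewrite -mulrA ler_wpM2l // ler_pdivrMl.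
Unshelve. all: by end_near. Qed.

Let c2_gt0 : 0 < C 2^-1 * B + 1.
Proof.
have C0 : 0 < C 2^-1 by apply: C_gt0; lra.
by apply: addr_gt0 => //; apply: mulr_gt0.
Qed.

Lemma tmix_equiv_m : T 2^-1 ~_\oo m.
Proof.
apply: (equiv_of_near c2_gt0); first by apply: tmix_near; lra.
by near=> n; have : 0 <= m n by [near: n]; lra.
Unshelve. all: by end_near. Qed.

Lemma tmix_equiv_tsep : T 2^-1 ~_\oo (fun n => (tsep (@P n) (@pi n))%:R : R).
Proof.
apply: (equiv_trans tmix_equiv_m); apply: equiv_sym.
apply: (equiv_of_near c2_gt0); first exact: tsep_near.
by near=> n; have : 0 <= m n by [near: n]; lra.
Unshelve. all: by end_near. Qed.

Lemma tv_cutoff_of_concentration : tv_cutoff P pi.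
Proof.
move=> alpha a0 d.
have T_near (delta : R) : 0 < delta -> \forall n \near \oo, `|T 2^-1 n - m n| <= delta * m n.
  move=> d0; near=> n; apply: (@le_trans _ _ ((C 2^-1 * B + 1) * w n)).
    by near: n; apply: tmix_near; lra.
  by near: n; apply: small_window.
have sq_small (b : R) : 0 < b -> forall eps, 0 < eps ->
    \forall n \near \oo, (B * w n) ^+ 2 <= eps * (b * m n) ^+ 2.
  (* The minimum with 1 has a square at most [eps]. *)
  move=> b0 eps e0; pose z := Num.min eps 1 * b.
  have z0 : 0 < z by rewrite mulr_gt0 // lt_min e0 ltr01.
  near=> n; have mn : 0 <= m n by near: n.
  have w1 : 1 <= w n by near: n.
  have : B * w n <= z * m n by near: n; apply: small_window.
  rewrite /z -mulrA => h; apply: (@le_trans _ _ ((Num.min eps 1 * (b * m n)) ^+ 2)).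
    have hw : 0 <= B * w n by apply: mulr_ge0; [exact: ltW|lra].
    by rewrite lerXn2r // nnegrE; apply: le_trans hw h.
  rewrite exprMn ler_wpM2r ?sqr_ge0 // expr2.
  apply: (@le_trans _ _ (Num.min eps 1 * 1)); last by rewrite mulr1 ge_min lexx.
  by rewrite ler_wpM2l ?ge_min ?lexx ?orbT // le_min (ltW e0) ler01.
split=> [a1|a1].
- apply/cvgrPdist_le => eps e0; near=> n.
  have dn t : (1 - e n) * sv n t <= dtv (@P n) (@pi n) t <= sv n t by move: t; near: n.
  have sn t : 0 <= sv n t <= 1 by move: t; near: n.
  have mn : 0 <= m n by near: n.
  have Tn : `|T 2^-1 n - m n| <= (1 - alpha) / 2 * m n by near: n; apply: T_near; lra.
  have en : e n <= Num.min (eps / 2) (1 / 2).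
    by near: n; apply: e_small; rewrite lt_min !divr_gt0.
  have [en1 en2] : e n <= eps / 2 /\ e n <= 1 / 2.
    by move: en; rewrite le_min => /andP[].
  rewrite /d; set t := Num.truncn _.
  have w1 : 1 <= w n by near: n.
  have m1 : w n <= 1 * m n by near: n; apply: w_small.
  have tT : t%:R <= alpha * T 2^-1 n by rewrite truncn_le // mulr_ge0.
  have far : (1 - alpha) / 2 * m n <= m n - t%:R.
    move: Tn; rewrite ler_norml => /andP[_ Tn].
    have : alpha * (T 2^-1 n) <= alpha * (m n + (1 - alpha) / 2 * m n) by rewrite ler_wpM2l //; lra.
    have : 0 <= m n * ((1 - alpha) * (1 - alpha)).
      by rewrite mulr_ge0 // -expr2 sqr_ge0.
    move: (T 2^-1 n) tT Tn => x tx xm; lra.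
  have q0 : 0 < (1 - alpha) / 2 by lra.
  have qm : 0 < (1 - alpha) / 2 * m n by rewrite mulr_gt0 //; lra.
  have : (1 - sv n t) * (m n - t%:R) ^+ 2 <= (B * w n) ^+ 2.
    have tm : t%:R <= m n by lra.
    by move: t tm {tT far}; near: n.
  have : (B * w n) ^+ 2 <= eps / 2 * ((1 - alpha) / 2 * m n) ^+ 2.
    by near: n; apply: sq_small => //; lra.
  move=> sq1 sq2.
  have s1 : 1 - sv n t <= eps / 2.
    rewrite -(ler_pM2r (exprn_gt0 2 qm)); apply: le_trans sq1; apply: le_trans sq2.
    have /andP[_ h] := sn t.
    by rewrite ler_wpM2l ?subr_ge0 // lerXn2r // nnegrE; lra.
  have /andP[d1 d2] := dn t; have /andP[sn1 sn2] := sn t.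
  rewrite ger0_norm; last lra.
  have : e n * sv n t <= eps / 2.
    have [en0|en0] := leP 0 (e n); first by rewrite -[leRHS]mulr1 ler_pM.
    by apply: (@le_trans _ _ 0); [rewrite nmulr_rle0|lra].
  lra.
- apply/cvgr0Pnorm_le => eps e0.
  (* Chosen so that [alpha + 2] errors of size [delta * m n], from the mixing time and from
     rounding, use up half of [alpha - 1]. *)
  pose delta := (alpha - 1) / (2 * (alpha + 2)).
  have dl0 : 0 < delta by apply: divr_gt0; [|apply: mulr_gt0]; lra.
  near=> n.
  have dn t : (1 - e n) * sv n t <= dtv (@P n) (@pi n) t <= sv n t by move: t; near: n.
  have sn t : 0 <= sv n t <= 1 by move: t; near: n.
  have mn : 0 <= m n by near: n.
  have Tn : `|T 2^-1 n - m n| <= delta * m n by near: n; apply: T_near.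
  have en : e n <= 1 / 2 by near: n; apply: e_small; lra.
  rewrite /d; set t := Num.truncn _.
  have w1 : 1 <= w n by near: n.
  have m1 : w n <= delta * m n by near: n; apply: w_small.
  have m2 : 0 < m n.
    by rewrite -(pmulr_rgt0 _ dl0); lra.
  have tT : alpha * T 2^-1 n < t%:R + 1 by rewrite natr1 truncnS_gt.
  have far : (alpha - 1) / 2 * m n <= t%:R - m n.
    move: Tn; rewrite ler_norml => /andP[Tn _].
    have : alpha * (m n - delta * m n) <= alpha * (T 2^-1 n) by rewrite ler_wpM2l //; lra.
    have : delta * (alpha + 2) = (alpha - 1) / 2.
      by rewrite /delta; field; rewrite gt_eqF //; lra.
    move: (T 2^-1 n) tT Tn => x tx xm de ax.
    have : delta * (alpha + 2) * m n = (alpha - 1) / 2 * m n by rewrite de.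
    have : delta * m n <= delta * (m n) by []. lra.
  have q0 : 0 < (alpha - 1) / 2 by lra.
  have qm : 0 < (alpha - 1) / 2 * m n by rewrite mulr_gt0.
  have : sv n t * (t%:R - m n) ^+ 2 <= (B * w n) ^+ 2.
    have tm : m n <= t%:R by lra.
    by move: t tm {tT far}; near: n.
  have : (B * w n) ^+ 2 <= eps * ((alpha - 1) / 2 * m n) ^+ 2.
    by near: n; apply: sq_small => //; lra.
  move=> sq1 sq2.
  have s1 : sv n t <= eps.
    rewrite -(ler_pM2r (exprn_gt0 2 qm)); apply: le_trans sq1; apply: le_trans sq2.
    have /andP[h _] := sn t.
    by rewrite ler_wpM2l // lerXn2r // nnegrE; lra.
  have /andP[d1 d2] := dn t; have /andP[sn1 sn2] := sn t.
  rewrite ger0_norm; first exact: le_trans d2 s1.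
  apply: le_trans d1; rewrite mulr_ge0 //; lra.
Unshelve. all: by end_near. Qed.

End Asymptotics.

(** * Mixing estimates from the mean filling time under uniform driving *)

Section UniformDriving.
Context {R : realType} {V : finType}.

Lemma uniform_gt0 (x : V) : 0 < @uniform_law R V x.
Proof. by rewrite /uniform_law invr_gt0 ltr0n; apply/card_gt0P; exists x. Qed.

Lemma uniform_sum : (0 < #|V|)%N -> \sum_x @uniform_law R V x = 1.
Proof.
by move=> V0; rewrite /uniform_law sumr_const -[LHS]mulr_natl divff // pnatr_eq0 -lt0n.
Qed.

Definition fill_data (K : V -> V -> R) (m r : R) : Prop :=
  exists (Kt : transient K) (u1 : \sum_x @uniform_law R V x = 1),
    m = fill_time Kt uniform_gt0 u1 finset.set0 /\
    forall y, 1 <= r * grow_at Kt (@uniform_law R V) (~: [set y])%SET y.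

Lemma mixing_of_fill (K : V -> V -> R) (lam m r : R) (pi : @stable V -> R) :
  fill_data K m r -> 0 < lam -> stationary (arw K lam (@uniform_law R V)) pi ->
  let P := arw K lam (@uniform_law R V) in
  exists sv : nat -> R,
    [/\ forall t, dsep P pi t = sv t,
        forall t, (1 - #|V|%:R / (1 + lam)) * sv t <= dtv P pi t <= sv t,
        forall t, 0 <= sv t <= 1,
        forall t, m <= t%:R -> sv t * (t%:R - m) ^+ 2 <= r * m
      & forall t, t%:R <= m -> (1 - sv t) * (m - t%:R) ^+ 2 <= r * m].
Proof.
move=> [Kt [u1 [-> hr]]] l0 piP P.
pose sv t := surv Kt (@uniform_law R V) t finset.set0.
set m0 := fill_time _ _ _ _.
have up t : m0 <= t%:R -> sv t * (t%:R - m0) ^+ 2 <= r * m0.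
  move=> h; have := surv_upper uniform_gt0 u1 hr finset.set0 h.
  by rewrite -/m0 subrr expr0n addr0.
have low t : t%:R <= m0 -> (1 - sv t) * (m0 - t%:R) ^+ 2 <= r * m0.
  move=> h; have := surv_lower uniform_gt0 u1 hr finset.set0 h.
  by rewrite -/m0 subrr expr0n addr0.
have s01 t : 0 <= sv t <= 1.
  by rewrite surv_ge0 ?surv_le1 //; apply: uniform_gt0.
have s0 e : 0 < e -> exists t, sv t <= e.
  (* Past [m0] by at least 1, so that the square dominates the distance, and by at least
     [r * m0 / e]. *)
  move=> e0; pose t := (Num.truncn (`|m0| + `|r * m0| / e + 1)).+1.
  have t1 : `|m0| + `|r * m0| / e + 1 < t%:R by apply: truncnS_gt.
  have q0 : 0 <= `|r * m0| / e by rewrite divr_ge0 // ltW.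
  have h1 : m0 <= `|m0| by apply: ler_norm.
  have d1 : 1 <= t%:R - m0 by lra.
  have h2 : sv t * (t%:R - m0) ^+ 2 <= r * m0 by apply: up; lra.
  exists t; have /andP[sv0 _] := s01 t.
  rewrite -(ler_pM2r (_ : 0 < t%:R - m0)); last lra.
  apply: (@le_trans _ _ (sv t * (t%:R - m0) ^+ 2)).
    by rewrite ler_wpM2l // expr2 ler_peMl //; lra.
  apply: le_trans h2 _; apply: (le_trans (ler_norm _)).
  by rewrite -ler_pdivrMl //; lra.
exists sv; split=> //.
- by move=> t; apply: (dsepE l0 uniform_gt0 u1 piP s0).
- move=> t; apply/andP; split.
    exact: (dtv_ge l0 uniform_gt0 u1 piP s0).
  exact: (dtv_le l0 uniform_gt0 u1 piP s0).
Qed.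

End UniformDriving.

Section FromEstimates.
Context {R : realType} {V : nat -> finType}.
Local Open Scope classical_set_scope.
Implicit Types (K : forall n, V n -> V n -> R) (w m lam : nat -> R).

(** As [r n * m n] bounds the variance of the filling time, [w] is required to dominate the standard
    deviation and to be negligible against the mean. *)
Definition filling_estimates K w m : Prop :=
  exists r : nat -> R, exists2 B : R, 0 < B &
  [/\ forall n, (0 < n)%N -> fill_data (K n) (m n) (r n),
      \forall n \near \oo, r n * m n <= (B * w n) ^+ 2,
      \forall n \near \oo, 1 <= w n
    & forall eps, 0 < eps -> \forall n \near \oo, w n <= eps * m n].

Lemma cutoff_of_estimates K w m lam (pi : forall n, @stable (V n) -> R) :
  let P := fun n => arw (K n) (lam n) (@uniform_law R (V n)) in
  let t_mix := fun n => (tmix (P n) (pi n) 2^-1)%:R : R in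
  let t_sep := fun n => (tsep (P n) (pi n))%:R : R in
  filling_estimates K w m ->
  (forall n, (0 < n)%N -> 0 < lam n) ->
  (forall n, (0 < n)%N -> stationary (P n) (pi n)) ->
  lam n / #|V n|%:R @[n --> \oo] --> +oo ->
  [/\ tv_cutoff P pi, t_mix ~_\oo t_sep, t_mix ~_\oo m & cutoff_window P pi w].
Proof.
move=> P t_mix t_sep [r [B B0 [fd rm w1 wm]]] lam0 piP lamV.
have /choice[sv svP] : forall n, exists sv : nat -> R, (0 < n)%N ->
    [/\ forall t, dsep (P n) (@pi n) t = sv t,
        forall t, (1 - #|V n|%:R / (1 + lam n)) * sv t <= dtv (P n) (@pi n) t <= sv t,
        forall t, 0 <= sv t <= 1,
        forall t, m n <= t%:R -> sv t * (t%:R - m n) ^+ 2 <= r n * m n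
      & forall t, t%:R <= m n -> (1 - sv t) * (m n - t%:R) ^+ 2 <= r n * m n].
  case=> [|n]; first by exists (fun=> 0).
  by have [sv ?] := mixing_of_fill (fd n.+1 isT) (lam0 n.+1 isT) (piP n.+1 isT); exists sv.
pose e n : R := #|V n|%:R / (1 + lam n).
have n_pos : \forall n \near \oo, (0 < n)%N by exists 1%N.
have e_small eps : 0 < eps -> \forall n \near \oo, e n <= eps.
  move=> e0; near=> n.
  have ln : 0 < lam n by apply: lam0; near: n.
  have big : eps^-1 <= lam n / #|V n|%:R.
    by near: n; move/cvgryPge : lamV; apply; rewrite num_real.
  have V0 : 0 < #|V n|%:R :> R.
    rewrite lt_neqAle ler0n andbT; apply/eqP => V0; move: big.
    by rewrite -V0 invr0 mulr0 leNgt invr_gt0 e0.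
  rewrite /e ler_pdivrMr ?addr_gt0 //.
  move: big; rewrite ler_pdivlMr // ler_pdivrMl // mulrDr mulr1 => h.
  by apply: (le_trans h); rewrite lerDr ltW.
have h1 : \forall n \near \oo, forall t, dsep (P n) (@pi n) t = sv n t.
  by near=> n; case: (svP n) => //; near: n.
have h2 : \forall n \near \oo, forall t, (1 - e n) * sv n t <= dtv (P n) (@pi n) t <= sv n t.
  by near=> n; case: (svP n) => //; near: n.
have h3 : \forall n \near \oo, forall t, 0 <= sv n t <= 1.
  by near=> n; case: (svP n) => //; near: n.
have h4 : \forall n \near \oo, forall t, m n <= t%:R ->
    sv n t * (t%:R - m n) ^+ 2 <= (B * w n) ^+ 2.
  near=> n => t mt; apply: (@le_trans _ _ (r n * m n)); last by near: n.
  by have [|_ _ _ h _] := svP n; [near: n|apply: h].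
have h5 : \forall n \near \oo, forall t, t%:R <= m n ->
    (1 - sv n t) * (m n - t%:R) ^+ 2 <= (B * w n) ^+ 2.
  near=> n => t mt; apply: (@le_trans _ _ (r n * m n)); last by near: n.
  by have [|_ _ _ _ h] := svP n; [near: n|apply: h].
split.
- exact: (tv_cutoff_of_concentration B0 w1 wm e_small h2 h3 h4 h5).
- exact: (tmix_equiv_tsep B0 w1 wm e_small h1 h2 h3 h4 h5).
- exact: (tmix_equiv_m B0 w1 wm e_small h2 h3 h4 h5).
- exact: (window_of_concentration B0 w1 wm e_small h2 h3 h4 h5).
Unshelve. all: by end_near. Qed.

End FromEstimates.

(** * Hitting probabilities *)

Section HarmonicNumbers.
Context {R : realType}.

Lemma harmonic_num_ge_ln n : ln (n.+1%:R) <= harmonic_num n :> R.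
Proof.
elim: n => [|n IH]; first by rewrite /harmonic_num big_ord0 ln1.
rewrite harmonic_numS.
have -> : n.+2%:R = n.+1%:R * (1 + n.+1%:R^-1) :> R.
  by rewrite mulrDr mulr1 divff ?pnatr_eq0 // natr1.
rewrite lnM ?posrE ?ltr0n // ?addr_gt0 // lerD // le_ln1Dx //.
by apply: (@lt_trans _ _ 0) => //; rewrite invr_gt0.
Qed.

Lemma harmonic_num_le_ln n : (0 < n)%N -> harmonic_num n <= 1 + ln (n%:R) :> R.
Proof.
case: n => // n _; elim: n => [|n IH].
  by rewrite /harmonic_num big_ord1 invr1 ln1 addr0.
rewrite harmonic_numS; apply: le_trans (lerD IH (lexx _)) _.
rewrite -addrA lerD2l.
have x0 : 0 < n.+2%:R :> R by [].
have : ln (1 + (- n.+2%:R^-1)) <= - n.+2%:R^-1 :> R.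
  by apply: le_ln1Dx; rewrite ltrNl opprK invf_lt1 // ltr1n.
have -> : 1 + (- n.+2%:R^-1) = n.+1%:R / n.+2%:R :> R.
  by rewrite -[n.+1%:R](addrK 1) natr1 mulrBl divff ?gt_eqF // mul1r.
rewrite lnM ?posrE ?invr_gt0 // lnV ?posrE //.
by move: (ln _) (ln _) (_^-1) => a b c; lra.
Qed.

End HarmonicNumbers.

Section HittingSums.
Context {R : realType} {V : finType} {K : V -> V -> R} (Kt : transient K).
Context (V0 : (0 < #|V|)%N).
Implicit Types (x y z : V) (phi mu : V -> R).

Let N : R := #|V|%:R.
Let N_gt0 : 0 < N. Proof. by rewrite ltr0n. Qed.

(* Probability that the walk from [x] ever visits [y]. *)
Definition hit y x : R := exit Kt (~: [set y])%SET y x.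

Lemma hit_ge0 y x : 0 <= hit y x. Proof. exact: exit_ge0. Qed.

Lemma hit_self y : hit y y = 1.
Proof. by rewrite /hit exit_out ?inE ?eqxx. Qed.

Lemma hit_step y x : x != y -> hit y x = \sum_z K x z * hit y z.
Proof. by move=> xy; rewrite /hit exit_in // !inE. Qed.

(* Probability that the walk from [y] does not return to [y]. *)
Definition escape y : R := 1 - \sum_z K y z * hit y z.

Lemma escape_le1 y : escape y <= 1.
Proof.
case: Kt => K0 _ _; rewrite /escape gerBl sumr_ge0 // => z _.
by rewrite mulr_ge0 // hit_ge0.
Qed.

Lemma hit_le1 y x : hit y x <= 1.
Proof.
apply: le_trans (exit_sum_le1 Kt (~: [set y])%SET x).
by rewrite [leRHS](bigD1 y) //= lerDl sumr_ge0 // => z _; rewrite exit_ge0.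
Qed.

Lemma escape_ge0 y : 0 <= escape y.
Proof.
case: Kt => K0 K1 _; rewrite subr_ge0; apply: le_trans (K1 y).
by apply: ler_sum => z _; rewrite ler_piMr // hit_le1.
Qed.

(* Off [y] the function [hit y] is harmonic, so by reversibility testing it
   against [phi - K phi] only leaves a contribution of the site [y]. *)
Lemma hit_duality mu phi y : (forall x z, mu x * K x z = mu z * K z x) ->
  \sum_x mu x * hit y x * (phi x - \sum_z K x z * phi z) = mu y * phi y * escape y.
Proof.
move=> sym; under eq_bigr do rewrite mulrBr.
rewrite sumrB; under [X in _ - X]eq_bigr do rewrite mulr_sumr.
rewrite exchange_big /= -sumrB.
have e z : mu z * hit y z * phi z - \sum_x mu x * hit y x * (K x z * phi z) =
    mu z * phi z * (hit y z - \sum_x K z x * hit y x).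
  rewrite mulrBr mulrAC mulr_sumr; congr (_ - _); apply: eq_bigr => x _.
  have -> : mu x * hit y x * (K x z * phi z) = mu x * K x z * hit y x * phi z by ring.
  by rewrite sym; ring.
under eq_bigr do rewrite e.
rewrite (bigD1 y) //= hit_self [X in _ + X]big1 ?addr0 // => z zy.
by rewrite -hit_step // subrr mulr0.
Qed.

Lemma grow_at_uniform y :
  grow_at Kt (@uniform_law R V) (~: [set y])%SET y = (\sum_x hit y x) / N.
Proof. by rewrite /grow_at mulr_suml; apply: eq_bigr => x _; rewrite mulrC. Qed.

Local Notation f := (fill_time Kt uniform_gt0 (uniform_sum V0)).
Local Notation nu_gt0 := (@uniform_gt0 R V).
Local Notation nu_sum := (uniform_sum V0).

(** A vacant site is filled at least by the particles that start there, whence [r = N] and the upper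
    bound; a site of [D] is visited with probability at most [c / N], whence the lower one. *)
Lemma fill_coupon (D : {set V}) (c : R) : 0 < c ->
  (forall y, y \in D -> \sum_x hit y x <= c) ->
  exists m, [/\ fill_data K m N, N / c * harmonic_num #|D| <= m
              & m <= N * harmonic_num #|V|].
Proof.
move=> c0 hD.
have q1 (A : {set V}) z : z \notin A -> 1 <= N * grow_at Kt (@uniform_law R V) A z.
  move=> zA; apply: (@le_trans _ _ (N * uniform_law R z)).
    by rewrite /uniform_law divff // gt_eqF.
  rewrite ler_wpM2l ?(ltW N_gt0) //; exact: (grow_at_ge Kt nu_gt0 zA).
exists (f finset.set0); split.
- by exists Kt, nu_sum; split => // y; apply: q1; rewrite !inE eqxx.
- rewrite -[in #|D|](finset.setD0 D).
  apply: fill_time_ge_harmonic => A z zD.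
  rewrite mulrAC ler_pdivrMr // mul1r; apply: le_trans (hD z zD).
  rewrite -ler_pdivlMl // mulrC -grow_at_uniform.
  exact: (grow_at_le Kt nu_gt0 A z).
- have := @fill_time_le_harmonic _ _ _ Kt _ nu_gt0 nu_sum N q1 finset.set0.
  by rewrite finset.setC0 cardsT.
Qed.

Lemma fill_sharp (r : R) : (forall y, N <= r * \sum_x hit y x) ->
  exists m, [/\ fill_data K m r, N <= m
    & forall eps, 0 < eps -> m <=
        (1 + eps) * N + 1 + r * N * expR (- (eps ^+ 2 / (4 + 2 * eps) * N / r))].
Proof.
move=> hr.
have qr y : 1 <= r * grow_at Kt (@uniform_law R V) (~: [set y])%SET y.
  by rewrite grow_at_uniform mulrA ler_pdivlMr // mul1r.
exists (f finset.set0); split.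
- by exists Kt, nu_sum.
- have := fill_time_ge_card Kt nu_gt0 nu_sum finset.set0.
  by rewrite finset.setC0 cardsT.
(* With [th = eps / 2] and [t] about [(1 + eps) * N], the exponent [th * N - t * th / (1 + th)] is
   at most [- N * eps ^ 2 / (4 + 2 * eps)]. *)
move=> eps e0; pose t := (Num.truncn ((1 + eps) * N)).+1.
have t1 : (1 + eps) * N < t%:R by apply: truncnS_gt.
have t2 : t%:R <= (1 + eps) * N + 1.
  by rewrite -natr1 lerD2r truncn_le mulr_ge0 ?(ltW N_gt0) // addr_ge0 // ltW.
have d0 : 0 <= eps ^+ 2 / (4 + 2 * eps) * N.
  by rewrite mulr_ge0 ?(ltW N_gt0) // divr_ge0 ?sqr_ge0 //; lra.
apply: le_trans (fill_time_upper nu_gt0 nu_sum qr (fun=> erefl) (t := t) (th := eps / 2) _ d0 _) _.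
- by rewrite divr_ge0 // ltW.
- have q0 : 0 <= eps / 2 / (1 + eps / 2) by rewrite !divr_ge0 //; lra.
  apply: (@le_trans _ _ (eps / 2 * N - (1 + eps) * N * (eps / 2 / (1 + eps / 2)))).
    by rewrite lerD2l lerN2 ler_wpM2r // ltW.
  rewrite le_eqVlt; apply/orP; left; apply/eqP; field.
  by rewrite !gt_eqF //; lra.
- by rewrite lerD2r.
Qed.

End HittingSums.

Section RestrictedWalk.
Context {R : realType} {G : choiceType} (e : rel G).

Let nbrs (A : {fset G}) (Z : {set A}) x : seq G :=
  [seq val y | y <- enum [set y in Z | e x (val y)]%SET].

Let nbrs_size (A : {fset G}) (Z : {set A}) x :
  size (nbrs Z x) = #|[set y in Z | e x (val y)]%SET|.
Proof. by rewrite size_map -cardE. Qed.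

Let nbrs_uniq (A : {fset G}) (Z : {set A}) x : uniq (nbrs Z x).
Proof. by rewrite map_inj_uniq ?enum_uniq //; apply: val_inj. Qed.

Let mem_nbr x z : finite_set (neighbors e x) -> (z \in fset_set (neighbors e x)) = e x z.
Proof. by move=> fx; rewrite in_fset_set //; apply/idP/idP; rewrite inE. Qed.

Lemma card_neighbors_le (A : {fset G}) (Z : {set A}) x : finite_set (neighbors e x) ->
  (#|[set y in Z | e x (val y)]%SET| <= degree e x)%N.
Proof.
move=> fx; rewrite -nbrs_size; apply: uniq_leq_size => // z /mapP[y].
by rewrite mem_enum inE => /andP[_ xy] ->; rewrite mem_nbr.
Qed.

Lemma card_neighbors_lt (A : {fset G}) (Z : {set A}) x z : finite_set (neighbors e x) ->
  e x z -> (forall y, y \in Z -> val y != z) ->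
  (#|[set y in Z | e x (val y)]%SET| < degree e x)%N.
Proof.
move=> fx xz zZ; rewrite -nbrs_size; apply: (@uniq_leq_size _ (z :: nbrs Z x)).
  rewrite /= nbrs_uniq andbT; apply/mapP => -[y]; rewrite mem_enum inE => /andP[yZ _] zy.
  by move: (zZ y yZ); rewrite -zy eqxx.
move=> u; rewrite inE => /orP[/eqP->|/mapP[y]]; first by rewrite mem_nbr.
by rewrite mem_enum inE => /andP[_ xy] ->; rewrite mem_nbr.
Qed.

Lemma srw_ge0 x y : 0 <= srw e x y :> R.
Proof. by rewrite /srw; case: ifP => // _; rewrite invr_ge0. Qed.

Lemma srw_sum (A : {fset G}) (Z : {set A}) x :
  \sum_(y in Z) srw e x (val y) = #|[set y in Z | e x (val y)]%SET|%:R / (degree e x)%:R :> R.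
Proof.
rewrite -sum1_card natr_sum mulr_suml big_mkcond [RHS]big_mkcond /=.
apply: eq_bigr => y _; rewrite !inE /srw.
by case: (y \in Z); case: (e x (val y)); rewrite ?mul1r.
Qed.

Lemma srw_on_transient (A : {fset G}) : (forall x, finite_set (neighbors e x)) ->
  (forall Z : {set A}, Z != finset.set0 ->
     exists2 x, x \in Z & exists2 z, e (val x) z & forall y, y \in Z -> val y != z) ->
  transient (@srw_on R G e A).
Proof.
move=> fx hZ; split=> [x y|x|Z Z0]; first exact: srw_ge0.
- rewrite (eq_bigl (fun y => y \in [set: A]%SET)); last by move=> y; rewrite finset.in_setT.
  rewrite srw_sum; have [->|d0] := eqVneq (degree e (val x)) 0%N.
    by rewrite invr0 mulr0.
  by rewrite ler_pdivrMr ?ltr0n ?lt0n // mul1r ler_nat card_neighbors_le.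
- have [x xZ [z xz zZ]] := hZ Z Z0; exists x => //.
  rewrite srw_sum; have lt := card_neighbors_lt (fx _) xz zZ.
  by rewrite ltr_pdivrMr ?ltr0n ?(leq_trans _ lt) // mul1r ltr_nat.
Qed.


End RestrictedWalk.

(** * Graphs with a sink *)

Section SinkGraph.
Context {R : realType} {G : finType} (e : rel G).

Lemma degree_finE x : degree e x = #|[set y | e x y]%SET|.
Proof.
rewrite /degree -(card_uniqP (fset_uniq _)); apply: eq_card => z.
rewrite in_fset_set; last exact: finite_finset.
by apply/idP/idP; rewrite !inE.
Qed.

Lemma card_fset_fin (A : {fset G}) o n : #|G| = n.+1 ->
  (forall x, (x \in A) = (x != o)) -> #|{: A}| = n.
Proof.
move=> Gn Ao; rewrite -cardfE -(card_uniqP (fset_uniq A)).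
transitivity #|predC1 o|; last by rewrite cardC1 Gn.
by apply: eq_card => x; rewrite Ao.
Qed.

End SinkGraph.

Lemma srw_degree {R : realType} {G : choiceType} (e : rel G) x y : finite_set (neighbors e x) ->
  (degree e x)%:R * srw e x y = (e x y)%:R :> R.
Proof.
move=> fx; rewrite /srw; case: ifP => xy; last by rewrite mulr0.
rewrite divff // pnatr_eq0 -lt0n cardfs_gt0; apply/fset0Pn; exists y.
by rewrite in_fset_set // inE.
Qed.

Lemma degree_gt0 {G : choiceType} (e : rel G) x y : finite_set (neighbors e x) -> e x y ->
  (0 < degree e x)%N.
Proof.
move=> fx xy; rewrite /degree cardfs_gt0; apply/fset0Pn; exists y.
by rewrite in_fset_set // inE.
Qed.

Section SinkEstimate.
Context {R : realType} {G : finType} (e : rel G) (o : G) (A : {fset G}) (n d : nat).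

(** Each step is killed with probability at least [1 / d]. By [hit_duality], with the degree as
    reversing measure and a constant test function, all hitting sums are bounded, so that every site
    is a coupon. *)
Lemma sink_fill : (0 < n)%N -> simple_graph e -> #|G| = n.+1 -> degree e o = n ->
  (forall x, x != o -> (degree e x <= d)%N) -> (forall x, (x \in A) = (x != o)) ->
  exists m : R, [/\ fill_data (@srw_on R G e A) m n%:R,
    n%:R / d%:R ^+ 2 * ln n%:R <= m & m <= n%:R * (1 + ln n%:R)].
Proof.
move=> n0 [es ei] Gn od dd Ao.
have fin x : finite_set (neighbors e x) by apply: finite_finset.
(* The sink has [n] neighbours among the [n] other vertices. *)
have oA (x : A) : e (val x) o.
  rewrite es; have xo : val x != o by rewrite -Ao fsvalP.
  have sub : [set y | e o y]%SET \subset (~: [set o])%SET.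
    by apply/fintype.subsetP => y; rewrite !inE; apply: contraTneq => ->; rewrite ei.
  have : [set y | e o y]%SET == (~: [set o])%SET.
    by rewrite eqEcard sub /= cardsC1 Gn -degree_finE od.
  by move=> /eqP/setP/(_ (val x)); rewrite !inE xo.
have AN : #|{: A}| = n by apply: card_fset_fin Gn Ao.
have A0 : (0 < #|{: A}|)%N by rewrite AN.
have Kt : transient (@srw_on R G e A).
  apply: srw_on_transient => // Z /set0Pn[x xZ]; exists x => //; exists o => //.
  by move=> y _; rewrite -Ao fsvalP.
have deg1 (x : A) : (0 < degree e (val x))%N by apply: degree_gt0 (oA x).
have degd (x : A) : (degree e (val x) <= d)%N by apply: dd; rewrite -Ao fsvalP.
have d0 : 0 < d%:R :> R.
  by have /card_gt0P[x _] := A0; rewrite ltr0n (leq_trans (deg1 x)).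
have hitc (y : A) : \sum_x hit Kt y x <= d%:R ^+ 2.
  apply: (@le_trans _ _ (\sum_(x : A) (degree e (val x))%:R * hit Kt y x *
      (d%:R - \sum_(z : A) srw_on e x z * d%:R))).
    apply: ler_sum => x _; rewrite mulrAC -[leLHS]mul1r ler_wpM2r ?hit_ge0 //.
    rewrite -mulr_suml -{1}[d%:R]mul1r -mulrBl mulrA mulrBr mulr1.
    rewrite mulr_sumr; under eq_bigr do rewrite srw_degree //.
    have -> : \sum_(z : A) (e (val x) (val z))%:R = #|[set y in [set: A]%SET | e (val x) (val y)]%SET|%:R :> R.
      rewrite -sum1_card natr_sum [RHS]big_mkcond; apply: eq_bigr => z _.
      by rewrite !inE; case: (e _ _).
    have lt : (#|[set y in [set: A] | e (val x) (val y)]%SET| < degree e (val x))%N.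
      by apply: (card_neighbors_lt _ (oA x)) => // z _; rewrite -Ao fsvalP.
    rewrite -natrB ?(ltnW lt) // mulr_natl -[leLHS]mulr1n.
    by rewrite -mulr_natr -natrM ler1n muln_gt0 -(ltr0n R) d0 subn_gt0.
  rewrite (hit_duality Kt (fun=> d%:R)); last first.
    by move=> x z; rewrite !srw_degree // es.
  rewrite -[leRHS]mulr1 ler_pM ?mulr_ge0 ?escape_ge0 ?escape_le1 //.
  by rewrite expr2 ler_wpM2r // ler_nat.
have [m [fd lo up]] := fill_coupon A0 (exprn_gt0 2 d0) (fun y (_ : y \in [set: A]%SET) => hitc y).
exists m; rewrite AN in fd lo up; split => //.
  apply: le_trans lo; rewrite ler_wpM2l ?divr_ge0 ?exprn_ge0 //.
  rewrite cardsT AN; apply: le_trans (harmonic_num_ge_ln _).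
  by rewrite ler_ln ?posrE ?ltr0n // ler_nat.
by apply: le_trans up _; rewrite ler_wpM2l // harmonic_num_le_ln.
Qed.

End SinkEstimate.

(** * Non-amenable graphs *)

Section Cheeger.
Context {R : realType} {A : finType} (adj : rel A) (b : A -> R) (D : R) (h : R).
Hypotheses (adj_sym : symmetric adj) (b_ge0 : forall x, 0 <= b x) (h_gt0 : 0 < h).
Hypothesis deg_le : forall x, \sum_y (adj x y)%:R + b x <= D.
Hypothesis isoperimetry : forall S : {set A},
  h * #|S|%:R <= \sum_(x in S) (\sum_(y in ~: S) (adj x y)%:R + b x).

Let a x y : R := (adj x y)%:R.

(* Peeling off the lowest layer of the support reduces to sets. *)
Lemma coarea (F : A -> R) : (forall x, 0 <= F x) ->
  h * \sum_x F x <= \sum_x \sum_y a x y * Num.max 0 (F x - F y) + \sum_x b x * F x.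
Proof.
have [n] := ubnP #|[set x | 0 < F x]%SET|; elim: n F => // n IH F Fn F0.
pose S := [set x | 0 < F x]%SET; rewrite -/S in Fn.
have FS x : x \notin S -> F x = 0.
  by rewrite inE -leNgt => h0; apply/eqP; rewrite eq_le h0 F0.
have [S0|[x0 x0S]] := set_0Vmem S.
  rewrite big1 => [|x _]; last by rewrite FS // S0 inE.
  rewrite mulr0 addr_ge0 //; apply: sumr_ge0 => x _; last by rewrite mulr_ge0.
  by apply: sumr_ge0 => y _; rewrite mulr_ge0 // le_max lexx.
pose i := [arg min_(i < x0 in S) F i]%O.
have [iS imin] : i \in S /\ forall j, j \in S -> F i <= F j.
  by rewrite /i; case: arg_minP.
pose m := F i; have m0 : 0 < m by move: iS; rewrite inE.
pose F' x := if x \in S then F x - m else 0.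
have F'0 x : 0 <= F' x by rewrite /F'; case: ifP => // xS; rewrite subr_ge0 imin.
have F'n : (#|[set x | (0 < F' x)%R]%SET| < n)%N.
  move: Fn; rewrite ltnS; apply: leq_trans; apply: proper_card; apply/properP; split.
    apply/fintype.subsetP => x; rewrite !inE /F'; case: ifP; rewrite ?ltxx // inE //.
  by exists i => //; rewrite inE /F' iS subrr ltxx.
have := IH F' F'n F'0.
have eF x : F x = F' x + (if x \in S then m else 0).
  by rewrite /F'; case: ifP => [_|/negbT/FS ->]; rewrite ?subrK ?addr0.
have -> : \sum_x F x = \sum_x F' x + m * #|S|%:R.
  rewrite (eq_bigr _ (fun x _ => eF x)) big_split /=; congr (_ + _).
  by rewrite -big_mkcond /= sumr_const mulr_natr.
have -> : \sum_x b x * F x = \sum_x b x * F' x + m * \sum_(x in S) b x.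
  under eq_bigr do rewrite eF mulrDr; rewrite big_split /= mulr_sumr.
  by congr (_ + _); rewrite [in RHS]big_mkcond /=; apply: eq_bigr => x _; case: ifP => _; rewrite ?mulr0 // mulrC.
have : \sum_x \sum_y a x y * Num.max 0 (F' x - F' y) +
    m * \sum_(x in S) \sum_(y in ~: S) a x y <=
    \sum_x \sum_y a x y * Num.max 0 (F x - F y).
  rewrite mulr_sumr [X in _ + X]big_mkcond /= -big_split /=; apply: ler_sum => x _.
  case: ifP => xS; last first.
    rewrite addr0; apply: ler_sum => y _; rewrite ler_wpM2l // {1}/F' xS sub0r.
    by rewrite (max_idPl _) ?oppr_le0 // le_max lexx.
  rewrite mulr_sumr [X in _ + X]big_mkcond /= -big_split /=; apply: ler_sum => y _.
  rewrite finset.in_setC {1 2}/F' xS; case: ifP => yS /=.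
    by rewrite addr0 (_ : F x - m - (F y - m) = F x - F y) //; ring.
  rewrite subr0 (FS y) ?yS // subr0 (mulrC m) -mulrDr ler_wpM2l //.
  rewrite (max_idPr _) ?subr_ge0 ?imin // subrK le_max lexx orbT //.
have := isoperimetry S; rewrite big_split /= => iso.
have : m * (h * #|S|%:R) <= m * (\sum_(x in S) \sum_(y in ~: S) a x y + \sum_(x in S) b x).
  by rewrite ler_wpM2l // ltW.
rewrite mulrDr; lra.
Qed.

(* The energy of [phi] is at most [D] times its sum; applying [coarea] to
   [phi ^+ 2] bounds the sum of squares by the energy. *)
Lemma poisson_sum_le (phi : A -> R) : (forall x, 0 <= phi x) ->
  (forall x, \sum_y a x y * (phi x - phi y) + b x * phi x <= D) ->
  \sum_x phi x <= 2 / h * (4 * D ^+ 2 / h + D) * #|A|%:R.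
Proof.
move=> phi0 phiE.
have [A0|/card_gt0P[w _]] := posnP #|A|.
  rewrite A0 mulr0 big1 // => x _; by have := card0_eq A0 x.
have D0 : 0 <= D.
  apply: le_trans (deg_le w); rewrite addr_ge0 // sumr_ge0 //.
pose Q := \sum_x \sum_y a x y * (phi x - phi y) ^+ 2.
pose B := \sum_x b x * phi x ^+ 2.
pose S1 := \sum_x phi x; pose S2 := \sum_x phi x ^+ 2.
have sym (f : A -> A -> R) : \sum_x \sum_y a x y * f x y = \sum_x \sum_y a x y * f y x.
  rewrite exchange_big /=; apply: eq_bigr => x _; apply: eq_bigr => y _.
  by rewrite /a adj_sym.
have energy : Q / 2 + B <= D * S1.
  have -> : Q = 2 * \sum_x \sum_y a x y * (phi x * (phi x - phi y)).
    rewrite mulr_natl mulr2n {2}sym -big_split /=; apply: eq_bigr => x _.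
    by rewrite -big_split /=; apply: eq_bigr => y _; ring.
  rewrite mulrAC divff ?pnatr_eq0 // mul1r -big_split /= /S1 mulr_sumr.
  apply: ler_sum => x _; rewrite [leRHS]mulrC; apply: le_trans (ler_wpM2l (phi0 x) (phiE x)).
  rewrite mulrDr mulr_sumr le_eqVlt; apply/orP; left; apply/eqP; congr (_ + _); last by ring.
  by apply: eq_bigr => y _; rewrite mulrCA.
have B0 : 0 <= B by apply: sumr_ge0 => x _; rewrite mulr_ge0 ?sqr_ge0.
have Q0 : 0 <= Q.
  by apply: sumr_ge0 => x _; apply: sumr_ge0 => y _; rewrite mulr_ge0 ?sqr_ge0.
have S20 : 0 <= S2 by apply: sumr_ge0 => x _; rewrite sqr_ge0.
have S10 : 0 <= S1 by apply: sumr_ge0.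
have Dp : 0 < D.
  have := isoperimetry [set: A]%SET; rewrite cardsT => iso.
  rewrite lt_neqAle D0 andbT; apply/eqP => D00; move: iso.
  rewrite leNgt => /negP; apply.
  have V0 : 0 < #|A|%:R :> R by rewrite ltr0n; apply/card_gt0P; exists w.
  apply: (@le_lt_trans _ _ 0); last by rewrite mulr_gt0.
  apply: sumr_le0 => x _; rewrite [leRHS]D00; apply: le_trans (deg_le x).
  by rewrite finset.setCT big_set0 add0r lerDr sumr_ge0.
(* This weight makes the [S2] part of [co2] equal to half of the [h * S2] in [coarea], which absorbs
   it. *)
pose del := h / (2 * D).
have del0 : 0 < del by rewrite divr_gt0 // mulr_gt0.
have delD : del * D = h / 2 by rewrite /del; field; rewrite gt_eqF.
have Qdel : Q / del = 2 * D / h * Q by rewrite /del; field; rewrite !gt_eqF.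
clearbody del.
have amgm x y : 0 <= x -> 0 <= y ->
    Num.max 0 (x ^+ 2 - y ^+ 2) <= del * x ^+ 2 + (x - y) ^+ 2 / del :> R.
  move=> x0 y0; rewrite ge_max; apply/andP; split.
    by apply: addr_ge0; [apply: mulr_ge0|apply: divr_ge0]; rewrite ?sqr_ge0 ?(ltW del0).
  have sq : 2 * x * (x - y) <= del * x ^+ 2 + (x - y) ^+ 2 / del.
    have e : del * (del * x ^+ 2 + (x - y) ^+ 2 / del) = (del * x) ^+ 2 + (x - y) ^+ 2.
      by field; rewrite gt_eqF.
    rewrite -(ler_pM2l del0) e; have := sqr_ge0 (del * x - (x - y)); lra.
  apply: le_trans sq; have [xy|xy] := leP y x.
    have : 0 <= (x - y) * (x - y) by rewrite -expr2 sqr_ge0.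
    lra.
  have : 0 <= (y - x) * (y - x) by rewrite -expr2 sqr_ge0.
  have : 0 <= x * (y - x) by rewrite mulr_ge0 // subr_ge0 ltW.
  nra.
have := coarea (F := fun x => phi x ^+ 2) (fun x => sqr_ge0 (phi x)).
rewrite -/S2 -/B => co.
have co2 : \sum_x \sum_y a x y * Num.max 0 (phi x ^+ 2 - phi y ^+ 2) <= del * D * S2 + Q / del.
  rewrite /S2 /Q mulr_sumr mulr_suml -big_split /=; apply: ler_sum => x _.
  apply: (@le_trans _ _ (\sum_y a x y * (del * phi x ^+ 2 + (phi x - phi y) ^+ 2 / del))).
    by apply: ler_sum => y _; rewrite ler_wpM2l // amgm.
  have -> : \sum_y a x y * (del * phi x ^+ 2 + (phi x - phi y) ^+ 2 / del) =
      (\sum_y a x y) * (del * phi x ^+ 2) + (\sum_y a x y * (phi x - phi y) ^+ 2) / del.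
    rewrite !mulr_suml -big_split /=; apply: eq_bigr => y _.
    by rewrite (mulrDr (a x y)) -(mulrA (a x y) (_ ^+ 2)).
  rewrite lerD2r [del * D]mulrC -mulrA ler_wpM2r //.
    by apply: mulr_ge0; rewrite ?sqr_ge0 ?(ltW del0).
  by apply: le_trans (deg_le x); rewrite lerDl.
rewrite delD Qdel in co2.
have Q1 : 2 * D / h * Q <= 2 * D / h * (2 * D * S1).
  by rewrite ler_wpM2l ?divr_ge0 ?mulr_ge0 ?(ltW h_gt0) //; lra.
set C0 := 2 / h * (4 * D ^+ 2 / h + D).
have C00 : 0 < C0.
  by rewrite mulr_gt0 ?divr_gt0 // addr_gt0 // divr_gt0 // mulr_gt0 // exprn_gt0.
have S2le : S2 <= C0 * S1.
  have : h / 2 * S2 <= (4 * D ^+ 2 / h + D) * S1.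
    have -> : (4 * D ^+ 2 / h + D) * S1 = 2 * D / h * (2 * D * S1) + D * S1 by ring.
    lra.
  rewrite -ler_pdivlMl ?divr_gt0 // invf_div mulrA //.
clearbody C0.
(* From [2 * C0 * phi <= phi ^ 2 + C0 ^ 2] at each site; as [S2 <= C0 * S1], half of [S1] absorbs
   the quadratic part. *)
have : S1 <= S2 / (2 * C0) + C0 / 2 * #|A|%:R.
  have -> : C0 / 2 * #|A|%:R = \sum_(x : A) C0 / 2 by rewrite sumr_const mulr_natr.
  rewrite /S1 /S2 mulr_suml -big_split /=.
  apply: ler_sum => x _; rewrite -subr_ge0.
  have -> : phi x ^+ 2 / (2 * C0) + C0 / 2 - phi x = (phi x - C0) ^+ 2 / (2 * C0).
    by field; rewrite gt_eqF.
  by rewrite divr_ge0 ?sqr_ge0 // mulr_ge0 // ltW.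
have : S2 / (2 * C0) <= S1 / 2.
  rewrite ler_pdivrMr ?mulr_gt0 //; apply: le_trans S2le _.
  by rewrite le_eqVlt; apply/orP; left; apply/eqP; field.
rewrite -/S1; move: (#|A|%:R) => N; lra.
Qed.

End Cheeger.

Section NonAmenableEstimate.
Local Open Scope classical_set_scope.
Context {R : realType} {G : choiceType} (e : rel G) (D : nat).
Hypotheses (e_simple : simple_graph e)
  (e_deg : forall x, finite_set (neighbors e x) /\ (degree e x <= D)%N)
  (e_na : non_amenable (R := R) e).

Let h : R := inf [set r : R | exists2 B : {fset G}, B != fset0
  & r = #|` fset_set (outer_boundary e B)|%:R / #|` B|%:R].

Lemma boundary_ge (B : {fset G}) : B != fset0 ->
  h * #|` B|%:R <= #|` fset_set (outer_boundary e B)|%:R.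
Proof.
move=> B0; have B1 : 0 < #|` B|%:R :> R by rewrite ltr0n cardfs_gt0.
rewrite -ler_pdivlMr //; apply: ge_inf; last by exists B.
by exists 0 => _ [C _ ->]; rewrite divr_ge0.
Qed.

Let boundary_fin (B : {fset G}) : finite_set (outer_boundary e B).
Proof.
apply: (@sub_finite_set _ _ (\bigcup_(x in [set` B]) neighbors e x)).
  by move=> y [_ [x xB xy]]; exists x.
by apply: bigcup_finite => // x _; case: (e_deg x).
Qed.

Lemma boundary_neighbor (B : {fset G}) : B != fset0 ->
  exists2 x, x \in B & exists2 z, e x z & z \notin B.
Proof.
move=> B0; have := boundary_ge B0.
have [->|/fset0Pn[z]] := eqVneq (fset_set (outer_boundary e B)) fset0.
  rewrite cardfs0 leNgt => /negP[]; rewrite mulr_gt0 // ?ltr0n ?cardfs_gt0 //.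
by rewrite in_fset_set // inE => -[zB [x xB xz]]; exists x => //; exists z.
Qed.

Context (A : {fset G}).

Let adj : rel A := fun x y => e (val x) (val y).
Let b (x : A) : R := (degree e (val x))%:R - \sum_y (adj x y)%:R.

Let count_adj (S : {set A}) (x : A) : \sum_(y in S) (adj x y)%:R =
  #|[set y in S | e (val x) (val y)]%SET|%:R :> R.
Proof.
rewrite -sum1_card natr_sum big_mkcond [RHS]big_mkcond /=.
by apply: eq_bigr => y _; rewrite !inE /adj; case: (y \in S); case: (e _ _).
Qed.

Let b_ge0 x : 0 <= b x.
Proof.
rewrite subr_ge0 (eq_bigl (fun y => y \in [set: A]%SET)); last by move=> y; rewrite finset.in_setT.
by rewrite count_adj ler_nat card_neighbors_le //; case: (e_deg (val x)).
Qed.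

Let b_deg x : \sum_y (adj x y)%:R + b x = (degree e (val x))%:R :> R.
Proof. by rewrite addrC subrK. Qed.

Lemma edge_isoperimetry (S : {set A}) :
  h * #|S|%:R <= \sum_(x in S) (\sum_(y in ~: S) (adj x y)%:R + b x).
Proof.
have [->|S0] := eqVneq S finset.set0.
  by rewrite cards0 mulr0 big_set0.
pose B : {fset G} := seq_fset tt [seq val x | x <- enum S].
have BE z : (z \in B) = (z \in [seq val x | x <- enum S]) by rewrite seq_fsetE.
have uS : uniq [seq val x | x <- enum S].
  by rewrite map_inj_uniq ?enum_uniq //; apply: val_inj.
have BS : #|` B| = #|S|.
  by rewrite size_seq_fset undup_id // size_map -cardE.
have B0 : B != fset0.
  by rewrite -cardfs_gt0 BS lt0n cards_eq0.
rewrite -BS; apply: le_trans (boundary_ge B0) _.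
pose nb x := enum_fset (fset_set (neighbors e x)).
(* The edges leaving [B], each recorded by its outer endpoint; they cover the outer boundary. *)
pose fl := flatten [seq [seq z <- nb (val x) | z \notin B] | x <- enum S].
apply: (@le_trans _ _ (size fl)%:R).
  rewrite ler_nat; apply: uniq_leq_size; first exact: fset_uniq.
  move=> z; rewrite in_fset_set // inE => -[zB [x xB xz]].
  apply/flattenP; move: xB; rewrite BE => /mapP[y yS xy].
  exists [seq z <- nb (val y) | z \notin B]; first by apply/mapP; exists y.
  rewrite mem_filter zB /= -xy /nb in_fset_set ?inE //; by case: (e_deg x).
rewrite /fl size_flatten /shape -map_comp sumnE big_map big_enum /= natr_sum.
apply: ler_sum => x xS.
have -> : \sum_(y in ~: S) (adj x y)%:R + b x =
    (degree e (val x))%:R - \sum_(y in S) (adj x y)%:R.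
  rewrite /b [\sum_y _](bigID (mem S)) /=.
  have -> : \sum_(y in ~: S) (adj x y)%:R = \sum_(y | y \notin S) (adj x y)%:R :> R.
    by apply: eq_bigl => y; rewrite finset.in_setC.
  by lra.
rewrite count_adj -natrB ?card_neighbors_le //; last by case: (e_deg (val x)).
rewrite ler_nat leq_subRL ?card_neighbors_le //; last by case: (e_deg (val x)).
rewrite /degree -/(nb (val x)) -(count_predC (fun z => z \in B) (nb (val x))).
rewrite size_filter leq_add2r -size_filter cardE -(size_map val).
apply: uniq_leq_size; first by rewrite map_inj_uniq ?enum_uniq //; apply: val_inj.
move=> z /mapP[y]; rewrite mem_enum inE => /andP[yS xy] ->.
rewrite mem_filter BE map_f ?mem_enum //= /nb in_fset_set ?inE //; by case: (e_deg (val x)).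
Qed.

Lemma nonamenable_transient : transient (@srw_on R G e A).
Proof.
apply: srw_on_transient => [x|Z Z0]; first by case: (e_deg x).
pose B : {fset G} := seq_fset tt [seq val x | x <- enum Z].
have BE z : (z \in B) = (z \in [seq val x | x <- enum Z]) by rewrite seq_fsetE.
have [|x] := @boundary_neighbor B.
  have /set0Pn[x xZ] := Z0; apply/fset0Pn; exists (val x).
  by rewrite BE map_f // mem_enum.
rewrite BE => /mapP[y yZ ->] [z yz zB]; exists y; first by rewrite -mem_enum.
by exists z => // u uZ; apply: contraNneq zB => <-; rewrite BE map_f // mem_enum.
Qed.

Definition nonamenable_const : R := 2 / h * (4 * D%:R ^+ 2 / h + D%:R).

(** The test function in [hit_duality] is the mean lifetime. Only its average is bounded, through
    the Cheeger-type estimate [poisson_sum_le], so by Markov's inequality at least half of the sites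
    have bounded hitting sums and serve as coupons. *)
Lemma nonamenable_fill (n : nat) : (0 < n)%N -> #|` A| = n ->
  exists m : R, [/\ fill_data (@srw_on R G e A) m n%:R,
    n%:R / (4 * D%:R * nonamenable_const) * ln n%:R <= m & m <= n%:R * (1 + ln n%:R)].
Proof.
move=> n0 An; have AN : #|{: A}| = n by rewrite -cardfE.
have A0 : (0 < #|{: A}|)%N by rewrite AN.
have fin x : finite_set (neighbors e x) by case: (e_deg x).
have degD x : (degree e x <= D)%N by case: (e_deg x).
have Kt := nonamenable_transient.
have deg1 x : (0 < degree e x)%N.
  have [|_ /fset1P -> [z xz _]] := @boundary_neighbor [fset x]%fset.
    by apply/fset0Pn; exists x; rewrite fset11.
  exact: degree_gt0 xz.
have D0 : 0 < D%:R :> R.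
  by have /card_gt0P[x _] := A0; rewrite ltr0n (leq_trans (deg1 (val x))).
have h0 : 0 < h := e_na.
pose phi := lifetime Kt; pose C := nonamenable_const.
have C0 : 0 < C.
  by rewrite mulr_gt0 ?divr_gt0 // addr_gt0 // divr_gt0 // mulr_gt0 // exprn_gt0.
have phi0 x : 0 <= phi x by apply: lifetime_ge0.
have sum_phi : \sum_x phi x <= C * #|{: A}|%:R.
  apply: (@poisson_sum_le _ _ adj b D%:R h) => //.
  - by move=> x y; rewrite /adj; case: e_simple => ->.
  - by move=> x; rewrite b_deg ler_nat.
  - exact: edge_isoperimetry.
  move=> x; apply: (@le_trans _ _ (degree e (val x))%:R); last by rewrite ler_nat.
  under eq_bigr do rewrite mulrBr.
  rewrite sumrB -mulr_suml addrAC -mulrDl b_deg {1}/phi lifetimeE -/phi mulrDr mulr1.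
  rewrite mulr_sumr; under [X in X + _ - _]eq_bigr do rewrite mulrA srw_degree //.
  by rewrite addrAC subrr add0r.
pose S := [set x | phi x <= 2 * C]%SET.
have S2 : (n <= 2 * #|S|)%N.
  rewrite -(ler_nat R) natrM -AN.
  have : 2 * C * #|~: S|%:R <= C * #|{: A}|%:R.
    apply: le_trans sum_phi.
    rewrite mulr_natr -sumr_const; apply: (@le_trans _ _ (\sum_(x in ~: S) phi x)).
      by apply: ler_sum => x; rewrite !inE -ltNge => /ltW.
    by rewrite [leRHS](bigID (mem (~: S))) /= lerDl sumr_ge0.
  rewrite -(cardsC S) natrD; nra.
have hitc (y : A) : y \in S -> \sum_x hit Kt y x <= 2 * D%:R * C.
  rewrite inE => yS; apply: (@le_trans _ _ (\sum_(x : A) (degree e (val x))%:R * hit Kt y x *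
      (phi x - \sum_(z : A) srw_on e x z * phi z))).
    apply: ler_sum => x _; rewrite {1}/phi lifetimeE -/phi addrAC subrr add0r mulr1.
    by rewrite ler_peMl ?hit_ge0 // ler1n.
  rewrite (hit_duality Kt); last first.
    by move=> x z; rewrite !srw_degree //; case: e_simple => ->.
  rewrite -[leRHS]mulr1 ler_pM ?mulr_ge0 ?escape_ge0 ?escape_le1 //.
  rewrite [leRHS](_ : _ = D%:R * (2 * C)); last by ring.
  by rewrite ler_pM ?ler_nat.
have c0 : 0 < 2 * D%:R * C by apply: mulr_gt0 => //; apply: mulr_gt0.
have [m [fd lo up]] := fill_coupon A0 c0 hitc.
exists m; rewrite AN in fd lo up; split => //.
  apply: le_trans lo; apply: (@le_trans _ _ (n%:R / (2 * D%:R * C) * (ln n%:R / 2))).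
    by rewrite le_eqVlt; apply/orP; left; apply/eqP; rewrite -/C; field; rewrite !gt_eqF.
  (* Since [n <= 2 * #|S|], also [n <= (#|S| + 1) ^ 2]: working with [S] costs a factor 2 in the
     logarithm. *)
  rewrite ler_wpM2l ?divr_ge0 // ?(ltW c0) // ler_pdivrMr //.
  apply: le_trans (ler_wpM2r _ (harmonic_num_ge_ln _)) => //.
  rewrite mulr_natr -lnXn // ler_ln ?posrE ?ltr0n ?exprn_gt0 //.
  rewrite -natrX ler_nat; apply: (leq_trans S2); rewrite -mulnn; nia.
by apply: le_trans up _; rewrite ler_wpM2l // harmonic_num_le_ln.
Qed.

End NonAmenableEstimate.

(** * Vertex-transitive graphs *)

Lemma exit_edge {G : choiceType} (e : rel G) (Z : pred G) x w : connected_graph e ->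
  Z x -> ~~ Z w -> exists2 u, Z u & exists2 v, e u v & ~~ Z v.
Proof.
move=> conn; have [p] := conn x w; elim: p x => [|y p IH] x /=.
  by move=> _ -> ->.
move=> /andP[xy yp] lw Zx Zw; have [Zy|Zy] := boolP (Z y); first exact: (IH y).
by exists x => //; exists y.
Qed.

Section TransitiveGraph.
Context {R : realType} {G : finType} (e : rel G) (o : G) (A : {fset G}) (n : nat).
Hypotheses (n_gt0 : (0 < n)%N) (e_simple : simple_graph e) (e_conn : connected_graph e)
  (e_trans : vertex_transitive e) (Gn : #|G| = n.+1) (Ao : forall x, (x \in A) = (x != o)).

Let P (x y : G) : R := srw e x y.

Let fin x : finite_set (neighbors e x). Proof. exact: finite_finset. Qed.

Let degree_cst x y : degree e x = degree e y.
Proof.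
have [f [fb fe <-]] := e_trans x y; rewrite !degree_finE.
have -> : [set z | e x z]%SET = f @^-1: [set z | e (f x) z]%SET.
  by apply/setP => z; rewrite !inE fe.
by apply: on_card_preimset; apply: onW_bij.
Qed.

Let degree_pos x : (0 < degree e x)%N.
Proof.
have [w wx] : exists w, w != x.
  have : (0 < #|predC1 x|)%N by rewrite cardC1 Gn.
  by move=> /card_gt0P[w]; exists w.
have [||u /eqP -> [v xv _]] := @exit_edge _ e (pred1 x) x w e_conn; rewrite /= ?eqxx //.
exact: degree_gt0 xv.
Qed.

Let P_sym x y : P x y = P y x.
Proof.
have d0 u : (degree e u)%:R != 0 :> R by rewrite pnatr_eq0 -lt0n.
have [es _] := e_simple.
by apply: (mulfI (d0 x)); rewrite {2}(degree_cst x y) !srw_degree // es.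
Qed.

Let P_sum x : \sum_y P x y = 1.
Proof.
have d0 : (degree e x)%:R != 0 :> R by rewrite pnatr_eq0 -lt0n.
apply: (mulfI d0); rewrite mulr1 mulr_sumr; under eq_bigr do rewrite srw_degree //.
rewrite degree_finE -sum1_card natr_sum [RHS]big_mkcond; apply: eq_bigr => y _.
by rewrite inE; case: (e x y).
Qed.

Let killed z (x y : G) : R := if x == z then 0 else P x y.

Let killed_transient z : transient (killed z).
Proof.
split=> [x y|x|Z Z0].
- by rewrite /killed; case: ifP => // _; apply: srw_ge0.
- by rewrite /killed; case: eqP => _; [rewrite big1|rewrite P_sum].
have [zZ|zZ] := boolP (z \in Z).
  by exists z => //; rewrite big1 // => y _; rewrite /killed eqxx.
have /set0Pn[x xZ] := Z0.
have [u uZ [v uv vZ]] := @exit_edge _ e (mem Z) x z e_conn xZ zZ.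
exists u => //; rewrite -(P_sum u) [ltRHS](bigID (mem Z)) /=.
have uz : u != z by apply: contraNneq zZ => <-.
rewrite (eq_bigr (P u)) => [|y _]; last by rewrite /killed (negPf uz).
rewrite ltrDl (bigD1 v) //= ltr_pwDl //; last by apply: sumr_ge0 => y _; apply: srw_ge0.
by rewrite /P /srw uv invr_gt0 ltr0n.
Qed.

Lemma hitting_time_ex z : exists H : G -> R,
  forall x, H x = \sum_y killed z x y * H y + (x != z)%:R.
Proof.
have [H HE] := dirichlet_ex [set: G]%SET (fun x => (x != z)%:R) (killed_transient z).
by exists H => x; rewrite {1}HE inE.
Qed.

(* Mean hitting times of [z]. *)
Let H z : G -> R := projT1 (cid (hitting_time_ex z)).

Let HE z x : H z x = \sum_y killed z x y * H z y + (x != z)%:R.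
Proof. by rewrite /H; case: cid => h /= ->. Qed.

Let H_self z : H z z = 0.
Proof. by rewrite HE eqxx addr0 big1 // => y _; rewrite /killed eqxx mul0r. Qed.

Let H_step z x : x != z -> H z x = \sum_y P x y * H z y + 1.
Proof.
by move=> xz; rewrite HE xz; congr (_ + _); apply: eq_bigr => y _; rewrite /killed (negPf xz).
Qed.

Let H_sum z z' : \sum_x H z x = \sum_x H z' x.
Proof.
have [f [fb fe <-]] := e_trans z z'; have fi := bij_inj fb.
rewrite [RHS](reindex f) /=; last exact: onW_bij.
apply: eq_bigr => x _; symmetry; move: x.
apply: (@dirichlet_unique _ _ (killed z) [set: G]%SET (fun x => (x != z)%:R)
  (fun x => H (f z) (f x)) (H z) (killed_transient z)).
- move=> x _; rewrite {1}HE (inj_eq fi); congr (_ + _).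
  rewrite (reindex f) /=; last exact: onW_bij.
  apply: eq_bigr => y _; rewrite /killed (inj_eq fi) /P /srw fe.
  by rewrite (degree_cst (f x) x).
- by move=> x _; rewrite {1}HE.
- by move=> x; rewrite inE.
Qed.

Let L (g : G -> R) x : R := g x - \sum_y P x y * g y.

Let L_sym f g : \sum_x f x * L g x = \sum_x g x * L f x.
Proof.
rewrite /L; under eq_bigr do rewrite mulrBr; under [RHS]eq_bigr do rewrite mulrBr.
rewrite !sumrB; congr (_ - _); first by apply: eq_bigr => x _; rewrite mulrC.
under eq_bigr do rewrite mulr_sumr; rewrite exchange_big /=.
apply: eq_bigr => x _; rewrite mulr_sumr; apply: eq_bigr => y _.
by rewrite P_sym; ring.
Qed.

Let L_sum g : \sum_x L g x = 0.
Proof.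
have := L_sym (fun=> 1) g; under eq_bigr do rewrite mul1r; move=> ->.
rewrite big1 // => x _; rewrite /L; under eq_bigr do rewrite mulr1.
by rewrite P_sum subrr mulr0.
Qed.

(** The value at [z] is forced by [L_sum]; this is Kac's formula, the mean return time being
    [n + 1]. *)
Let LH z x : L (H z) x = 1 - n.+1%:R * (x == z)%:R.
Proof.
have LH1 w : w != z -> L (H z) w = 1.
  by move=> wz; rewrite /L H_step // addrAC subrr add0r.
have [->|xz] := eqVneq x z; last by rewrite mulr0 subr0 LH1.
rewrite mulr1; have := L_sum (H z); rewrite (bigD1 z) //= (eq_bigr (fun=> 1)) => [|w /LH1 //].
rewrite sumr_const cardC1 Gn /= -natr1; lra.
Qed.

Let pairing (g : G -> R) z : \sum_x g x * L (H z) x = \sum_x g x - n.+1%:R * g z.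
Proof.
under eq_bigr do rewrite LH mulrBr mulr1.
rewrite sumrB; congr (_ - _); rewrite (bigD1 z) //= eqxx mulr1 mulrC big1 ?addr0 //.
by move=> x /negPf ->; rewrite !mulr0.
Qed.

(** Pair [H y] with [H z] through the symmetric [L]; transitivity equates their sums. *)
Let H_symm y z : H y z = H z y.
Proof.
have := L_sym (H y) (H z); rewrite !pairing (H_sum y z) => /addrI/oppr_inj.
by apply: mulfI; rewrite pnatr_eq0.
Qed.

(* Pairing a function that is harmonic off [y] and [o] with the hitting times
   of [y] and of [o] determines its mean, as these are symmetric. *)
Lemma harmonic_sum (g : G -> R) y : y != o -> g o = 0 -> g y = 1 ->
  (forall x, x != o -> x != y -> L g x = 0) -> \sum_x g x = n.+1%:R / 2.
Proof.
move=> yo go gy g0.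
have Lgsum F : \sum_x F x * L g x = F y * L g y + F o * L g o.
  rewrite (bigD1 o) //= (bigD1 y) //= addrCA addrA big1 ?addr0 // => x /andP[xo xy].
  by rewrite g0 // mulr0.
have := L_sum g; rewrite (eq_bigr (fun x => 1 * L g x)) => [|x _]; last by rewrite mul1r.
rewrite Lgsum !mul1r => e1.
have := pairing g o; rewrite L_sym Lgsum H_self go mul0r mulr0 subr0 addr0 => e2.
have := pairing g y; rewrite L_sym Lgsum H_self gy mul0r add0r mulr1 => e3.
rewrite (H_symm y o) in e3.
have e4 : L g o = - L g y by lra.
rewrite e4 mulrN e2 in e3; lra.
Qed.

Lemma transitive_transient : transient (@srw_on R G e A).
Proof.
apply: srw_on_transient => // Z /set0Pn[x xZ].
have [||u uZ [v uv vZ]] := @exit_edge _ e (fun u => [exists y in Z, val y == u]) (val x) o e_conn.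
- by apply/existsP; exists x; rewrite xZ eqxx.
- apply/existsPn => y; rewrite negb_and; apply/orP; right.
  by rewrite -Ao fsvalP.
have /existsP[a /andP[aZ /eqP au]] := uZ.
exists a => //; exists v; first by rewrite au.
by move=> y yZ; apply: contraNneq vZ => <-; apply/existsP; exists y; rewrite yZ eqxx.
Qed.

Lemma transitive_hit_sum (y : A) : \sum_x hit transitive_transient y x = n.+1%:R / 2 :> R.
Proof.
pose Kt := transitive_transient.
(* Extended by 0 at the removed vertex, the hitting probability is harmonic on the whole graph off
   [o] and [y]. *)
pose g x : R := if insub x is Some a then hit Kt y a else 0.
have gA (a : A) : g (val a) = hit Kt y a by rewrite /g valK.
have go : g o = 0 by rewrite /g insubF //= Ao eqxx.
have sumA (F : G -> R) : F o = 0 -> \sum_x F x = \sum_(a : A) F (val a).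
  move=> Fo; rewrite (bigD1 o) //= Fo add0r.
  rewrite (reindex_omap (val : A -> G) insub) => [|x xo]; last by rewrite insubT ?Ao.
  by apply: eq_bigl => a; rewrite valK eqxx -Ao fsvalP.
rewrite -(harmonic_sum (y := val y) (g := g)) //.
- by rewrite sumA //; apply: eq_bigr => a _; rewrite gA.
- by rewrite -Ao fsvalP.
- by rewrite gA hit_self.
move=> x xo xy; have xA : x \in A by rewrite Ao.
have ex : x = val [` xA]%fset by [].
rewrite /L {1}ex gA hit_step; last by apply: contraNneq xy => <-.
rewrite (sumA (fun z => P x z * g z)) ?go ?mulr0 //.
by apply/eqP; rewrite subr_eq0; apply/eqP; apply: eq_bigr => a _; rewrite gA.
Qed.

Lemma transitive_fill : exists m : R, [/\ fill_data (@srw_on R G e A) m 2, n%:R <= m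
  & forall eps, 0 < eps -> m <=
      (1 + eps) * n%:R + 1 + 2 * n%:R * expR (- (eps ^+ 2 / (4 + 2 * eps) * n%:R / 2))].
Proof.
have AN : #|{: A}| = n by apply: card_fset_fin Gn Ao.
have A0 : (0 < #|{: A}|)%N by rewrite AN.
have := @fill_sharp _ _ _ transitive_transient A0 2; rewrite AN; apply => y.
rewrite transitive_hit_sum mulrCA divff ?pnatr_eq0 // mulr1 ler_nat //.
Qed.

End TransitiveGraph.

(** * Lattice balls *)

Section HitLower.
Context {R : realType} {V : finType} {K : V -> V -> R} (Kt : transient K).

(** Two uses of [hit_duality] with counting measure: the superharmonic [u] bounds the escape
    probability of [y] from below, and the subsolution [phi] of the lifetime equation bounds the
    hitting sum by [phi y] times that probability. *)
Lemma hit_sum_ge (u phi : V -> R) (c : R) y : (forall x z, K x z = K z x) ->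
  (forall x, \sum_z K x z * u z <= u x) -> c <= u y - \sum_z K y z * u z -> 0 <= u y ->
  (forall x, phi x <= 1 + \sum_z K x z * phi z) -> 0 <= phi y ->
  c * phi y <= u y * \sum_x hit Kt y x.
Proof.
move=> sym usup uy u0 phisub phi0.
have e f := hit_duality Kt (mu := fun=> 1) f y (fun x z => congr1 _ (sym x z)).
have a1 : c <= u y * escape Kt y.
  have := e u; rewrite mul1r => <-; apply: le_trans uy _.
  rewrite [leRHS](bigD1 y) //= hit_self !mul1r lerDl sumr_ge0 // => x _.
  by rewrite mul1r mulr_ge0 ?hit_ge0 // subr_ge0.
have a2 : phi y * escape Kt y <= \sum_x hit Kt y x.
  have := e phi; rewrite mul1r => <-; apply: ler_sum => x _.
  by rewrite mul1r ler_piMr ?hit_ge0 // lerBlDr.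
apply: (le_trans (ler_wpM2r phi0 a1)); rewrite -mulrA.
by rewrite ler_wpM2l // mulrC.
Qed.

End HitLower.

Section Lattice.
Context {R : realType} {d : nat}.
Implicit Types (x y z : 'rV[int]_d) (p : 'I_d * bool).

Definition unit_step (s : bool) : int := if s then 1 else -1.

Definition nbr x p : 'rV[int]_d := \row_j (x 0 j + if j == p.1 then unit_step p.2 else 0).

Lemma nbr_inj x : injective (nbr x).
Proof.
move=> [i s] [j t] /rowP e; have := e i; have := e j; rewrite !mxE !eqxx /=.
case: eqP => [->|ji]; first by case: s t {e} => [] [] //= /addrI.
by move=> /addrI; case: t {e}.
Qed.

Lemma lattice_edgeP x y : reflect (exists p, y = nbr x p) (lattice_edge x y).
Proof.
apply: (iffP eqP) => [e|[[i s] ->]]; last first.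
  rewrite (bigD1 i) //= mxE eqxx opprD addrA subrr add0r normrN big1 ?addr0 => [|j ji].
    by case: s.
  by rewrite mxE (negPf ji) addr0 subrr normr0.
have [i xyi] : exists i, x 0 i != y 0 i.
  apply/existsP; rewrite -negb_forall; apply/forallP => xy.
  by move: e; rewrite big1 // => i _; have /eqP -> := xy i; rewrite subrr normr0.
move: e; rewrite (bigD1 i) //=.
have ni : 1 <= `|x 0 i - y 0 i| by rewrite -gtz0_ge1 normr_gt0 subr_eq0.
have n0 : 0 <= \sum_(j | j != i) `|x 0 j - y 0 j| by apply: sumr_ge0.
move=> e; have [xi s0] : `|x 0 i - y 0 i| = 1 /\ \sum_(j | j != i) `|x 0 j - y 0 j| = 0.
  by move: ni n0 e; set u := `|_|; set v := \sum_(j | j != i) _; move: u v => u v; lia.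
move/eqP: s0; rewrite psumr_eq0 // => /allP z0.
exists (i, y 0 i - x 0 i == 1); apply/rowP => j; rewrite mxE.
have [->|ji] := eqVneq j i; first by rewrite /unit_step /=; case: eqP; lia.
have := z0 j (mem_index_enum j); rewrite ji /= normr_eq0 subr_eq0 => /eqP ->.
by rewrite addr0.
Qed.

Local Open Scope classical_set_scope.

Lemma lattice_finite x : finite_set (neighbors (@lattice_edge d) x).
Proof.
rewrite (_ : neighbors _ _ = range (nbr x)); first exact: finite_image.
apply/seteqP; split=> y; first by move=> /lattice_edgeP[p ->]; exists p.
by move=> [p _ <-]; apply/lattice_edgeP; exists p.
Qed.

Lemma lattice_degree x : degree (@lattice_edge d) x = (d * 2)%N.
Proof.
have <- : size [seq nbr x p | p <- enum {: 'I_d * bool}] = (d * 2)%N.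
  by rewrite size_map -cardE card_prod card_ord card_bool.
apply: perm_size; apply: uniq_perm; rewrite ?fset_uniq //.
  by rewrite map_inj_uniq ?enum_uniq //; apply: nbr_inj.
move=> z; rewrite in_fset_set; last exact: lattice_finite.
apply/idP/mapP; rewrite inE; first by move=> /lattice_edgeP[p ->]; exists p; rewrite ?mem_enum.
by move=> [p _ ->]; apply/lattice_edgeP; exists p.
Qed.

Definition lattice_mean (F : 'rV[int]_d -> R) x : R := (\sum_p F (nbr x p)) / (d * 2)%:R.

Lemma lattice_srw_sum (A : {fset 'rV[int]_d}) (F : 'rV[int]_d -> R) x :
  \sum_(z : A) srw (@lattice_edge d) x (val z) * F (val z) =
  lattice_mean (fun z => if z \in A then F z else 0) x.
Proof.
have edgeE z : (lattice_edge x z)%:R = \sum_p (nbr x p == z)%:R :> R.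
  case: lattice_edgeP => [[p ->]|nz].
    rewrite (bigD1 p) //= eqxx big1 ?addr0 // => q qp.
    by rewrite (inj_eq (@nbr_inj x)) (negPf qp).
  by rewrite big1 // => p _; case: eqP => // zp; case: nz; exists p.
transitivity ((\sum_(z : A) \sum_p (nbr x p == val z)%:R * F (val z)) / (d * 2)%:R).
  rewrite mulr_suml; apply: eq_bigr => z _; rewrite -mulr_suml -edgeE /srw lattice_degree.
  by case: ifP; rewrite ?mul1r ?mul0r // mulrC.
rewrite /lattice_mean; congr (_ / _); rewrite exchange_big /=; apply: eq_bigr => p _.
case: ifP => pA.
  rewrite (bigD1 [` pA]%fset) //= eqxx mul1r big1 ?addr0 // => z zp.
  by case: eqP => [e|_]; [move: zp; rewrite -val_eqE /= -e eqxx|rewrite mul0r].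
rewrite big1 // => z _; case: eqP => [e|_]; last by rewrite mul0r.
by move: pA; rewrite e fsvalP.
Qed.

Lemma ler_lattice_mean F F' x : (forall p, F (nbr x p) <= F' (nbr x p)) ->
  lattice_mean F x <= lattice_mean F' x.
Proof. by move=> le; rewrite ler_wpM2r ?invr_ge0 // ler_sum. Qed.

Lemma lattice_meanE F x : lattice_mean F x =
  (\sum_i (F (nbr x (i, true)) + F (nbr x (i, false)))) / (d * 2)%:R.
Proof.
rewrite /lattice_mean; congr (_ / _).
rewrite -(pair_bigA _ (fun i s => F (nbr x (i, s)))) /=.
by apply: eq_bigr => i _; rewrite big_bool.
Qed.

Definition sqdist x y : R := \sum_i ((x 0 i - y 0 i)%:~R) ^+ 2.

Lemma sqdist_ge0 x y : 0 <= sqdist x y.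
Proof. by apply: sumr_ge0 => i _; rewrite sqr_ge0. Qed.

Lemma sqdist_coord x y i : ((x 0 i - y 0 i)%:~R) ^+ 2 <= sqdist x y.
Proof. by rewrite /sqdist (bigD1 i) //= lerDl sumr_ge0 // => j _; rewrite sqr_ge0. Qed.

Lemma sqdist_nbr x y i s : sqdist (nbr x (i, s)) y =
  sqdist x y + 1 + 2 * ((unit_step s)%:~R * (x 0 i - y 0 i)%:~R).
Proof.
rewrite /sqdist (bigD1 i) //= [in RHS](bigD1 i) //= mxE eqxx /=.
rewrite (eq_bigr (fun j => ((x 0 j - y 0 j)%:~R : R) ^+ 2)) => [|j ji]; last first.
  by rewrite mxE (negPf ji) addr0.
have -> : x 0 i + unit_step s - y 0 i = (x 0 i - y 0 i) + unit_step s by ring.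
rewrite rmorphD /= sqrrD.
have -> : ((unit_step s)%:~R : R) ^+ 2 = 1 by case: s; rewrite /= ?rmorphN /= ?sqrrN expr1n.
rewrite -mulr_natl; ring.
Qed.

Lemma sqdist_triangle x y : sqdist x y <= 2 * sqdist x 0 + 2 * sqdist y 0.
Proof.
rewrite /sqdist !mulr_sumr -big_split /=; apply: ler_sum => i _.
rewrite !mxE !subr0 rmorphB /=.
have := sqr_ge0 ((x 0 i)%:~R + (y 0 i)%:~R : R); rewrite !expr2; lra.
Qed.

Lemma lattice_mean_sqdist (f : R -> R) x y : lattice_mean (fun z => f (sqdist z y)) x =
  (\sum_i (f (sqdist x y + 1 + 2 * (x 0 i - y 0 i)%:~R) +
           f (sqdist x y + 1 - 2 * (x 0 i - y 0 i)%:~R))) / (d * 2)%:R.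
Proof.
rewrite lattice_meanE; congr (_ / _); apply: eq_bigr => i _; rewrite !sqdist_nbr /=.
by congr (f _ + f _); rewrite ?rmorphN /= ?mul1r // mulN1r mulrN.
Qed.

Context (d_gt0 : (0 < d)%N) (n : nat) (n_gt0 : (0 < n)%N) (A : {fset 'rV[int]_d})
  (AE : forall x, (x \in A) = (\sum_(i < d) x 0 i ^+ 2 <= n%:R ^+ 2)).

Let K := @srw_on R _ (@lattice_edge d) A.
Lemma lattice_symm (x z : A) : K x z = K z x.
Proof.
rewrite /K /srw_on /srw !lattice_degree.
suff -> : lattice_edge (val x) (val z) = lattice_edge (val z) (val x) by [].
by congr (_ == _); apply: eq_bigr => i _; rewrite distrC.
Qed.

Let sq0 x : sqdist x 0 = (\sum_(i < d) x 0 i ^+ 2)%:~R.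
Proof.
by rewrite /sqdist rmorph_sum /=; apply: eq_bigr => i _; rewrite mxE subr0 rmorphXn.
Qed.

Lemma ball_sqdist x : x \in A -> sqdist x 0 <= n%:R ^+ 2.
Proof. by rewrite AE sq0 -(ler_int R) rmorphXn /= natz. Qed.

Lemma ball_compl_sqdist x : x \notin A -> n%:R ^+ 2 + 1 <= sqdist x 0.
Proof.
rewrite AE sq0 -ltNge -lezD1 -(ler_int R) rmorphD /= rmorphXn /= natz //.
Qed.

Lemma ball_coord x i : x \in A -> `|(x 0 i)%:~R| <= n%:R :> R.
Proof.
move=> xA; rewrite -(ler_pXn2r (_ : 0 < 2)%N) ?nnegrE // real_normK ?num_real //.
by apply: le_trans (ball_sqdist xA); have := sqdist_coord x 0 i; rewrite mxE subr0.
Qed.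

Lemma ball_nbr_sqdist x p : x \in A -> sqdist (nbr x p) 0 <= (n%:R + 1) ^+ 2.
Proof.
move=> xA; case: p => i s; rewrite sqdist_nbr mxE subr0.
have := ball_coord i xA; have := ball_sqdist xA; rewrite ler_norml => h1 /andP[h2 h3].
by case: s; rewrite /= ?rmorphN /= ?mul1r ?mulN1r sqrrD -mulr_natl; lra.
Qed.

Lemma ball_transient : transient K.
Proof.
apply: srw_on_transient => [x|Z /set0Pn[x0 x0Z]]; first exact: lattice_finite.
pose i0 := Ordinal d_gt0.
pose x := [arg max_(x > x0 in Z) (val x) 0 i0]%O.
have [xZ xm] : x \in Z /\ forall z : A, z \in Z -> (val z) 0 i0 <= (val x) 0 i0.
  by rewrite /x; case: arg_maxP.
exists x => //; exists (nbr (val x) (i0, true)); first by apply/lattice_edgeP; exists (i0, true).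
move=> z zZ; apply/eqP => zx; have := xm z zZ.
by rewrite zx mxE eqxx /= gerDl.
Qed.

Lemma ball_mean_ge (F : 'rV[int]_d -> R) (x : A) : (forall z, z \notin A -> F z <= 0) ->
  lattice_mean F (val x) <= \sum_(z : A) K x z * F (val z).
Proof.
move=> F0; rewrite lattice_srw_sum; apply: ler_lattice_mean => p.
by case: ifP => // /negbT /F0.
Qed.

Lemma ball_mean_le (F : 'rV[int]_d -> R) (x : A) : (forall p, 0 <= F (nbr (val x) p)) ->
  \sum_(z : A) K x z * F (val z) <= lattice_mean F (val x).
Proof.
move=> F0; rewrite lattice_srw_sum; apply: ler_lattice_mean => p.
by case: ifP.
Qed.

(** Its mean drop per step is exactly 1. Coordinates are integers, so with the added 1 it is at
    least 1 on the ball and still nonpositive outside. *)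
Let psi x : R := n%:R ^+ 2 + 1 - sqdist x 0.

Let psi_out z : z \notin A -> psi z <= 0.
Proof. by move=> /ball_compl_sqdist; rewrite subr_le0. Qed.

Let psi_in z : z \in A -> 1 <= psi z.
Proof. by move=> /ball_sqdist h; rewrite /psi; lra. Qed.

Let psi_mean x : lattice_mean psi x = psi x - 1.
Proof.
rewrite (lattice_mean_sqdist (fun q => n%:R ^+ 2 + 1 - q)) /psi.
rewrite (eq_bigr (fun=> 2 * (n%:R ^+ 2 + 1 - sqdist x 0 - 1))) => [|i _]; last by ring.
by rewrite sumr_const card_ord -mulr_natr mulrAC natrM; field; rewrite pnatr_eq0 -lt0n.
Qed.

(** Near the boundary [psi] itself may be as small as 1. Its one-step improvement [phi] is still a
    subsolution, and there a step inwards along the largest coordinate raises [psi] by an amount of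
    order [n]. *)
Lemma ball_lifetime : exists phi : A -> R,
  (forall x : A, phi x <= 1 + \sum_z K x z * phi z) /\
  forall x : A, n%:R / (4 * d%:R ^+ 2) <= phi x.
Proof.
have K0 (x z : A) : 0 <= K x z by apply: srw_ge0.
pose phi (x : A) := 1 + \sum_(z : A) K x z * psi (val z).
have psi_le (x : A) : psi (val x) <= phi x.
  by rewrite /phi addrC -lerBlDr -psi_mean ball_mean_ge.
have d1 : 1 <= d%:R :> R by rewrite ler1n.
exists phi; split=> x.
  by rewrite {1}/phi lerD2l; apply: ler_sum => z _; rewrite ler_wpM2l.
have phi_nbr p : 1 + psi (nbr (val x) p) / (d * 2)%:R <= phi x.
  rewrite /phi lerD2l lattice_srw_sum ler_wpM2r ?invr_ge0 // (bigD1 p) //=.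
  have s0 : 0 <= \sum_(q | q != p) (if nbr (val x) q \in A then psi (nbr (val x) q) else 0).
    by apply: sumr_ge0 => q _; case: ifP => // /psi_in; lra.
  by case: ifP => pA; [rewrite lerDl|apply: le_trans (psi_out (negbT pA)) _; rewrite add0r].
have coordP i : (n%:R ^+ 2 - sqdist (val x) 0 + 2 * `|((val x) 0 i)%:~R|) / (d * 2)%:R <= phi x.
  have key s : psi (nbr (val x) (i, s)) =
      n%:R ^+ 2 - sqdist (val x) 0 - 2 * ((unit_step s)%:~R * ((val x) 0 i)%:~R).
    by rewrite /psi sqdist_nbr mxE subr0; lra.
  have [x0|x0] := leP 0 ((val x) 0 i).
    have := phi_nbr (i, false); rewrite key /= rmorphN /= mulN1r ger0_norm ?ler0z //.
    rewrite mulrN opprK; lra.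
  have := phi_nbr (i, true); rewrite key /= mul1r ltr0_norm ?ltrz0 //.
  rewrite mulrN; lra.
have xs := ball_sqdist (fsvalP x).
pose i0 := Ordinal d_gt0; pose i := [arg max_(j > i0) `|(val x) 0 j|]%O.
have im j : `|(val x) 0 j| <= `|(val x) 0 i| by rewrite /i; case: arg_maxP => // k _ /(_ j); apply.
pose M : R := `|((val x) 0 i)%:~R|.
have M0 : 0 <= M by apply: normr_ge0.
have sqM : sqdist (val x) 0 <= d%:R * M ^+ 2.
  have -> : d%:R * M ^+ 2 = \sum_(j < d) M ^+ 2 by rewrite sumr_const card_ord mulr_natl.
  apply: ler_sum => j _; rewrite mxE subr0 -real_normK ?num_real //.
  by rewrite lerXn2r ?nnegrE // /M -!intr_norm ler_int.
have n1 : 1 <= n%:R :> R by rewrite ler1n.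
apply: le_trans (coordP i); rewrite -/M natrM.
rewrite ler_pdivlMr ?mulr_gt0 ?ltr0n //.
have -> : n%:R / (4 * d%:R ^+ 2) * (d%:R * 2) = n%:R / (2 * d%:R) :> R.
  by field; rewrite pnatr_eq0 -lt0n.
have d0 : 0 < d%:R :> R by lra.
have nd : n%:R / (2 * d%:R) <= n%:R / 2 :> R.
  rewrite invfM mulrA ler_piMr ?divr_ge0 // invf_le1 //.
have nn : n%:R <= n%:R ^+ 2 :> R by rewrite expr2 ler_peMl.
(* If no coordinate is of order [n], the point is well inside the ball and [n ^ 2 - sqdist]
   suffices. *)
have [h|h] := leP (n%:R / (2 * d%:R)) (2 * M); first lra.
have h' : M < n%:R / (4 * d%:R).
  have -> : n%:R / (4 * d%:R) = n%:R / (2 * d%:R) / 2 :> R by field; rewrite gt_eqF.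
  lra.
have : d%:R * M ^+ 2 <= n%:R ^+ 2 / 16.
  apply: (@le_trans _ _ (d%:R * (n%:R / (4 * d%:R)) ^+ 2)).
    by rewrite ler_wpM2l ?(ltW d0) // lerXn2r ?nnegrE ?(le_trans M0 (ltW h')) ?(ltW h').
  have -> : d%:R * (n%:R / (4 * d%:R)) ^+ 2 = n%:R ^+ 2 / 16 / d%:R :> R.
    by field; rewrite gt_eqF.
  by rewrite ler_piMr ?divr_ge0 ?sqr_ge0 // invf_le1.
lra.
Qed.

End Lattice.

(** * Superharmonic functions of the distance on the lattice *)

Section Superharmonic.
Context {R : realType}.

(* The fourth-order Taylor polynomial of [(1 + x)^(-1/2)] with its last
   coefficient [35/128] enlarged to [1]. *)
Let taylor (x : R) := 1 - x / 2 + 3 / 8 * x ^+ 2 - 5 / 16 * x ^+ 3 + x ^+ 4.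

(** Agreement to third order makes the difference of the squares [x ^ 4] times a bracket, which is
    positive on this range of [x]. *)
Lemma inv_sqrt_le (rho x : R) : 0 < rho -> - 2^-1 <= x -> x <= 2^-1 ->
  (Num.sqrt (rho * (1 + x)))^-1 <= (Num.sqrt rho)^-1 * taylor x.
Proof.
move=> r0 xl xu; have x1 : 0 < 1 + x by lra.
rewrite sqrtrM ?(ltW r0) // invfM ler_wpM2l ?invr_ge0 ?sqrtr_ge0 //.
have s0 : 0 < Num.sqrt (1 + x) by rewrite sqrtr_gt0.
have x2 : x ^+ 2 <= 4^-1.
  have : 0 <= (2^-1 - x) * (2^-1 + x) by rewrite mulr_ge0; lra.
  rewrite expr2; lra.
have x20 : 0 <= x ^+ 2 by apply: sqr_ge0.
have x3 : - 8^-1 <= x ^+ 3 <= 8^-1.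
  have a : 0 <= x ^+ 2 * (2^-1 + x) by rewrite mulr_ge0 //; lra.
  have b : 0 <= x ^+ 2 * (2^-1 - x) by rewrite mulr_ge0 //; lra.
  by rewrite exprSr; apply/andP; split; lra.
have x4 : 0 <= x ^+ 4 by rewrite -[4%N]/(2 * 2)%N exprM sqr_ge0.
have x5 : - 32^-1 <= x ^+ 5.
  have e5 : x ^+ 5 = x ^+ 2 * x ^+ 3 by rewrite -exprD.
  rewrite e5; case/andP: x3 => a b.
  have : - 4^-1 * 8^-1 <= x ^+ 2 * x ^+ 3.
    have : 0 <= x ^+ 2 * (x ^+ 3 + 8^-1) by rewrite mulr_ge0 //; lra.
    lra.
  lra.
case/andP: x3 => x3l x3u.
have p0 : 0 <= taylor x by rewrite /taylor; lra.
rewrite -div1r ler_pdivrMr //.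
rewrite -(ler_pXn2r (_ : 0 < 2)%N) ?nnegrE ?mulr_ge0 ?(ltW s0) // expr1n exprMn sqr_sqrtr ?(ltW x1) //.
rewrite -subr_ge0.
have -> : taylor x ^+ 2 * (1 + x) - 1 = x ^+ 4 * (93 / 64 + 39 / 32 * x - 99 / 256 * x ^+ 2
    + 57 / 256 * x ^+ 3 + 3 / 8 * x ^+ 4 + x ^+ 5).
  by rewrite /taylor; field.
by rewrite mulr_ge0 //; lra.
Qed.

(* The shift by [16] keeps the relative increments below [1 / 2], as [taylor]
   requires. *)
Lemma superharmonic_inv_sqrt d (z : 'I_d -> R) (q : R) : (3 <= d)%N ->
  q = \sum_i z i ^+ 2 ->
  \sum_i ((Num.sqrt (q + 1 + 2 * z i + 16))^-1 + (Num.sqrt (q + 1 - 2 * z i + 16))^-1) <=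
  (d * 2)%:R * (Num.sqrt (q + 16))^-1.
Proof.
move=> d3 qE; pose rho := q + 16.
have q0 : 0 <= q by rewrite qE; apply: sumr_ge0 => i _; rewrite sqr_ge0.
have zq i : z i ^+ 2 <= q.
  by rewrite qE (bigD1 i) //= lerDl sumr_ge0 // => j _; rewrite sqr_ge0.
have r16 : 16 <= rho by rewrite /rho; lra.
have r0 : 0 < rho by lra.
pose t := rho^-1.
have t0 : 0 < t by rewrite invr_gt0.
have t1 : t <= 16^-1 by rewrite lef_pV2 ?posrE.
have tr : t * rho = 1 by rewrite mulVf // gt_eqF.
have tq : t * q = 1 - 16 * t by rewrite (_ : q = rho - 16) ?mulrBr ?tr /rho; lra.
pose B := 3 * t ^+ 2 + 32 * t ^+ 3 + 48 * t ^+ 4.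
have B0 : 0 <= B.
  by rewrite /B !addr_ge0 ?mulr_ge0 ?exprn_ge0 // ltW.
have term i : (Num.sqrt (q + 1 + 2 * z i + 16))^-1 + (Num.sqrt (q + 1 - 2 * z i + 16))^-1 <=
   (Num.sqrt rho)^-1 * (2 - t + 3 / 4 * t ^+ 2 + 2 * t ^+ 4 + B * z i ^+ 2).
  have e s : q + 1 + s + 16 = rho * (1 + t * (1 + s)).
    by rewrite mulrDr mulr1 mulrA [rho * t]mulrC tr mul1r /rho; lra.
  have zr : - (rho / 2) <= 1 + 2 * z i <= rho / 2 /\ - (rho / 2) <= 1 - 2 * z i <= rho / 2.
    have := zq i; rewrite /rho => h.
    have := sqr_ge0 (z i - 2); have := sqr_ge0 (z i + 2); rewrite !expr2 in h * => h1 h2.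
    split; apply/andP; split; lra.
  have tb s : - (rho / 2) <= s <= rho / 2 -> - 2^-1 <= t * s <= 2^-1.
    move=> /andP[a b]; apply/andP; split.
      have : t * - (rho / 2) <= t * s by rewrite ler_wpM2l // ltW.
      rewrite mulrN mulrA tr; lra.
    have : t * s <= t * (rho / 2) by rewrite ler_wpM2l // ltW.
    rewrite mulrA tr; lra.
  case: zr => /tb/andP[a1 a2] /tb/andP[b1 b2].
  rewrite e -[q + 1 - 2 * z i]/(q + 1 + (- (2 * z i))) e.
  apply: le_trans (lerD (inv_sqrt_le r0 a1 a2) (inv_sqrt_le r0 b1 b2)) _.
  rewrite -mulrDr ler_wpM2l ?invr_ge0 ?sqrtr_ge0 //.
  have c3 : 0 <= t ^+ 3 * z i ^+ 2 by apply: mulr_ge0; [rewrite exprn_ge0 // ltW|apply: sqr_ge0].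
  have z4 : t ^+ 4 * (z i ^+ 2 * z i ^+ 2) <= t ^+ 3 * z i ^+ 2.
    have -> : t ^+ 4 * (z i ^+ 2 * z i ^+ 2) = t ^+ 3 * z i ^+ 2 * (t * z i ^+ 2) by ring.
    rewrite ler_piMr //.
    have : t * z i ^+ 2 <= t * q by rewrite ler_wpM2l // ltW.
    lra.
  have c4 : 0 <= t ^+ 3 by rewrite exprn_ge0 // ltW.
  have -> : taylor (t * (1 + 2 * z i)) + taylor (t * (1 - 2 * z i)) =
      2 - t + 3 / 4 * t ^+ 2 + 3 * (t ^+ 2 * z i ^+ 2) - 5 / 8 * t ^+ 3
      - 15 / 2 * (t ^+ 3 * z i ^+ 2) + 2 * t ^+ 4 + 48 * (t ^+ 4 * z i ^+ 2)
      + 32 * (t ^+ 4 * (z i ^+ 2 * z i ^+ 2)).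
    by rewrite /taylor; field.
  rewrite /B; lra.
apply: (le_trans (ler_sum _ (fun i _ => term i))).
rewrite -mulr_sumr mulrC ler_wpM2r ?invr_ge0 ?sqrtr_ge0 //.
rewrite big_split /= -mulr_sumr -qE sumr_const card_ord -[_ *+ d]mulr_natl natrM.
have d3R : 3 <= d%:R :> R by rewrite ler_nat.
(* To leading order the quadratic terms gain [3 * t] while the [d] linear terms lose [d * t]: here
   dimension at least 3 is decisive. *)
have Bq : B * q = 3 * t - 16 * t ^+ 2 - 464 * t ^+ 3 - 768 * t ^+ 4.
  have -> : B * q = (3 * t + 32 * t ^+ 2 + 48 * t ^+ 3) * (t * q) by rewrite /B; ring.
  rewrite tq; ring.
rewrite Bq.
have t2 : t ^+ 2 <= t / 16 by rewrite expr2 ler_wpM2l // ltW.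
have t2' : 0 <= t ^+ 2 by apply: sqr_ge0.
have t3 : 0 <= t ^+ 3 by rewrite exprn_ge0 // ltW.
have t4 : 0 <= t ^+ 4 <= t ^+ 2 / 256.
  rewrite exprn_ge0 ?(ltW t0) //=.
  have -> : t ^+ 4 = t ^+ 2 * (t * t) by ring.
  rewrite ler_wpM2l // -expr2; apply: le_trans t2 _; lra.
case/andP: t4 => t4 t4'.
have neg : - t + 3 / 4 * t ^+ 2 + 2 * t ^+ 4 <= 0 by lra.
have : (d%:R - 3) * (- t + 3 / 4 * t ^+ 2 + 2 * t ^+ 4) <= 0.
  by rewrite mulr_ge0_le0 // subr_ge0.
lra.
Qed.

(** After exponentiation the claim is polynomial, and the difference is visibly positive. Thus a
    constant minus this logarithm is superharmonic in the plane. *)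
Lemma superharmonic_ln (z : 'I_2 -> R) (q : R) : q = \sum_i z i ^+ 2 ->
  4 * ln (q + 1) <= \sum_i (ln (q + 1 + 2 * z i + 1) + ln (q + 1 - 2 * z i + 1)).
Proof.
move=> qE; have q0 : 0 <= q by rewrite qE; apply: sumr_ge0 => i _; rewrite sqr_ge0.
have zq i : z i ^+ 2 <= q.
  by rewrite qE (bigD1 i) //= lerDl sumr_ge0 // => j _; rewrite sqr_ge0.
have pos i : 0 < q + 1 + 2 * z i + 1 /\ 0 < q + 1 - 2 * z i + 1.
  have := zq i; have := sqr_ge0 (z i + 1); have := sqr_ge0 (z i - 1).
  rewrite !expr2 => h1 h2 h3; split; lra.
have q1 : 0 < q + 1 by lra.
rewrite big_ord_recl big_ord1; rewrite big_ord_recl big_ord1 in qE.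
have [p1 p2] := pos ord0; have [p3 p4] := pos (lift ord0 ord0).
rewrite -!lnM ?posrE ?mulr_gt0 //.
have -> : 4 * ln (q + 1) = ln ((q + 1) ^+ 4) by rewrite lnXn // mulr_natl.
rewrite ler_ln ?posrE ?exprn_gt0 ?mulr_gt0 //.
rewrite -subr_ge0; set a := z ord0 in qE *; set c := z _ in qE *.
have -> : (q + 1 + 2 * a + 1) * (q + 1 - 2 * a + 1) * ((q + 1 + 2 * c + 1) * (q + 1 - 2 * c + 1))
   - (q + 1) ^+ 4 = 2 * (q + 1) ^+ 2 + 8 * (q + 1) + 5 + 16 * (a * c) ^+ 2.
  by rewrite qE; ring.
have := sqr_ge0 (q + 1); have := sqr_ge0 (a * c).
move: (_ ^+ 2) ((a * c) ^+ 2) => u v; lra.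
Qed.

End Superharmonic.

Section BallHitting.
Context {R : realType} {d : nat}.
Context (d_gt0 : (0 < d)%N) (n : nat) (n_gt0 : (0 < n)%N) (A : {fset 'rV[int]_d})
  (AE : forall x, (x \in A) = (\sum_(i < d) x 0 i ^+ 2 <= n%:R ^+ 2)).

Let K := @srw_on R _ (@lattice_edge d) A.
Let Kt : transient K := ball_transient d_gt0 A.

(** Apply [hit_sum_ge] to [F] of the squared distance to [y], whose drop at [y] is at least
    [F 0 - F 1]. The range of [q] allows for neighbours just outside the ball. *)
Lemma ball_hit_ge (F : R -> R) (c : R) (y : A) :
  (forall q, 0 <= q -> q <= 2 * (n%:R + 1) ^+ 2 + 2 * n%:R ^+ 2 -> 0 <= F q) ->
  (forall (z : 'I_d -> R) q, q = \sum_i z i ^+ 2 ->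
     \sum_i (F (q + 1 + 2 * z i) + F (q + 1 - 2 * z i)) <= (d * 2)%:R * F q) ->
  0 <= c -> c <= F 0 - F 1 ->
  c * (n%:R / (4 * d%:R ^+ 2)) <= F 0 * \sum_x hit Kt y x.
Proof.
move=> F0 Fsup c0 cF.
have d2 : 0 < (d * 2)%:R :> R by rewrite ltr0n muln_gt0 d_gt0.
have [phi [phi1 phi2]] := @ball_lifetime R d d_gt0 n n_gt0 A AE.
have yy : sqdist (val y) (val y) = 0 :> R.
  by rewrite /sqdist big1 // => i _; rewrite subrr expr0n.
have range_nbr (x : A) p : 0 <= F (sqdist (nbr (val x) p) (val y)).
  apply: F0; first exact: sqdist_ge0.
  apply: le_trans (sqdist_triangle _ _) _.
  rewrite lerD // ler_wpM2l //; first by apply: (ball_nbr_sqdist AE); apply: fsvalP.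
  by apply: (ball_sqdist AE); apply: fsvalP.
have F00 : 0 <= F 0 by apply: F0 => //; rewrite addr_ge0 // mulr_ge0 // sqr_ge0.
have kx (x : A) : \sum_z K x z * F (sqdist (val z) (val y)) <=
    lattice_mean (fun z => F (sqdist z (val y))) (val x).
  exact: (ball_mean_le (F := fun z => F (sqdist z (val y)))).
have f0 : 0 <= phi y by apply: le_trans (phi2 y); rewrite divr_ge0 // mulr_ge0 // sqr_ge0.
have := @hit_sum_ge _ _ _ Kt (fun x => F (sqdist (val x) (val y))) phi c y
  (@lattice_symm _ _ A) _ _ _ phi1 f0.
rewrite yy => h; apply: (le_trans (ler_wpM2l c0 (phi2 y))); apply: h => //.
  move=> x; apply: le_trans (kx x) _; rewrite lattice_mean_sqdist ler_pdivrMr // mulrC.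
  exact: (Fsup (fun i => ((val x) 0 i - (val y) 0 i)%:~R)).
apply: le_trans cF _; rewrite lerD2l lerN2; apply: le_trans (kx y) _.
rewrite lattice_mean_sqdist ler_pdivrMr // yy.
rewrite (eq_bigr (fun=> F 1 * 2)) => [|i _]; last first.
  by rewrite subrr !(mulr0, addr0, subr0, add0r) mulr_natr.
by rewrite sumr_const card_ord -[leLHS]mulr_natr natrM -mulrA [2 * _]mulrC.
Qed.

Lemma ball_card_le : (#|{: A}| <= (2 * n).+1 ^ d)%N.
Proof.
pose f (x : A) : {ffun 'I_d -> 'I_(2 * n).+1} := [ffun i => inord (absz ((val x) 0 i + n%:Z))].
have xb (x : A) i : - n%:Z <= (val x) 0 i <= n%:Z.
  have := ball_coord (R := R) AE i (fsvalP x).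
  by rewrite -intr_norm -[n%:R]/(n%:Z%:~R) ler_int ler_norml.
have fi : injective f.
  move=> x y /ffunP e; apply/val_inj/rowP => i; have := e i; rewrite !ffunE.
  have := xb x i; have := xb y i.
  move: ((val x) 0 i) ((val y) 0 i) => a b ha hb /(congr1 (@nat_of_ord _)).
  by rewrite !inordK; lia.
by have := leq_card f fi; rewrite card_ffun !card_ord.
Qed.

Lemma ball_card_ge : (n ^ d <= d ^ d * #|{: A}|)%N.
Proof.
(* The cube of points with coordinates from 0 to [k] lies in the ball, since
   [d * k ^ 2 <= (d * k) ^ 2 <= n ^ 2]. *)
pose k := (n %/ d)%N.
have kd : (d * k <= n)%N by rewrite mulnC leq_trunc_div.
have kd' : (n < d * k.+1)%N by rewrite mulnC ltn_ceil.
pose g (h : {ffun 'I_d -> 'I_k.+1}) : 'rV[int]_d := \row_i (h i)%:Z.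
have gA h : g h \in A.
  rewrite AE; apply: (@le_trans _ _ (\sum_(i < d) (k%:Z) ^+ 2)).
    apply: ler_sum => i _; rewrite mxE -!natz -!natrX ler_nat leq_exp2r // -ltnS //.
  rewrite sumr_const card_ord -natz -natrX -mulrnA -natrX ler_nat.
  apply: leq_trans (_ : (d * k) ^ 2 <= _)%N; last by rewrite leq_exp2r.
  by rewrite expnMn mulnC leq_mul2r orbC -mulnn leq_pmulr.
have gi : injective (fun h => [` gA h]%fset).
  move=> h h' /(congr1 val) /= /rowP e; apply/ffunP => i; apply/val_inj.
  by have := e i; rewrite !mxE => -[].
have := leq_card _ gi; rewrite card_ffun !card_ord => le.
apply: leq_trans (_ : (d * k.+1) ^ d <= _)%N; first by rewrite leq_exp2r // ltnW.
by rewrite expnMn leq_mul2l le orbT.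
Qed.

End BallHitting.

(** Near the ends the lifetime is only of order [n], so [u] must be smaller there too. Both the
    lifetime [phi] and the concave [u] vanish at the killing points, and their ratio at [y] is
    [(n + 1 + |y|) / 2]. *)
Lemma interval_hit_ge {R : realType} (n : nat) (n_gt0 : (0 < n)%N) (A : {fset 'rV[int]_1})
    (AE : forall x, (x \in A) = (\sum_(i < 1) x 0 i ^+ 2 <= n%:R ^+ 2)) (y : A) :
  (n%:R + 1) / 2 <= \sum_x hit (ball_transient (R := R) (ltn0Sn 0) A) y x.
Proof.
pose X (x : 'rV[int]_1) : R := (x 0 0)%:~R.
have X_in x : x \in A -> `|X x| <= n%:R by move=> xA; apply: (ball_coord AE).
have X_out x : x \notin A -> n%:R + 1 <= `|X x|.
  rewrite AE big_ord1 -ltNge /X -intr_norm => h.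
  have : n%:R + 1 <= `|x 0 0|.
    by rewrite lezD1 -(ltr_pXn2r (_ : 0 < 2)%N) ?nnegrE // real_normK ?num_real.
  by rewrite -(ler_int R) rmorphD rmorph_nat.
have Xt (x : 'rV[int]_1) : X (nbr x (ord0, true)) = X x + 1 by rewrite /X mxE eqxx rmorphD.
have Xf (x : 'rV[int]_1) : X (nbr x (ord0, false)) = X x - 1 by rewrite /X mxE eqxx rmorphB.
have mean (F : 'rV[int]_1 -> R) (x : 'rV[int]_1) : lattice_mean F x = (F (nbr x (ord0, true)) + F (nbr x (ord0, false))) / 2 :> R.
  by rewrite lattice_meanE big_ord1.
pose u x : R := 2 * (n%:R + 1 - Num.max `|X x| `|X (val y)|).
pose phi x : R := (n%:R + 1) ^+ 2 - X x ^+ 2.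
have yn := X_in _ (fsvalP y).
have um x p : x \in A -> 0 <= u (nbr x p).
  move=> xA; rewrite mulr_ge0 // subr_ge0 ge_max; apply/andP; split; last by lra.
  have := X_in _ xA; rewrite ler_norml => /andP[a b].
  by case: p => i [|]; rewrite (ord1 i) ?Xt ?Xf ler_norml; apply/andP; split; lra.
have triangle (a : R) : 2 * `|a| <= `|a + 1| + `|a - 1|.
  have -> : 2 * `|a| = `|(a + 1) + (a - 1)|.
    have -> : a + 1 + (a - 1) = 2 * a by ring.
    by rewrite normrM normr_nat.
  exact: ler_normD.
have max_sum (a b : R) : 2 * Num.max `|a| b <= Num.max `|a + 1| b + Num.max `|a - 1| b.
  have [ab|ab] := leP `|a| b; last first.
    by apply: le_trans (triangle a) _; apply: lerD; rewrite le_max lexx.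
  by rewrite mulr_natl mulr2n lerD // le_max lexx orbT.
have h := @hit_sum_ge _ _ _ (ball_transient (R := R) (ltn0Sn 0) A)
  (fun x => u (val x)) (fun x => phi (val x)) 1 y (@lattice_symm _ _ A).
have {h} := h _ _ _ _ _; rewrite mul1r => h.
have fac : phi (val y) = (n%:R + 1 - `|X (val y)|) * (n%:R + 1 + `|X (val y)|).
  by rewrite /phi -[X _ ^+ 2]real_normK ?num_real // subr_sqr.
have uyE : u (val y) = 2 * (n%:R + 1 - `|X (val y)|) by rewrite /u maxxx.
have d0 : 0 < n%:R + 1 - `|X (val y)| by lra.
have : phi (val y) <= u (val y) * \sum_x hit (ball_transient (R := R) (ltn0Sn 0) A) y x.
  apply: h.
  - move=> x; apply: le_trans (ball_mean_le (um (val x) ^~ (fsvalP x))) _.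
    rewrite mean /u Xt Xf ler_pdivrMr //; have := max_sum (X (val x)) `|X (val y)|; lra.
  - rewrite lerBrDr -lerBrDl; apply: le_trans (ball_mean_le (um (val y) ^~ (fsvalP y))) _.
    rewrite mean /u Xt Xf maxxx ler_pdivrMr //.
    suff : 2 * `|X (val y)| + 1 <=
        Num.max `|X (val y) + 1| `|X (val y)| + Num.max `|X (val y) - 1| `|X (val y)| by lra.
    have [p|p] := leP 0 (X (val y)).
      have : `|X (val y)| + 1 <= Num.max `|X (val y) + 1| `|X (val y)|.
        by rewrite le_max !ger0_norm ?addr_ge0 ?lexx.
      have : `|X (val y)| <= Num.max `|X (val y) - 1| `|X (val y)| by rewrite le_max lexx orbT.
      lra.
    have : `|X (val y)| + 1 <= Num.max `|X (val y) - 1| `|X (val y)|.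
      by rewrite le_max !ltr0_norm ?opprB; [rewrite addrC lexx| |]; lra.
    have : `|X (val y)| <= Num.max `|X (val y) + 1| `|X (val y)| by rewrite le_max lexx orbT.
    lra.
  - by rewrite uyE mulr_ge0 // ltW.
  - move=> x; rewrite addrC -lerBlDr.
    have <- : lattice_mean phi (val x) = phi (val x) - 1.
      by rewrite mean /phi Xt Xf; field.
    apply: ball_mean_ge => z /X_out zn; rewrite /phi subr_le0 -[X z ^+ 2]real_normK ?num_real //.
    by rewrite lerXn2r // nnegrE // addr_ge0.
  - by rewrite fac; apply: mulr_ge0; [exact: ltW|rewrite !addr_ge0].
rewrite fac uyE [2 * _]mulrC -mulrA ler_pM2l // => hh.
have : 0 <= `|X (val y)| by []. lra.
Qed.

(** Unlike [ball_g], which is 0 for [d = 2] and [n = 1], this is positive for all [n >= 1]. *)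
Definition ball_rate {R : realType} (d n : nat) : R :=
  match d with
  | 1 => 1
  | 2 => n%:R * (1 + ln n%:R)
  | _ => n%:R ^+ d.-1
  end.

(** The lifetime bound of order [n] is divided by the value of the superharmonic function at [y],
    which is logarithmic for [d = 2] and bounded for [d >= 3]; the interval is treated apart. *)
Lemma ball_hit_rate {R : realType} (d : nat) (d_gt0 : (0 < d)%N) :
  exists2 C : R, 0 < C & forall (n : nat) (n_gt0 : (0 < n)%N) (A : {fset 'rV[int]_d})
    (AE : forall x, (x \in A) = (\sum_(i < d) x 0 i ^+ 2 <= n%:R ^+ 2)) (y : A),
  #|{: A}|%:R <= C * ball_rate d n * \sum_x hit (ball_transient (R := R) d_gt0 A) y x.
Proof.
have card_le n (A : {fset 'rV[int]_d}) (n_gt0 : (0 < n)%N)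
    (AE : forall x, (x \in A) = (\sum_(i < d) x 0 i ^+ 2 <= n%:R ^+ 2)) :
    #|{: A}|%:R <= 3 ^+ d * n%:R ^+ d :> R.
  rewrite -exprMn -natrM -natrX ler_nat; apply: leq_trans (ball_card_le (R := R) d_gt0 n_gt0 AE) _.
  by rewrite leq_exp2r //; lia.
have d0 : 0 < d%:R :> R by rewrite ltr0n.
have general (F : nat -> R -> R) (c U : R) : 0 < c -> 0 < U ->
    (forall n q, (0 < n)%N -> 0 <= q -> q <= 2 * (n%:R + 1) ^+ 2 + 2 * n%:R ^+ 2 -> 0 <= F n q) ->
    (forall n (z : 'I_d -> R) q, q = \sum_i z i ^+ 2 ->
     \sum_i (F n (q + 1 + 2 * z i) + F n (q + 1 - 2 * z i)) <= (d * 2)%:R * F n q) ->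
    (forall n, (0 < n)%N -> c <= F n 0 - F n 1) ->
    (forall n, (0 < n)%N -> F n 0 * n%:R ^+ d.-1 <= U * ball_rate d n) ->
    exists2 C : R, 0 < C & forall (n : nat) (n_gt0 : (0 < n)%N) (A : {fset 'rV[int]_d})
    (AE : forall x, (x \in A) = (\sum_(i < d) x 0 i ^+ 2 <= n%:R ^+ 2)) (y : A),
  #|{: A}|%:R <= C * ball_rate d n * \sum_x hit (ball_transient (R := R) d_gt0 A) y x.
  move=> c0 U0 F0 Fs Fc FU; exists (3 ^+ d * (4 * d%:R ^+ 2 / c) * U).
    by rewrite !mulr_gt0 ?invr_gt0 ?exprn_gt0.
  move=> n n0 A AE y; apply: le_trans (card_le n A n0 AE) _.
  have := ball_hit_ge d_gt0 n0 AE y (fun q => F0 n q n0) (Fs n) (ltW c0) (Fc n n0).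
  have n1 : 0 <= n%:R ^+ d.-1 :> R by rewrite exprn_ge0.
  set S := \sum_x _; have S0 : 0 <= S by apply: sumr_ge0 => x _; apply: hit_ge0.
  set k := _ / c; have k0 : 0 < k by rewrite !mulr_gt0 ?invr_gt0 ?exprn_gt0.
  set q := n%:R / _ => h.
  have e : n%:R ^+ d = k * (n%:R ^+ d.-1 * (c * q)) :> R.
    by rewrite -{1}(prednK d_gt0) exprSr /k /q; field; rewrite !gt_eqF.
  clearbody k q; rewrite -!mulrA ler_pM2l ?exprn_gt0 // e ler_pM2l //.
  apply: (@le_trans _ _ (n%:R ^+ d.-1 * (F n 0 * S))); first by rewrite ler_wpM2l.
  by rewrite mulrA [_ * F n 0]mulrC mulrA ler_wpM2r // FU.
have [d1|d1] := leqP d 1.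
  have d1' : d = 1%N by lia.
  subst d; exists 4 => // n n0 A AE y; rewrite /ball_rate mulr1.
  rewrite (_ : ball_transient _ _ = ball_transient (ltn0Sn 0) A) //.
  have := interval_hit_ge (R := R) n0 AE y; set S := \sum_x _ => h.
  apply: (@le_trans _ _ (2 * n%:R + 1)); last by lra.
  have := ball_card_le (R := R) (ltn0Sn 0) n0 AE; rewrite expn1 -(ler_nat R) -natr1 natrM; exact.
have [d2|d2] := leqP d 2.
  have d2' : d = 2%N by lia.
  (* The largest [q + 1] needed is at most [11 * n ^ 2], so the constant 12 keeps the function
     nonnegative; [ln 2] is its drop from 0 to 1. *)
  subst d; apply: (general (fun n q => ln (12 * n%:R ^+ 2) - ln (q + 1)) (ln 2) (ln 12 + 2)).
  - by rewrite ln_gt0 // ltr1n.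
  - by rewrite addr_gt0 // ln_gt0 // ltr1n.
  - move=> n q n0 q0 qn; have n1 : 1 <= n%:R :> R by rewrite ler1n.
    rewrite subr_ge0 ler_ln ?posrE ?mulr_gt0 ?exprn_gt0 //; try lra.
    by apply: le_trans (lerD qn (lexx _)) _; nra.
  - move=> n z q qE; have := superharmonic_ln qE.
    rewrite !big_ord_recl !big_ord0; lra.
  - move=> n n0; rewrite add0r ln1; lra.
  - move=> n n0; rewrite add0r ln1 subr0 /= expr1.
    have n1 : 0 < n%:R :> R by rewrite ltr0n.
    have l0 : 0 <= ln n%:R :> R by rewrite ln_ge0 // ler1n.
    have l12 : 0 <= ln 12 :> R by rewrite ln_ge0 // ler1n.
    rewrite lnM ?posrE ?exprn_gt0 // lnXn // mulrC mulrCA ler_wpM2l //; nra.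
apply: (general (fun _ q => (Num.sqrt (q + 16))^-1) ((Num.sqrt 16)^-1 - (Num.sqrt 17)^-1) (Num.sqrt 16)^-1).
- by rewrite subr_gt0 ltf_pV2 ?posrE ?sqrtr_gt0 // ltr_sqrt // ltr_nat.
- by rewrite invr_gt0 sqrtr_gt0.
- by move=> n q _ _ _; rewrite invr_ge0 sqrtr_ge0.
- by move=> n z q qE; apply: superharmonic_inv_sqrt.
- by move=> n _; rewrite add0r -[1 + 16]/(17%:R) // (_ : 1 + 16 = 17) //; ring.
- move=> n _; rewrite add0r le_eqVlt; apply/orP; left; apply/eqP; congr (_ * _).
  by move: d2; rewrite /ball_rate; case: d {general card_le d0 d1 d_gt0} => [|[|[|d]]].
Qed.

(** * Asymptotics *)

Section Settings.
Local Open Scope classical_set_scope.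
Context {R : realType}.

Lemma near_ln_ge (M : R) : \forall n \near \oo, M <= ln n%:R.
Proof.
near=> n; rewrite -[M]expRK ler_ln ?posrE ?expR_gt0 //.
  by near: n; exact: nbhs_infty_ger.
by rewrite ltr0n; near: n; exists 1%N.
Unshelve. all: by end_near. Qed.

Lemma near_sqrt_ge (M : R) : \forall n \near \oo, M <= Num.sqrt n%:R.
Proof.
near=> n; apply: (@le_trans _ _ (Num.sqrt (M ^+ 2))).
  by rewrite sqrtr_sqr ler_norm.
by rewrite ler_sqrt //; near: n; exact: nbhs_infty_ger.
Unshelve. all: by end_near. Qed.

Lemma near_gt0 : \forall n \near \oo, (0 < n)%N.
Proof. by exists 1%N. Qed.

(** With [r = n], the standard deviation bound [sqrt (r * m)] is of order [n * sqrt (ln n)], smaller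
    than the mean by a factor [sqrt (ln n)]. *)
Lemma filling_estimates_nln (V : nat -> finType) (K : forall n, V n -> V n -> R) (c : R) :
  0 < c ->
  (forall n, (0 < n)%N -> exists m : R, [/\ fill_data (K n) m n%:R,
     n%:R / c * ln n%:R <= m & m <= n%:R * (1 + ln n%:R)]) ->
  exists2 m, filling_estimates K (fun n => n%:R * Num.sqrt (ln n%:R)) m &
    m =Theta_\oo (fun n => n%:R * ln n%:R : R).
Proof.
move=> c0 hm.
have /choice[m mP] : forall n, exists m : R, (0 < n)%N -> [/\ fill_data (K n) m n%:R,
    n%:R / c * ln n%:R <= m & m <= n%:R * (1 + ln n%:R)].
  by case=> [|n]; [exists 0|have [m ?] := hm n.+1 isT; exists m].
exists m; last first.
  rewrite eqThetaE bigThetaE eqOmegaO; split; apply/eqO_exP.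
    exists 2 => //; near=> n.
    have n0 : (0 < n)%N by near: n; exact: near_gt0.
    have l1 : 1 <= ln n%:R :> R by near: n; exact: near_ln_ge.
    have [_ a b] := mP n n0.
    have n1 : 0 < n%:R :> R by rewrite ltr0n.
    rewrite !ger0_norm; [nra|nra|].
    by apply: le_trans a; rewrite !mulr_ge0 ?invr_ge0 ?(ltW c0) //; lra.
  exists c => //; near=> n.
  have n0 : (0 < n)%N by near: n; exact: near_gt0.
  have l1 : 1 <= ln n%:R :> R by near: n; exact: near_ln_ge.
  have [_ a b] := mP n n0.
  have n1 : 0 < n%:R :> R by rewrite ltr0n.
  have x0 : 0 <= n%:R * ln n%:R :> R by rewrite mulr_ge0 //; lra.
  have m0 : 0 <= m n.
    by apply: le_trans a; rewrite mulrAC divr_ge0 // ltW.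
  by rewrite !ger0_norm // [c * _]mulrC -ler_pdivrMr // mulrAC.
exists (fun n => n%:R), 2 => //; split=> [n n0||| eps e0].
- by case: (mP n n0).
- near=> n.
  have n0 : (0 < n)%N by near: n; exact: near_gt0.
  have l1 : 1 <= ln n%:R :> R by near: n; exact: near_ln_ge.
  have [_ _ b] := mP n n0.
  rewrite !exprMn sqr_sqrtr; last by lra.
  have n1 : 0 < n%:R :> R by rewrite ltr0n.
  rewrite mulrCA [n%:R ^+ 2]expr2 -!mulrA ler_pM2l //; nra.
- near=> n.
  have n0 : (0 < n)%N by near: n; exact: near_gt0.
  have l1 : 1 <= ln n%:R :> R by near: n; exact: near_ln_ge.
  have s1 : 1 <= Num.sqrt (ln n%:R) :> R by rewrite -[leLHS]sqrtr1 ler_wsqrtr.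
  have n1 : 1 <= n%:R :> R by rewrite ler1n.
  nra.
near=> n.
have n0 : (0 < n)%N by near: n; exact: near_gt0.
have l1 : 1 <= ln n%:R :> R by near: n; exact: near_ln_ge.
have l2 : (c / eps) ^+ 2 <= ln n%:R by near: n; exact: near_ln_ge.
have [_ a _] := mP n n0.
have n1 : 0 < n%:R :> R by rewrite ltr0n.
set s := Num.sqrt _; have sE : ln n%:R = s ^+ 2 by rewrite sqr_sqrtr //; lra.
have s0 : 0 <= s by apply: sqrtr_ge0.
have s1 : c / eps <= s.
  by rewrite -(@ler_pXn2r _ 2) ?nnegrE ?divr_ge0 ?(ltW c0) ?(ltW e0) // -sE.
apply: (@le_trans _ _ (eps * (n%:R / c * ln n%:R))); last by rewrite ler_wpM2l // ltW.
rewrite sE; rewrite ler_pdivrMr // in s1.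
have -> : eps * (n%:R / c * s ^+ 2) = n%:R * s * (s * eps / c) by field; rewrite gt_eqF.
by rewrite ler_peMr ?mulr_ge0 ?(ltW n1) // ler_pdivlMr // mul1r.
Unshelve. all: by end_near. Qed.

(** Here [r] is polynomially bounded and [N / r] at least of order [sqrt n], so the exponential
    error is negligible; powers of [sqrt n] are a scale common to all dimensions. *)
Lemma filling_estimates_sharp (V : nat -> finType) (K : forall n, V n -> V n -> R)
    (r w N : nat -> R) (A a B : R) (k : nat) :
  0 < a -> 0 < B ->
  (forall n, (0 < n)%N -> 0 < r n) ->
  (forall n, (0 < n)%N -> exists m : R, [/\ fill_data (K n) m (r n), N n <= m
     & forall eps, 0 < eps -> m <=
         (1 + eps) * N n + 1 + r n * N n * expR (- (eps ^+ 2 / (4 + 2 * eps) * N n / r n))]) ->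
  (\forall n \near \oo, r n <= A * Num.sqrt n%:R ^+ k) ->
  (\forall n \near \oo, a * Num.sqrt n%:R * r n <= N n) ->
  (\forall n \near \oo, r n * N n <= (B * w n) ^+ 2) ->
  (\forall n \near \oo, 1 <= w n) ->
  (forall eps, 0 < eps -> \forall n \near \oo, w n <= eps * N n) ->
  exists2 m, filling_estimates K w m & m ~_\oo N.
Proof.
move=> a0 B0 r0 hm rA rN rw w1 wN.
have /choice[m mP] : forall n, exists m : R, (0 < n)%N ->
    [/\ fill_data (K n) m (r n), N n <= m
     & forall eps, 0 < eps -> m <=
         (1 + eps) * N n + 1 + r n * N n * expR (- (eps ^+ 2 / (4 + 2 * eps) * N n / r n))].
  by case=> [|n]; [exists 0|have [m ?] := hm n.+1 isT; exists m].
have small c eps : 0 < c -> 0 < eps -> \forall n \near \oo, r n * expR (- (c * N n / r n)) <= eps.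
  move=> c0 e0; near=> n.
  have n0 : (0 < n)%N by near: n; exact: near_gt0.
  have rn := r0 n n0.
  have hN : a * Num.sqrt n%:R * r n <= N n by near: n.
  have hA : r n <= A * Num.sqrt n%:R ^+ k by near: n.
  have hs : A / (eps * ((c * a) ^+ k.+1 / k.+1`!%:R)) <= Num.sqrt n%:R.
    by near: n; exact: near_sqrt_ge.
  move: hN hA hs; set s : R := Num.sqrt n%:R => hN hA hs; have s0 : 0 < s by rewrite sqrtr_gt0 ltr0n.
  have q : c * a * s <= c * N n / r n.
    by rewrite -!mulrA ler_pM2l // ler_pdivlMr.
  move: hs; set b := _ / k.+1`!%:R => hs.
  have b0 : 0 < b by rewrite divr_gt0 ?exprn_gt0 ?mulr_gt0 // ltr0n fact_gt0.
  (* One term of the exponential series, of degree one more than the bound on [r]. *)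
  have ex : b * s ^+ k.+1 <= expR (c * N n / r n).
    apply: (@le_trans _ _ (expR (c * a * s))); last by rewrite ler_expR.
    apply: le_trans (expR_ge1Dxn k _); last by rewrite !mulr_ge0 // ltW.
    by rewrite exprMn mulrAC lerDr ler01.
  rewrite expRN ler_pdivrMr ?expR_gt0 //.
  apply: (@le_trans _ _ (A * s ^+ k)) => //.
  apply: (@le_trans _ _ (eps * (b * s ^+ k.+1))); last by rewrite ler_wpM2l // ltW.
  clearbody b; by rewrite exprS !mulrA ler_wpM2r ?exprn_ge0 ?(ltW s0) // mulrC -ler_pdivrMr ?mulr_gt0.
have upper eps : 0 < eps -> \forall n \near \oo, m n <= (1 + eps) * N n.
  (* One third each for the slack in [N], the rounding term 1, which is below [w], and the
     exponential term. *)
  move=> e0; have e3 : 0 < eps / 3 by rewrite divr_gt0.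
  have c0 : 0 < (eps / 3) ^+ 2 / (4 + 2 * (eps / 3)).
    by rewrite divr_gt0 ?exprn_gt0 // addr_gt0 ?mulr_gt0.
  near=> n.
  have n0 : (0 < n)%N by near: n; exact: near_gt0.
  have [_ _ /(_ _ e3) h] := mP n n0.
  have x1 : w n <= eps / 3 * N n by near: n; exact: wN.
  have x2 : 1 <= w n by near: n.
  have N0 : 0 < N n by rewrite -(pmulr_rgt0 _ e3); lra.
  have x3 : r n * expR (- ((eps / 3) ^+ 2 / (4 + 2 * (eps / 3)) * N n / r n)) <= eps / 3.
    by near: n; exact: small.
  apply: (le_trans h); rewrite mulrAC.
  have := ler_wpM2r (ltW N0) x3; lra.
have lower n : (0 < n)%N -> N n <= m n by move=> n0; case: (mP n n0).
exists m; last first.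
  apply/eqaddoP => eps e0; near=> n.
  have n0 : (0 < n)%N by near: n; exact: near_gt0.
  have x1 : w n <= 1 * N n by near: n; exact: wN.
  have x2 : 1 <= w n by near: n.
  have x3 := lower n n0.
  have x4 : m n <= (1 + eps) * N n by near: n; exact: upper.
  rewrite [X in X <= _]ger0_norm ?ger0_norm; [|lra|by rewrite /= subr_ge0].
  have -> : (m - N) n = m n - N n by [].
  lra.
exists r, (2 * B); first by rewrite mulr_gt0.
split=> // [n n0||eps e0].
- by case: (mP n n0).
- near=> n.
  have n0 : (0 < n)%N by near: n; exact: near_gt0.
  have x1 : m n <= (1 + 1) * N n by near: n; exact: upper.
  have x2 : r n * N n <= (B * w n) ^+ 2 by near: n.
  rewrite -mulrA exprMn; apply: (@le_trans _ _ (r n * ((1 + 1) * N n))).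
    by rewrite ler_wpM2l // ltW // r0.
  have := sqr_ge0 (B * w n); lra.
near=> n.
have n0 : (0 < n)%N by near: n; exact: near_gt0.
apply: (@le_trans _ _ (eps * N n)); first by near: n; exact: wN.
by rewrite ler_wpM2l ?(ltW e0) // lower.
Unshelve. all: by end_near. Qed.


Lemma setting_a_estimates (V : nat -> finType) (K : forall n, V n -> V n -> R) w :
  setting_a K w -> exists2 m, filling_estimates K w m &
    m =Theta_\oo (fun n => n%:R * ln n%:R : R).
Proof.
case=> {V K w} G e V e_simple _ _ [D e_deg] e_na Vn.
(* With [D.+1] the constant is positive whatever [D] is. *)
have e_deg1 x : finite_set (neighbors e x) /\ (degree e x <= D.+1)%N.
  by have [? ?] := e_deg x; split=> //; apply: leqW.
have C0 : 0 < 4 * D.+1%:R * nonamenable_const (R := R) e D.+1.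
  have h0 : 0 < inf _ := e_na.
  by rewrite /nonamenable_const !(mulr_gt0, addr_gt0, invr_gt0, exprn_gt0, ltr0n).
apply: filling_estimates_nln C0 _ => n n0.
exact: (nonamenable_fill e_simple e_deg1 e_na n0 (Vn n n0)).
Qed.

Lemma setting_c_estimates (V : nat -> finType) (K : forall n, V n -> V n -> R) w :
  setting_c K w -> exists2 m, filling_estimates K w m &
    m =Theta_\oo (fun n => n%:R * ln n%:R : R).
Proof.
case=> {V K w} d G e o V hG.
apply: (@filling_estimates_nln _ _ (d.+1%:R ^+ 2)); first by rewrite exprn_gt0.
move=> n n0; have [e1 Gn on dx Vo] := hG n n0.
by apply: sink_fill n0 e1 Gn on _ Vo => x xo; apply: leqW; apply: dx.
Qed.

Lemma setting_b_estimates (V : nat -> finType) (K : forall n, V n -> V n -> R) w :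
  setting_b K w -> exists2 m, filling_estimates K w m & m ~_\oo (fun n => #|V n|%:R : R).
Proof.
case=> {V K w} G e o V hG.
have Vn n : (0 < n)%N -> #|{: V n}| = n.
  by move=> n0; have [_ _ _ Gn Vo] := hG n n0; apply: card_fset_fin Gn Vo.
have sq n : Num.sqrt n%:R ^+ 2 = n%:R :> R by rewrite sqr_sqrtr.
apply: (@filling_estimates_sharp _ _ (fun=> 2) _ _ 2 2^-1 2 0) => //.
- move=> n n0; rewrite Vn //; have [e1 e2 e3 Gn Vo] := hG n n0.
  exact: transitive_fill n0 e1 e2 e3 Gn Vo.
- by near=> n; rewrite expr0 mulr1.
- near=> n; have n0 : (0 < n)%N by near: n; exact: near_gt0.
  have s1 : 1 <= Num.sqrt n%:R :> R by near: n; exact: near_sqrt_ge.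
  by rewrite Vn // -[leRHS]sq; nra.
- near=> n; have n0 : (0 < n)%N by near: n; exact: near_gt0.
  by rewrite Vn // exprMn sq; have : 0 <= n%:R :> R by []; lra.
- exact: near_sqrt_ge.
move=> eps e0; near=> n; have n0 : (0 < n)%N by near: n; exact: near_gt0.
have s1 : eps^-1 <= Num.sqrt n%:R :> R by near: n; exact: near_sqrt_ge.
rewrite Vn // -[X in _ * X]sq expr2 mulrA ler_peMl ?sqrtr_ge0 //.
by rewrite -ler_pdivrMl // mulr1.
Unshelve. all: by end_near. Qed.

Lemma ball_rate_gt0 (d n : nat) : (0 < n)%N -> 0 < ball_rate d n :> R.
Proof.
move=> n0; have n1 : 1 <= n%:R :> R by rewrite ler1n.
have l0 : 0 <= ln n%:R :> R by rewrite ln_ge0.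
case: d => [|[|[|d]]] /=; rewrite ?exprn_gt0 ?ltr0n //.
by apply: mulr_gt0; lra.
Qed.

Lemma ball_g_le_rate (d n : nat) : (0 < n)%N -> ball_g R d n <= ball_rate d n.
Proof.
move=> n0; case: d => [|[|[|d]]] //=.
by rewrite ler_wpM2l // lerDr ler01.
Qed.

Lemma near_ball_rate_le (d : nat) : \forall n \near \oo, ball_rate d n <= 2 * ball_g R d n.
Proof.
near=> n; have n0 : (0 < n)%N by near: n; exact: near_gt0.
have l1 : 1 <= ln n%:R :> R by near: n; exact: near_ln_ge.
have n1 : 1 <= n%:R :> R by rewrite ler1n.
case: d => [|[|[|d]]] /=; [|lra|nra|].
  by rewrite expr0; lra.
by rewrite ler_peMl ?exprn_ge0 // ler1n.
Unshelve. all: by end_near. Qed.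

Lemma near_ball_g_ge1 (d : nat) : \forall n \near \oo, 1 <= ball_g R d n.
Proof.
near=> n; have n0 : (0 < n)%N by near: n; exact: near_gt0.
have l1 : 1 <= ln n%:R :> R by near: n; exact: near_ln_ge.
have n1 : 1 <= n%:R :> R by rewrite ler1n.
case: d => [|[|[|d]]] //=; [nra|].
by rewrite exprn_ege1.
Unshelve. all: by end_near. Qed.

(** The gap of order [sqrt n] between rate and volume controls both the exponential error and the
    relative size of the window. *)
Lemma ball_rate_le_sqrt (d n : nat) : (0 < d)%N -> (0 < n)%N ->
  ball_rate d n * Num.sqrt n%:R <= 2 * n%:R ^+ d :> R.
Proof.
move=> d0 n0; have n1 : 1 <= n%:R :> R by rewrite ler1n.
set s := Num.sqrt _; have sE : n%:R = s ^+ 2 by rewrite sqr_sqrtr.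
have s1 : 1 <= s by rewrite -[leLHS]sqrtr1 ler_wsqrtr.
have sn : s <= n%:R by rewrite sE; nra.
case: d d0 => [//|[|[|d]]] _ /=.
- by rewrite mul1r expr1; lra.
- have h : (1 + ln n%:R) * s <= 2 * n%:R.
    have : ln n%:R <= 2 * (s - 1).
      rewrite sE lnXn ?(lt_le_trans ltr01) // -[_ *+ 2]mulr_natl ler_pM2l //.
      have -> : s = 1 + (s - 1) by ring.
      by apply: le_trans (le_ln1Dx _) _; lra.
    move: sE; clearbody s => ->; nra.
  have := ler_wpM2l (le_trans ler01 n1) h; rewrite expr2; lra.
have p : 0 <= n%:R ^+ d.+2 :> R by rewrite exprn_ge0.
rewrite [_ ^+ d.+3]exprS; nra.
Qed.

Lemma setting_d_estimates (V : nat -> finType) (K : forall n, V n -> V n -> R) w :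
  setting_d K w -> exists2 m, filling_estimates K w m & m ~_\oo (fun n => #|V n|%:R : R).
Proof.
case=> {V K w} d V d0 hV.
have [C C0 hC] := ball_hit_rate (R := R) d0.
have dd0 : 0 < d%:R ^+ d :> R by rewrite exprn_gt0 // ltr0n.
have rate0 n (n0 : (0 < n)%N) := ball_rate_gt0 d n0.
have card_ge n : (0 < n)%N -> n%:R ^+ d <= d%:R ^+ d * #|{: V n}|%:R :> R.
  by move=> n0; rewrite -!natrX -natrM ler_nat; exact: (ball_card_ge d0 (hV n n0)).
have card_le n : (0 < n)%N -> #|{: V n}|%:R <= 3 ^+ d * n%:R ^+ d :> R.
  move=> n0; rewrite -exprMn -natrM -natrX ler_nat.
  by apply: leq_trans (ball_card_le (R := R) d0 n0 (hV n n0)) _; rewrite leq_exp2r //; lia.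
have rate_g := near_ball_rate_le d.
have g_ge1 := near_ball_g_ge1 d.
have nd1 n : (0 < n)%N -> 1 <= n%:R ^+ d :> R by move=> n0; rewrite exprn_ege1 ?ler1n.
have w2 : \forall n \near \oo,
    Num.sqrt (n%:R ^+ d * ball_g R d n) ^+ 2 = n%:R ^+ d * ball_g R d n.
  near=> n; have n0 : (0 < n)%N by near: n; exact: near_gt0.
  have g1 : 1 <= ball_g R d n by near: n.
  by rewrite sqr_sqrtr // mulr_ge0 ?exprn_ge0 //; lra.
pose B : R := 2 * C * 3 ^+ d + 1.
have B1 : 1 <= B by rewrite lerDr !mulr_ge0 ?exprn_ge0 // ltW.
(* The exponent [2 * d] comes from bounding the rate by a multiple of [n ^ d], a power of [sqrt n]
   of that degree. *)
apply: (@filling_estimates_sharp _ _ (fun n => C * ball_rate d n) _ _ (2 * C)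
  ((2 * C * d%:R ^+ d)^-1) B (2 * d)%N).
- by rewrite invr_gt0 !mulr_gt0.
- by lra.
- by move=> n n0; rewrite mulr_gt0 ?rate0.
- move=> n n0; have V0 : (0 < #|{: V n}|)%N.
    rewrite -(ltr_nat R) -(pmulr_rgt0 _ dd0); apply: lt_le_trans (card_ge n n0).
    by rewrite exprn_gt0 // ltr0n.
  by apply: (fill_sharp (Kt := ball_transient d0 (V n)) V0) => y; apply: hC n0 _ (hV n n0) y.
- near=> n; have n0 : (0 < n)%N by near: n; exact: near_gt0.
  have s1 : 1 <= Num.sqrt n%:R :> R by near: n; exact: near_sqrt_ge.
  rewrite exprM sqr_sqrtr // [2 * C]mulrC -mulrA ler_pM2l //.
  apply: le_trans (ball_rate_le_sqrt d0 n0).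
  by rewrite ler_peMr // ltW // rate0.
- near=> n; have n0 : (0 < n)%N by near: n; exact: near_gt0.
  have h1 := ball_rate_le_sqrt d0 n0; have h2 := card_ge n n0.
  have -> : (2 * C * d%:R ^+ d)^-1 * Num.sqrt n%:R * (C * ball_rate d n) =
      (ball_rate d n * Num.sqrt n%:R) / (2 * d%:R ^+ d).
    by field; rewrite !gt_eqF.
  rewrite ler_pdivrMr ?mulr_gt0 //; lra.
- near=> n; have n0 : (0 < n)%N by near: n; exact: near_gt0.
  have h1 : ball_rate d n <= 2 * ball_g R d n by near: n.
  have g1 : 1 <= ball_g R d n by near: n.
  have h2 := card_le n n0; have r1 := rate0 n n0; have n1 := nd1 n n0.
  have e : Num.sqrt (n%:R ^+ d * ball_g R d n) ^+ 2 = n%:R ^+ d * ball_g R d n by near: n.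
  have x0 : 0 <= n%:R ^+ d * ball_g R d n by apply: mulr_ge0; lra.
  rewrite exprMn e; apply: (@le_trans _ _ (B * (n%:R ^+ d * ball_g R d n))); last first.
    by rewrite ler_wpM2r // expr2 ler_peMl //; lra.
  apply: (@le_trans _ _ (C * (2 * ball_g R d n) * (3 ^+ d * n%:R ^+ d))).
    by apply: ler_pM => //; [rewrite mulr_ge0 // ltW|rewrite ler_wpM2l // ltW].
  have -> : C * (2 * ball_g R d n) * (3 ^+ d * n%:R ^+ d) =
    2 * C * 3 ^+ d * (n%:R ^+ d * ball_g R d n) by ring.
  by rewrite ler_wpM2r // lerDl.
- near=> n; have n0 : (0 < n)%N by near: n; exact: near_gt0.
  have g1 : 1 <= ball_g R d n by near: n.
  have n1 := nd1 n n0.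
  by rewrite -[leLHS]sqrtr1 ler_wsqrtr //; nra.
move=> eps e0; near=> n; have n0 : (0 < n)%N by near: n; exact: near_gt0.
have g1 : 1 <= ball_g R d n by near: n.
have n1 := nd1 n n0; have h2 := card_ge n n0.
(* The squared window is at most [2 * n ^ (2 * d) / sqrt n]; this threshold brings it below the
   square of [eps * n ^ d / d ^ d]. *)
have s2 : 2 * (d%:R ^+ d / eps) ^+ 2 <= Num.sqrt n%:R :> R by near: n; exact: near_sqrt_ge.
have h3 := le_trans (ler_wpM2r (sqrtr_ge0 _) (ball_g_le_rate d n0)) (ball_rate_le_sqrt d0 n0).
have e : Num.sqrt (n%:R ^+ d * ball_g R d n) ^+ 2 = n%:R ^+ d * ball_g R d n by near: n.
apply: (@le_trans _ _ (eps * (n%:R ^+ d / d%:R ^+ d))); last first.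
  by rewrite ler_pM2l // ler_pdivrMr // mulrC.
rewrite -(@ler_pXn2r _ 2) ?nnegrE ?sqrtr_ge0 //; last first.
  by rewrite mulr_ge0 ?divr_ge0 ?(ltW e0) ?(ltW dd0) //; lra.
rewrite e; set x := n%:R ^+ d; set D := d%:R ^+ d.
have -> : (eps * (x / D)) ^+ 2 = x * (x / (D / eps) ^+ 2).
  by field; rewrite ?gt_eqF.
rewrite ler_wpM2l //; first by apply: le_trans n1.
rewrite ler_pdivlMr ?exprn_gt0 ?divr_gt0 //.
rewrite -(ler_pM2l (_ : 0 < 2)) // mulrCA.
by apply: le_trans h3; rewrite ler_wpM2l //; lra.
Unshelve. all: by end_near. Qed.

End Settings.

Local Open Scope classical_set_scope.

Theorem corollary7 (R : realType) (V : nat -> finType)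
    (K : forall n, V n -> V n -> R) (w : nat -> R) (lam : nat -> R)
    (pi : forall n, @stable (V n) -> R) :
  let P := fun n => arw (K n) (lam n) (@uniform_law R (V n)) in
  let t_mix := fun n => (tmix (P n) (pi n) 2^-1)%:R : R in
  let t_sep := fun n => (tsep (P n) (pi n))%:R : R in
  [\/ setting_a K w, setting_b K w, setting_c K w | setting_d K w] ->
  (forall n, (0 < n)%N -> 0 < lam n) ->
  (forall n, (0 < n)%N -> stationary (P n) (pi n)) ->
  lam n / #|V n|%:R @[n --> \oo] --> +oo ->
  [/\ tv_cutoff P pi,
      t_mix ~_\oo t_sep,
      (setting_a K w \/ setting_c K w ->
         t_mix =Theta_\oo (fun n => n%:R * ln n%:R : R)),
      (setting_b K w \/ setting_d K w ->
         t_mix ~_\oo (fun n => #|V n|%:R : R))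
    & cutoff_window P pi w].

Proof.
move=> P t_mix t_sep set lam0 piP lamV.
have ac : setting_a K w \/ setting_c K w -> t_mix =Theta_\oo (fun n => n%:R * ln n%:R : R).
  move=> hac; have [m' hm th] : exists2 m, filling_estimates K w m &
      m =Theta_\oo (fun n => n%:R * ln n%:R : R).
    by case: hac => [/setting_a_estimates|/setting_c_estimates].
  have [_ _ eqv _] := cutoff_of_estimates hm lam0 piP lamV.
  apply: eqTheta_trans th; rewrite eqThetaE bigThetaE eqOmegaO; split.
    exact: equivOLR eqv.
  exact: equivORL eqv.
have bd : setting_b K w \/ setting_d K w -> t_mix ~_\oo (fun n => #|V n|%:R : R).
  move=> hbd; have [m hm mN] : exists2 m, filling_estimates K w m &
      m ~_\oo (fun n => #|V n|%:R : R).
    by case: hbd => [/setting_b_estimates|/setting_d_estimates].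
  have [_ _ eqv _] := cutoff_of_estimates hm lam0 piP lamV.
  exact: equiv_trans eqv mN.
have [m hm] : exists m, filling_estimates K w m.
  case: set => [/setting_a_estimates|/setting_b_estimates|/setting_c_estimates|/setting_d_estimates];
    by case=> m ? _; exists m.
by have [? ? _ ?] := cutoff_of_estimates hm lam0 piP lamV; split.
Qed.
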